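(* If a $\Gamma$-invariant $(b,\theta)$-density exists for some $\theta\in(0,\pi/2)$ (and some $b=(b_1,b_2)\in\mathbb R^2$), then $$\delta_\theta(\Gamma)\le b_1\cos\theta+b_2\sin\theta .$$
   Context: Setting. A Hadamard space is a complete geodesic CAT(0) metric space. $(X_1,d_1)$, $(X_2,d_2)$ are locally compact Hadamard spaces, and $X=X_1\times X_2$ carries the metric $d=\sqrt{d_1^2+d_2^2}$. $\partial X$, $\partial X_i$ are the geometric boundaries (classes of asymptotic geodesic rays, cone topology). An isometry $h$ of a Hadamard space is axial if there are $l>0$ and a geodesic line $\sigma$ with $h(\sigma(t))=\sigma(t+l)$ for all $t\in\mathbb R$; such $\sigma$ is an axis. It is rank one if it has an axis which does not bound a flat half-plane. Two rank one isometries are independent if their fixed point sets in the geometric boundary are disjoint. $\Gamma\subset \mathrm{Is}(X_1)\times \mathrm{Is}(X_2)$ is a discrete group containing elements $g=(g_1,g_2)$ and $h=(h_1,h_2)$ such that for $i=1,2$, $g_i$ and $h_i$ are independent rank one isometries of $X_i$. $o=(o_1,o_2)\in X$ is a fixed base point. Limit set and slope. $L_\Gamma=\overline{\Gamma\cdot x}\cap\partial X$ (independent of $x\in X$). Every geodesic ray in $X$ has the form $\sigma(t)=(\sigma_1(t\cos\theta),\sigma_2(t\sin\theta))$ with geodesic rays $\sigma_i$ in $X_i$ and $\theta\in[0,\pi/2]$ its slope, which depends only on the boundary point. $\partial X_\theta$ is the set of points of $\partial X$ of slope $\theta$; for $\theta\in(0,\pi/2)$ it is identified with $\partial X_1\times\partial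 X_2$ and its points are written $(\eta_1,\eta_2,\theta)$. Exponent of growth. $\delta_\theta(\Gamma)=\liminf_{\varepsilon\to0}\limsup_{n\to\infty}\frac1n\log N_\theta^\varepsilon(n)$, where $N_\theta^\varepsilon(n)=\#\{\gamma=(\gamma_1,\gamma_2)\in\Gamma: n-1<d(o,\gamma o)\le n,\ |\arctan\frac{d_2(o_2,\gamma_2o_2)}{d_1(o_1,\gamma_1o_1)}-\theta|<\varepsilon\}$ (with $\arctan(a/0)=\pi/2$ for $a>0$). $(b,\theta)$-density. For $\eta_i\in\partial X_i$, $\mathcal B_{\eta_i}(x_i,y_i)=\lim_{t\to\infty}(d_i(x_i,\sigma(t))-d_i(y_i,\sigma(t)))$, $\sigma$ any ray in the class of $\eta_i$. $\mathcal M^+(\partial X)$ is the cone of positive finite Borel measures on $\partial X$ (weak topology). For $\theta\in(0,\pi/2)$ and $b=(b_1,b_2)\in\mathbb R^2$, a $\Gamma$-invariant $(b,\theta)$-density is a continuous map $\mu:X\to\mathcal M^+(\partial X)$, $x\mapsto\mu_x$, such that for all $x=(x_1,x_2)\in X$: (i) $\emptyset\ne\mathrm{supp}(\mu_x)\subseteq L_\Gamma\cap\partial X_\theta$; (ii) $\gamma_*\mu_x=\mu_{\gamma x}$ for all $\gamma\in\Gamma$, where $\gamma_*\mu_x(E)=\mu_x(\gamma^{-1}E)$; (iii) $\frac{d\mu_x}{d\mu_o}(\tilde\eta)=e^{b_1\mathcal B_{\eta_1}(o_1,x_1)+b_2\mathcal B_{\eta_2}(o_2,x_2)}$ for all $\tilde\eta=(\eta_1,\eta_2,\theta)\in\mathrm{supp}(\mu_o)$.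 *)

(* Defs.v *)
From HB Require Import structures.
From mathcomp Require Import all_boot all_order all_algebra.
From mathcomp Require Import all_classical all_reals all_analysis.
From mathcomp Require Import ring lra.

Set Implicit Arguments.
Unset Strict Implicit.
Unset Printing Implicit Defensive.

Import Order.TTheory GRing.Theory Num.Theory.
Import numFieldTopology.Exports numFieldNormedType.Exports.

Local Open Scope classical_set_scope.
Local Open Scope ring_scope.
Local Open Scope charge_scope.

(* A copy of the cartesian product: the library's own uniform structure on
   [X1 * X2] has the maximum metric. *)
Definition l2prod_type (R : realType) (X1 X2 : metricType R) : Type :=
  (X1 * X2)%type.

Section l2prod_metric.
Context (R : realType) (X1 X2 : metricType R).
Local Notation X := (l2prod_type X1 X2).

HB.instance Definition _ := Choice.copy X (X1 * X2)%type.

Definition l2dist (x y : X) : R :=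
  Num.sqrt (mdist x.1 y.1 ^+ 2 + mdist x.2 y.2 ^+ 2).

Lemma l2distxx x : l2dist x x = 0.
Proof. by rewrite /l2dist !metric_structure.mdistxx expr0n addr0 sqrtr0. Qed.

Lemma l2dist_positivity x y : l2dist x y = 0 -> x = y.
Proof.
move=> /eqP; rewrite sqrtr_eq0 => le0.
have p1 := sqr_ge0 (mdist x.1 y.1); have p2 := sqr_ge0 (mdist x.2 y.2).
have /eqP : mdist x.1 y.1 ^+ 2 = 0 by apply/eqP; rewrite eq_le p1 andbT; lra.
have /eqP : mdist x.2 y.2 ^+ 2 = 0 by apply/eqP; rewrite eq_le p2 andbT; lra.
rewrite !sqrf_eq0 => /eqP /mdist_positivity e2 /eqP /mdist_positivity e1.
by rewrite (surjective_pairing x) (surjective_pairing y) e1 e2.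
Qed.

Lemma l2dist_sym x y : l2dist x y = l2dist y x.
Proof. by rewrite /l2dist metric_sym (metric_sym x.2). Qed.

Lemma l2dist_triangle y x z : l2dist x z <= l2dist x y + l2dist y z.
Proof.
rewrite /l2dist.
have t1 := metric_triangle x.1 y.1 z.1.
have t2 := metric_triangle x.2 y.2 z.2.
have a0 := mdist_ge0 x.1 y.1; have b0 := mdist_ge0 x.2 y.2.
have c0 := mdist_ge0 y.1 z.1; have d0 := mdist_ge0 y.2 z.2.
have e0 := mdist_ge0 x.1 z.1; have f0 := mdist_ge0 x.2 z.2.
move: t1 t2 a0 b0 c0 d0 e0 f0.
move: (mdist x.1 y.1) (mdist x.2 y.2) (mdist y.1 z.1) (mdist y.2 z.2)
      (mdist x.1 z.1) (mdist x.2 z.2) => a b c d e f t1 t2 a0 b0 c0 d0 e0 f0.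
have p0 : 0 <= a ^+ 2 + b ^+ 2 by rewrite addr_ge0 ?sqr_ge0.
have q0 : 0 <= c ^+ 2 + d ^+ 2 by rewrite addr_ge0 ?sqr_ge0.
have s0 := sqrtr_ge0 (a ^+ 2 + b ^+ 2).
have r0 := sqrtr_ge0 (c ^+ 2 + d ^+ 2).
have cs : a * c + b * d <=
    Num.sqrt (a ^+ 2 + b ^+ 2) * Num.sqrt (c ^+ 2 + d ^+ 2).
  rewrite -sqrtrM// -[leLHS]ger0_norm ?addr_ge0 ?mulr_ge0// -sqrtr_sqr.
  by apply: ler_wsqrtr; have := sqr_ge0 (a * d - b * c); nra.
rewrite -[leRHS]ger0_norm ?addr_ge0// -sqrtr_sqr; apply: ler_wsqrtr.
rewrite sqrrD !sqr_sqrtr//.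
have : e ^+ 2 <= (a + c) ^+ 2 by rewrite ler_sqr ?nnegrE ?addr_ge0.
have : f ^+ 2 <= (b + d) ^+ 2 by rewrite ler_sqr ?nnegrE ?addr_ge0.
nra.
Qed.

HB.instance Definition _ := isMetric.Build R X
  l2distxx l2dist_positivity l2dist_sym l2dist_triangle.

End l2prod_metric.

Definition l2prod (R : realType) (X1 X2 : metricType R) : metricType R :=
  l2prod_type X1 X2.

Definition euclidean_plane (R : realType) : metricType R := l2prod R^o R^o.

Section geodesics.
Context (R : realType) (M : metricType R).
Implicit Types (x y z : M) (c : R -> M).

(* Segments and rays are encoded by total functions; their values outside
   [0, mdist x y], resp. [0, +oo[, are irrelevant. *)
Definition is_segment x y c : Prop :=
  [/\ c 0 = x, c (mdist x y) = y &
      {in `[0, mdist x y] &, forall s t, mdist (c s) (c t) = `|s - t|}].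

Definition is_ray c : Prop :=
  forall s t, 0 <= s -> 0 <= t -> mdist (c s) (c t) = `|s - t|.

Definition is_line c : Prop := forall s t, mdist (c s) (c t) = `|s - t|.

Definition geodesic_space : Prop := forall x y, exists c, is_segment x y c.

(* [x', y', z'] is a comparison triangle; [p'] and [q'] are the comparison
   points of [a s] and [b t].  Two distinct sides of a triangle share a vertex,
   here [x]; for two points on the same side the inequality is an equality. *)
Definition CAT0 : Prop :=
  forall x y z (a b : R -> M), is_segment x y a -> is_segment x z b ->
  forall x' y' z' : euclidean_plane R,
    mdist x' y' = mdist x y -> mdist y' z' = mdist y z ->
    mdist x' z' = mdist x z ->
  forall s t, 0 <= s <= mdist x y -> 0 <= t <= mdist x z ->
  forall p' q' : euclidean_plane R,
    mdist x' p' = s -> mdist p' y' = mdist x y - s ->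
    mdist x' q' = t -> mdist q' z' = mdist x z - t ->
  mdist (a s) (b t) <= mdist p' q'.

Definition complete_space : Prop :=
  forall F : set_system M, ProperFilter F -> cauchy F -> exists x, F --> x.

Definition hadamard : Prop := [/\ complete_space, geodesic_space & CAT0].

Definition is_isometry (f : M -> M) : Prop :=
  (forall x y, mdist (f x) (f y) = mdist x y) /\ (forall y, exists x, f x = y).

End geodesics.

Section boundary.
Context (R : realType) (M : metricType R).

Record ray := Ray { ray_fun :> R -> M ; _ : `[< is_ray ray_fun >] }.
HB.instance Definition _ := [isSub for ray_fun].
HB.instance Definition _ := [Choice of ray by <:].

Definition asymptotic (s t : ray) : bool :=
  `[< exists K : R, forall u, 0 <= u -> mdist (s u) (t u) <= K >].

Lemma asymptotic_refl : reflexive asymptotic.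
Proof.
by move=> s; apply/asboolP; exists 0 => u _; rewrite metric_structure.mdistxx.
Qed.

Lemma asymptotic_sym : symmetric asymptotic.
Proof.
by move=> s t; apply/asbool_equiv_eq; split=> -[K HK]; exists K => u u0;
  rewrite metric_sym HK.
Qed.

Lemma asymptotic_trans : transitive asymptotic.
Proof.
move=> t s v /asboolP[K HK] /asboolP[L HL]; apply/asboolP.
exists (K + L) => u u0.
by rewrite (le_trans (metric_triangle _ (t u) _))// lerD ?HK ?HL.
Qed.

Canonical asymptotic_equiv :=
  EquivRel asymptotic asymptotic_refl asymptotic_sym asymptotic_trans.

Definition boundary : Type := {eq_quot asymptotic_equiv}%qT.
HB.instance Definition _ := Choice.on boundary.

Definition endpoint (s : ray) : boundary :=
  (\pi_({eq_quot asymptotic_equiv}) s)%qT.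

Definition endray (xi : boundary) : ray :=
  (repr (xi : {eq_quot asymptotic_equiv}))%qT.

(* The geometric compactification: [inl] are the points of [M], [inr] the
   boundary points. *)
Definition bordification : Type := (M + boundary)%type.
HB.instance Definition _ := Choice.on bordification.

(* The points z with d(c(0), z) > r such that the geodesic from c(0) to z
   passes at distance less than e from c(r) at time r. *)
Definition cone_nbhd (c : ray) (r e : R) : set bordification :=
  [set z | match z with
           | inl y => r < mdist (c 0) y /\
               exists2 a, is_segment (c 0) y a & mdist (a r) (c r) < e
           | inr xi =>
               exists a : ray, [/\ endpoint a = xi, a 0 = c 0 &
                                   mdist (a r) (c r) < e]
           end].

(* The rays c have arbitrary origins: for a Hadamard space, restricting
   to a fixed origin gives the same topology. *)
Definition cone_subbase : set (set bordification) :=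
  [set U | (exists x r, U = inl @` ball (x : M) r) \/
           (exists c r e, [/\ 0 < r, 0 < e & U = cone_nbhd c r e])].

HB.instance Definition _ :=
  @isSubBaseTopological.Build bordification (set bordification) cone_subbase id.

HB.instance Definition _ := Topological.copy boundary
  (initial_topology (inr : boundary -> bordification)).

(* [boundary_at xi0] is the boundary marked at [xi0], because the library's
   measurable types are pointed and a boundary may be empty. *)
Definition boundary_at (xi0 : boundary) : Type := boundary.
HB.instance Definition _ (xi0 : boundary) := Topological.on (boundary_at xi0).
HB.instance Definition _ (xi0 : boundary) :=
  isPointed.Build (boundary_at xi0) xi0.

Definition borel_boundary (xi0 : boundary) :=
  g_sigma_algebraType (open : set (set (boundary_at xi0))).
HB.instance Definition _ (xi0 : boundary) := Measurable.on (borel_boundary xi0).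
HB.instance Definition _ (xi0 : boundary) :=
  Topological.copy (borel_boundary xi0) (boundary_at xi0).

(* The class of f \o s, for s in the class xi.  The default value of [insubd]
   is never used when f is an isometry. *)
Definition boundary_map (f : M -> M) (xi : boundary) : boundary :=
  endpoint (insubd (endray xi) (f \o endray xi)).

Definition busemann (xi : boundary) (x y : M) : R :=
  lim ((mdist x (endray xi t) - mdist y (endray xi t)) @[t --> +oo]).

End boundary.

Section rank_one.
Context (R : realType) (M : metricType R).
Implicit Types (h : M -> M) (c : R -> M).

Definition is_axis h c : Prop :=
  is_line c /\ exists2 l : R, 0 < l & forall t, h (c t) = c (t + l).

Definition axial h : Prop := is_isometry h /\ exists c, is_axis h c.

Definition bounds_flat_half_plane c : Prop :=
  exists F : euclidean_plane R -> M,
    (forall s, F (s, 0) = c s) /\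
    (forall p q : euclidean_plane R, 0 <= p.2 -> 0 <= q.2 ->
       mdist (F p) (F q) = mdist p q).

Definition rank_one h : Prop :=
  axial h /\ exists2 c, is_axis h c & ~ bounds_flat_half_plane c.

Definition fixed_boundary h : set (boundary M) :=
  [set xi | boundary_map h xi = xi].

Definition independent g h : Prop :=
  fixed_boundary g `&` fixed_boundary h = set0.

End rank_one.

Section product.
Context (R : realType) (X1 X2 : metricType R).
Local Notation X := (l2prod X1 X2).
Local Notation G := ((X1 -> X1) * (X2 -> X2))%type.
Implicit Types (Gamma : set G) (o x : X).

Definition prod_act (gamma : G) (x : X) : X := (gamma.1 x.1, gamma.2 x.2).

Definition isometry_group Gamma : Prop :=
  [/\ forall gamma, Gamma gamma -> is_isometry gamma.1 /\ is_isometry gamma.2,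
      Gamma (id, id),
      forall gamma gamma', Gamma gamma -> Gamma gamma' ->
        Gamma (gamma.1 \o gamma'.1, gamma.2 \o gamma'.2) &
      forall gamma, Gamma gamma -> exists gamma', [/\ Gamma gamma',
        cancel gamma.1 gamma'.1 & cancel gamma.2 gamma'.2]].

Definition discrete_group Gamma : Prop :=
  forall gamma, Gamma gamma -> isolated
    (Gamma : set ({compact-open, X1 -> X1} * {compact-open, X2 -> X2})) gamma.

Definition limit_set Gamma x : set (boundary X) :=
  [set xi | closure
     [set (inl (prod_act gamma x) : bordification X) | gamma in Gamma]
     (inr xi)].

(* xi = (eta1, eta2, theta) *)
Definition has_coordinates (xi : boundary X)
    (eta1 : boundary X1) (eta2 : boundary X2) (theta : R) : Prop :=
  exists (c : ray X) (c1 : ray X1) (c2 : ray X2),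
    [/\ endpoint c = xi, endpoint c1 = eta1, endpoint c2 = eta2 &
        forall t, 0 <= t -> c t = (c1 (t * cos theta), c2 (t * sin theta))].

Definition boundary_slope (theta : R) : set (boundary X) :=
  [set xi | exists eta1 eta2, has_coordinates xi eta1 eta2 theta].

Definition angle_of (d1 d2 : R) : R :=
  if d1 == 0 then pi / 2 else atan (d2 / d1).

Definition orbit_count Gamma o (theta eps : R) (n : nat) : \bar R :=
  counting [set gamma | Gamma gamma /\
    [/\ n%:R - 1 < mdist o (prod_act gamma o) <= n%:R &
        `|angle_of (mdist o.1 (gamma.1 o.1)) (mdist o.2 (gamma.2 o.2)) - theta|
          < eps]].

(* [lne 0 = -oo] *)
Definition growth_exponent Gamma o (theta : R) : \bar R :=
  limf_einf (fun eps : R =>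
    limn_esup (fun n => (n%:R^-1)%:E * lne (orbit_count Gamma o theta eps n))%E)
  (0 : R)^'+.

Definition msupport (xi0 : boundary X)
    (mu : set (borel_boundary xi0) -> \bar R) : set (boundary X) :=
  [set xi | forall U : set (boundary X), open_nbhs xi U -> (0 < mu U)%E].

(* Continuity of [mu] is for the weak topology, the coarsest one making
   all [\int[.]_xi f xi], f continuous, continuous. *)
Definition is_density Gamma o (b1 b2 theta : R) (xi0 : boundary X)
    (mu : X -> {finite_measure set (borel_boundary xi0) -> \bar R}) : Prop :=
  (forall f : boundary X -> R, continuous f ->
     continuous (fun x => \int[mu x]_xi f xi)) /\
  forall x : X,
    [/\ msupport (mu x) !=set0 /\
          msupport (mu x) `<=` limit_set Gamma o `&` boundary_slope theta,
        forall gamma, Gamma gamma ->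
          forall E : set (borel_boundary xi0), measurable E ->
          mu x (boundary_map (prod_act gamma) @^-1` E) =
          mu (prod_act gamma x) E,
        mu x `<< mu o &
        {ae mu o, forall xi, msupport (mu o) xi ->
          forall eta1 eta2, has_coordinates xi eta1 eta2 theta ->
          ('d (charge_of_finite_measure (mu x)) '/d (mu o)) xi =
          (expR (b1 * busemann eta1 o.1 x.1 + b2 * busemann eta2 o.2 x.2))%:E}].

Definition density_exists Gamma o (b1 b2 theta : R) : Prop :=
  exists (xi0 : boundary X)
    (mu : X -> {finite_measure set (borel_boundary xi0) -> \bar R}),
    is_density Gamma o b1 b2 theta mu.

End product.

(* Main.v *)
(* The argument is a shadow lemma.  A rank one axis contracts: a segment whose
   endpoints have distant feet on it passes near the axis.  By playing
   the four axis directions of [g] and [h] against each other in both factors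
   at once, finitely many group elements suffice to move any boundary point of
   slope theta into the shadow of one fixed ball [B] around [o], whatever
   the light source.  A density therefore gives these shadows a mass bounded
   from below, and by conformality the shadow of [gamma B] seen from [o] has
   mass at least [c exp (- b1 d1(o1, gamma1 o1) - b2 d2(o2, gamma2 o2))].
   By discreteness a boundary point of slope theta lies in polynomially many, in
   [n], of the shadows with [d(o, gamma o) <= n], since a ray meets boundedly
   many translates of [B] near any given pair of times in the two factors.
   Summing over the [gamma] of slope close to theta in the [n]-th annulus, the
   finite total mass bounds their number by a polynomial times
   [exp (n (b1 cos theta + b2 sin theta + epsilon))]. *)

Require Import Defs.
From mathcomp Require Import all_boot all_order all_algebra.
From mathcomp Require Import all_classical all_reals all_analysis.
From mathcomp Require Import measurable_realfun ring lra zify.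

Set Implicit Arguments.
Unset Strict Implicit.
Unset Printing Implicit Defensive.

Import Order.TTheory GRing.Theory Num.Theory.
Import numFieldTopology.Exports numFieldNormedType.Exports.
Local Open Scope classical_set_scope.
Local Open Scope ring_scope.

(** Flat half-planes arise in one way: if points [y_n] escape and [d(y_n, c t) - d(y_n, c 0)] tends
    to [k * t] with [|k| < 1], the limits of the segments from the points of [c] to [y_n] sweep out
    a flat half-plane bounded by [c]. Contraction is proved by contradiction: bad configurations,
    recentred by the translations of the axis so that limits exist, yield such a sequence. The
    obstacle in a product is that one group element acts on both factors, so a choice that is good
    in one may be bad in the other. Each factor forbids at most one direction and the previous
    choice forbids one more, which is why four directions are enough. Moreover nothing synchronises
    the times at which the two components of a ray pass near the target. Shadows therefore have one
    time for each factor; the price is a multiplicity quadratic in [n], which the exponential rate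
    does not see. *)

Local Notation mcvgP := metricType_numDomainType.cvgrPdist_lt.

(** * Geodesics in nonpositively curved spaces *)

Section npc.
Context {R : realType}.

(* The inequality of Bruhat and Tits at all points of the segment, not only at
   the midpoint. *)
Definition npc (M : metricType R) : Prop :=
  forall (x y : M) (t : R), 0 <= t <= 1 -> exists m, forall z,
    mdist z m ^+ 2 <= (1 - t) * mdist z x ^+ 2 + t * mdist z y ^+ 2
                      - t * (1 - t) * mdist x y ^+ 2.

Context {M : metricType R} (hM : npc M).
Local Notation d := (@mdist R M).
Implicit Types (x y z w : M) (s t : R).

Lemma mdistxx x : d x x = 0. Proof. exact: metric_structure.mdistxx. Qed.

Definition pt x y (t : R) : M :=
  match pselect (0 <= t <= 1) with
  | left h => sval (cid (hM x y h))
  | right _ => x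
  end.

Lemma ptP x y t z : 0 <= t <= 1 ->
  d z (pt x y t) ^+ 2 <= (1 - t) * d z x ^+ 2 + t * d z y ^+ 2
                         - t * (1 - t) * d x y ^+ 2.
Proof. by rewrite /pt; case: pselect => // h _; case: cid => m /=. Qed.

(** At [z := m] the right side of the inequality is at most 0, which forces [m] onto the point.
    Geodesics are unique for this reason. *)
Lemma pt_unique x y t m : 0 <= t <= 1 ->
  d x m <= t * d x y -> d m y <= (1 - t) * d x y -> m = pt x y t.
Proof.
move=> t01 xm my; apply: mdist_positivity; apply/eqP; rewrite -sqrf_eq0.
rewrite eq_le sqr_ge0 andbT; apply: le_trans (ptP x y m t01) _.
rewrite (metric_sym m x); have [t0 t1] := andP t01.
have xm0 := mdist_ge0 x m; have my0 := mdist_ge0 m y.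
have h1 : d x m ^+ 2 <= (t * d x y) ^+ 2 by rewrite lerXn2r ?nnegrE //; lra.
have h2 : d m y ^+ 2 <= ((1 - t) * d x y) ^+ 2 by rewrite lerXn2r ?nnegrE //; lra.
have h3 : (1 - t) * d x m ^+ 2 <= (1 - t) * (t * d x y) ^+ 2.
  by rewrite ler_wpM2l// subr_ge0.
have h4 : t * d m y ^+ 2 <= t * ((1 - t) * d x y) ^+ 2 by rewrite ler_wpM2l.
have -> : 0 = (1 - t) * (t * d x y) ^+ 2 + t * ((1 - t) * d x y) ^+ 2
   - t * (1 - t) * d x y ^+ 2 by ring.
lra.
Qed.

Lemma d_pt_le x y t : 0 <= t <= 1 -> d x (pt x y t) <= t * d x y.
Proof.
move=> t01; have [t0 t1] := andP t01.
rewrite -ler_sqr ?nnegrE ?mulr_ge0 ?mdist_ge0//.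
apply: le_trans (ptP x y x t01) _; rewrite mdistxx expr0n/= mulr0 add0r.
by rewrite le_eqVlt; apply/orP; left; apply/eqP; ring.
Qed.

Lemma d_pt_le' x y t : 0 <= t <= 1 -> d (pt x y t) y <= (1 - t) * d x y.
Proof.
move=> t01; have [t0 t1] := andP t01; rewrite metric_sym.
rewrite -ler_sqr ?nnegrE ?mulr_ge0 ?mdist_ge0 ?subr_ge0//.
apply: le_trans (ptP x y y t01) _; rewrite mdistxx expr0n/= mulr0 addr0.
rewrite (metric_sym y x).
by rewrite le_eqVlt; apply/orP; left; apply/eqP; ring.
Qed.

Lemma d_pt x y t : 0 <= t <= 1 -> d x (pt x y t) = t * d x y.
Proof.
move=> t01; have h1 := d_pt_le x y t01; have h2 := d_pt_le' x y t01.
have h3 := metric_triangle x (pt x y t) y; lra.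
Qed.

Lemma d_pt' x y t : 0 <= t <= 1 -> d (pt x y t) y = (1 - t) * d x y.
Proof.
move=> t01; have h1 := d_pt_le x y t01; have h2 := d_pt_le' x y t01.
have h3 := metric_triangle x (pt x y t) y; lra.
Qed.

Lemma pt0 x y : pt x y 0 = x.
Proof.
have h : 0 <= (0 : R) <= 1 by apply/andP; split; lra.
by have := d_pt x y h; rewrite mul0r => /mdist_positivity.
Qed.

Lemma pt1 x y : pt x y 1 = y.
Proof.
have h : 0 <= (1 : R) <= 1 by apply/andP; split; lra.
by have := d_pt' x y h; rewrite subrr mul0r => /mdist_positivity.
Qed.

Lemma ptC x y t : 0 <= t <= 1 -> pt y x (1 - t) = pt x y t.
Proof.
move=> t01; have [t0 t1] := andP t01.
have s01 : 0 <= 1 - t <= 1 by apply/andP; split; lra.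
apply: pt_unique => //.
  by rewrite metric_sym d_pt' // (metric_sym y x); lra.
by rewrite metric_sym d_pt // (metric_sym y x).
Qed.

(** The inequality is used twice: for the segment to [z] seen from a point of the segment to [y],
    and for the segment to [y] seen from [z]. What remains is [t ^+ 2 * d y z ^+ 2]. *)
Lemma pt_convex1 x y z t : 0 <= t <= 1 ->
  d (pt x y t) (pt x z t) <= t * d y z.
Proof.
move=> t01; have [t0 t1] := andP t01.
rewrite -ler_sqr ?nnegrE ?mulr_ge0 ?mdist_ge0//.
have h1 := ptP x z (pt x y t) t01.
have h2 := ptP x y z t01.
rewrite (metric_sym (pt x y t) x) d_pt// in h1.
rewrite (metric_sym (pt x y t) z) in h1.
have h3 : t * d z (pt x y t) ^+ 2 <=
   t * ((1 - t) * d z x ^+ 2 + t * d z y ^+ 2 - t * (1 - t) * d x y ^+ 2).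
  by rewrite ler_wpM2l.
rewrite (metric_sym z x) (metric_sym z y) in h3.
apply: le_trans h1 _; apply: le_trans (lerB (lerD (lexx _) h3) (lexx _)) _.
by rewrite le_eqVlt; apply/orP; left; apply/eqP; ring.
Qed.

Lemma pt_convex x y x' y' t : 0 <= t <= 1 ->
  d (pt x y t) (pt x' y' t) <= (1 - t) * d x x' + t * d y y'.
Proof.
move=> t01; have [t0 t1] := andP t01.
have s01 : 0 <= 1 - t <= 1 by apply/andP; split; lra.
have h1 := pt_convex1 x y y' t01.
have h2 := pt_convex1 y' x x' s01.
rewrite ptC// in h2; rewrite ptC// in h2.
have := metric_triangle (pt x y t) (pt x y' t) (pt x' y' t); lra.
Qed.

(** The midpoint of [x] and [z] is seen from [y] and from [w]; its distances to them add up to at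
    least [d y w]. *)
Lemma quadrilateral x y z w :
  d x z ^+ 2 + d y w ^+ 2 <=
  d x y ^+ 2 + d y z ^+ 2 + d z w ^+ 2 + d w x ^+ 2.
Proof.
have h : 0 <= (1 / 2 : R) <= 1 by apply/andP; split; lra.
have h1 := ptP x z y h; have h2 := ptP x z w h.
have h3 := metric_triangle y (pt x z (1 / 2)) w.
move: h1 h2 h3; rewrite (metric_sym (pt _ _ _) w) (metric_sym y x) (metric_sym w z).
have := mdist_ge0 y (pt x z (1 / 2)); have := mdist_ge0 w (pt x z (1 / 2)).
have := mdist_ge0 y w.
move: (d y (pt _ _ _)) (d w (pt _ _ _)) => a b c0 b0 a0 h1 h2 h3.
have : d y w ^+ 2 <= (a + b) ^+ 2 by rewrite lerXn2r ?nnegrE ?addr_ge0.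
have := sqr_ge0 (a - b); nra.
Qed.

Definition geo x y (t : R) : M := pt x y (t / d x y).

Lemma ratio01 (t a : R) : 0 <= t <= a -> 0 <= t / a <= (1 : R).
Proof.
move=> /andP[t0 ta]; have a0 : 0 <= a by lra.
rewrite divr_ge0//=; move: a0; rewrite le_eqVlt => /orP[/eqP <-|a0].
  by rewrite invr0 mulr0 ler01.
by rewrite ler_pdivrMr// mul1r.
Qed.

Lemma ratioK (t a : R) : 0 <= t <= a -> t / a * a = t.
Proof.
move=> /andP[t0 ta]; have [a0|a0] := eqVneq a 0; last by rewrite divfK.
by rewrite a0 mulr0; lra.
Qed.

Lemma d_geo x y t : 0 <= t <= d x y -> d x (geo x y t) = t.
Proof. by move=> h; rewrite /geo d_pt ?ratio01// ratioK. Qed.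

Lemma d_geo' x y t : 0 <= t <= d x y -> d (geo x y t) y = d x y - t.
Proof. by move=> h; rewrite /geo d_pt' ?ratio01// mulrBl mul1r ratioK. Qed.

Lemma geo_unique x y t m : 0 <= t <= d x y ->
  d x m <= t -> d m y <= d x y - t -> m = geo x y t.
Proof.
move=> h xm my; apply: pt_unique; first exact: ratio01.
  by rewrite ratioK.
by rewrite mulrBl mul1r ratioK.
Qed.

Lemma geo_geo x y s t : 0 <= s <= t -> t <= d x y ->
  geo x (geo x y t) s = geo x y s.
Proof.
move=> /andP[s0 st] t1.
have ht : 0 <= t <= d x y by apply/andP; split; lra.
have hs : 0 <= s <= d x (geo x y t) by rewrite d_geo// s0.
apply: geo_unique; first by apply/andP; split; lra.
  by rewrite d_geo.
have := metric_triangle (geo x (geo x y t) s) (geo x y t) y.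
by rewrite d_geo' // d_geo' // d_geo //; lra.
Qed.

Lemma d_geo_geo x y s t : 0 <= s <= d x y -> 0 <= t <= d x y ->
  d (geo x y s) (geo x y t) = `|s - t|.
Proof.
wlog st : s t / s <= t => [hw hs ht|hs ht].
  have /orP[st|ts] := le_total s t; first exact: hw.
  by rewrite metric_sym distrC hw.
have [s0 s1] := andP hs; have [t0 t1] := andP ht.
rewrite distrC ger0_norm ?subr_ge0//.
have hs' : 0 <= s <= d x (geo x y t) by rewrite d_geo// s0.
by rewrite -(geo_geo (y := y) (t := t)) ?s0// d_geo'// d_geo.
Qed.

(* Two geodesics from [x] and [x'] to a common endpoint are compared at equal
   times, although their lengths differ. *)
Lemma geo_fellow x x' y t : 0 <= t <= d x y -> t <= d x' y ->
  d (geo x y t) (geo x' y t) <= 2 * d x x'.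
Proof.
move=> ht t2; have [t0 t1] := andP ht.
have [xy0|xy0] := eqVneq (d x y) 0.
  have -> : t = 0 by lra.
  by rewrite /geo !mul0r !pt0; have := mdist_ge0 x x'; lra.
have xyp : 0 < d x y by rewrite lt_neqAle eq_sym xy0 mdist_ge0.
(* Convexity compares points at equal proportion; passing to equal time costs at most the difference
   of the lengths, hence the factor 2. *)
have h1 := pt_convex x y x' y (ratio01 ht).
rewrite -/(geo x y t) mdistxx mulr0 addr0 in h1.
have ht' : 0 <= t / d x y * d x' y <= d x' y.
  have /andP[r0 r1] := ratio01 ht; rewrite mulr_ge0 ?mdist_ge0//=.
  by rewrite ler_piMl// mdist_ge0.
have e : pt x' y (t / d x y) = geo x' y (t / d x y * d x' y).
  rewrite /geo; have [e0|e0] := eqVneq (d x' y) 0; last by rewrite mulfK.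
  by have -> : t = 0; [lra|rewrite !mul0r].
have ht2 : 0 <= t <= d x' y by rewrite t0.
have h2 := metric_triangle (geo x y t) (pt x' y (t / d x y)) (geo x' y t).
rewrite [in X in _ + X]e d_geo_geo// in h2.
have -> : 2 * d x x' = d x x' + d x x' by ring.
apply: le_trans h2 _; apply: lerD.
  apply: le_trans h1 _; rewrite ler_piMl ?mdist_ge0//.
  by have /andP[] := ratio01 ht; lra.
have -> : t / d x y * d x' y - t = t / d x y * (d x' y - d x y).
  by rewrite mulrBr divfK.
rewrite normrM ger0_norm ?divr_ge0 ?mdist_ge0//.
have h3 : `|d x' y - d x y| <= d x x'.
  have := metric_triangle x' x y; have := metric_triangle x x' y.
  by rewrite (metric_sym x' x) ler_norml => ? ?; apply/andP; split; lra.
apply: le_trans (_ : `|d x' y - d x y| <= _) => //.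
by rewrite ler_piMl//; have /andP[] := ratio01 ht.
Qed.

End npc.

(** * Metric products and comparison triangles *)

Section l2prod.
Context {R : realType}.

Lemma l2dist_sqr (X1 X2 : metricType R) (x y : l2prod X1 X2) :
  mdist x y ^+ 2 = mdist x.1 y.1 ^+ 2 + mdist x.2 y.2 ^+ 2.
Proof. by rewrite [mdist x y]/mdist/= /l2dist sqr_sqrtr// addr_ge0 ?sqr_ge0. Qed.

Lemma mdist_fst_le (X1 X2 : metricType R) (x y : l2prod X1 X2) :
  mdist x.1 y.1 <= mdist x y.
Proof.
by rewrite -ler_sqr ?nnegrE ?mdist_ge0// l2dist_sqr lerDl sqr_ge0.
Qed.

Lemma mdist_snd_le (X1 X2 : metricType R) (x y : l2prod X1 X2) :
  mdist x.2 y.2 <= mdist x y.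
Proof.
by rewrite -ler_sqr ?nnegrE ?mdist_ge0// l2dist_sqr lerDr sqr_ge0.
Qed.

Lemma mdist_le_add (X1 X2 : metricType R) (x y : l2prod X1 X2) :
  mdist x y <= mdist x.1 y.1 + mdist x.2 y.2.
Proof.
have a0 := mdist_ge0 x.1 y.1; have b0 := mdist_ge0 x.2 y.2.
rewrite -ler_sqr ?nnegrE ?addr_ge0 ?mdist_ge0// l2dist_sqr; nra.
Qed.

Lemma npc_l2prod (X1 X2 : metricType R) : npc X1 -> npc X2 ->
  npc (l2prod X1 X2).
Proof.
move=> h1 h2 x y t t01.
have [m1 hm1] := h1 x.1 y.1 t t01; have [m2 hm2] := h2 x.2 y.2 t t01.
exists ((m1, m2) : l2prod X1 X2) => z; rewrite !l2dist_sqr/=.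
by have := hm1 z.1; have := hm2 z.2; lra.
Qed.

Lemma plane_distE (p q : euclidean_plane R) (r : R) : 0 <= r ->
  (p.1 - q.1) ^+ 2 + (p.2 - q.2) ^+ 2 = r ^+ 2 -> mdist p q = r.
Proof.
move=> r0 e; apply/eqP; rewrite -(@eqrXn2 _ 2) ?mdist_ge0//.
rewrite l2dist_sqr -e /mdist/=.
by rewrite !real_normK ?num_real// -(sqrrN (p.1 - _)) -(sqrrN (p.2 - _)) !opprB.
Qed.

Lemma plane_dist_sqr (p q : euclidean_plane R) :
  mdist p q ^+ 2 = (p.1 - q.1) ^+ 2 + (p.2 - q.2) ^+ 2.
Proof.
rewrite l2dist_sqr /mdist/=.
by rewrite !real_normK ?num_real// -(sqrrN (p.1 - _)) -(sqrrN (p.2 - _)) !opprB.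
Qed.

(** Place the comparison triangle with [x'] at the origin and [y'] on the first axis. Comparing a
    point of one side with the endpoint [z] of the other gives the inequality, which is an equality
    in the plane. *)
Lemma CAT0_npc (M : metricType R) : geodesic_space M -> CAT0 M -> npc M.
Proof.
move=> hg hc x y t /andP[t0 t1].
have [a ha] := hg x y; exists (a (t * mdist x y)) => z.
have [b hb] := hg x z.
have [[a0 a1 aa] [b0 b1 bb]] := (ha, hb).
have D0 := mdist_ge0 x y; have c0 := mdist_ge0 x z; have e0 := mdist_ge0 y z.
have tr1 := metric_triangle x y z; have tr2 := metric_triangle y x z.
have tr3 := metric_triangle x z y.
rewrite (metric_sym y x) in tr2; rewrite (metric_sym z y) in tr3.
have [D00|Dn0] := eqVneq (mdist x y) 0.
  have e := mdist_positivity _ _ D00.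
  rewrite D00 mulr0 a0 -e expr0n/= mulr0 subr0 -mulrDl subrK mul1r.
  by rewrite lexx.
have Dp : 0 < mdist x y by rewrite lt_neqAle eq_sym Dn0.
set D := mdist x y in D0 Dn0 Dp tr1 tr2 tr3 *.
set c := mdist x z in c0 tr1 tr2 tr3 *; set e := mdist y z in e0 tr1 tr2 tr3 *.
(* The first coordinate of [z'] by the law of cosines; the triangle inequalities make
   [c ^+ 2 - u ^+ 2] nonnegative. *)
pose u := (D ^+ 2 + c ^+ 2 - e ^+ 2) / (2 * D).
have uD : 2 * D * u = D ^+ 2 + c ^+ 2 - e ^+ 2 by rewrite /u mulrC divfK// mulf_neq0.
have v0 : 0 <= c ^+ 2 - u ^+ 2.
  have k1 : 0 <= 2 * D * (c - u) by rewrite mulrBr uD; nra.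
  have k2 : 0 <= 2 * D * (c + u) by rewrite mulrDr uD; nra.
  rewrite pmulr_rge0 ?mulr_gt0// in k1; rewrite pmulr_rge0 ?mulr_gt0// in k2.
  have -> : c ^+ 2 - u ^+ 2 = (c - u) * (c + u) by ring.
  exact: mulr_ge0.
pose v := Num.sqrt (c ^+ 2 - u ^+ 2).
have vv : v ^+ 2 = c ^+ 2 - u ^+ 2 by rewrite sqr_sqrtr.
pose P (a b : R) : euclidean_plane R := (a, b).
have tD : 0 <= t * D by rewrite mulr_ge0.
have tD' : t * D <= D by rewrite ler_piMl.
have := hc x y z a b ha hb (P 0 0) (P D 0) (P u v).
have -> : mdist (P 0 0) (P D 0) = D by apply: plane_distE => //=; ring.
have -> : mdist (P D 0) (P u v) = e.
  by apply: plane_distE => //=; rewrite sub0r sqrrN vv; lra.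
have -> : mdist (P 0 0) (P u v) = c.
  by apply: plane_distE => //=; rewrite !sub0r !sqrrN vv; lra.
move=> /(_ erefl erefl erefl (t * D) c); rewrite tD tD' c0 lexx.
move=> /(_ isT isT (P (t * D) 0) (P u v)).
have -> : mdist (P 0 0) (P (t * D) 0) = t * D by apply: plane_distE => //=; ring.
have -> : mdist (P (t * D) 0) (P D 0) = D - t * D.
  by apply: plane_distE => /=; [lra|ring].
have -> : mdist (P 0 0) (P u v) = c.
  by apply: plane_distE => //=; rewrite !sub0r !sqrrN vv; lra.
rewrite mdistxx subrr => /(_ erefl erefl erefl erefl); rewrite b1 => H.
have : mdist (a (t * D)) z ^+ 2 <= mdist (P (t * D) 0) (P u v) ^+ 2.
  by rewrite ler_sqr ?nnegrE ?mdist_ge0.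
rewrite plane_dist_sqr/= sub0r sqrrN vv (metric_sym z) (metric_sym z x) (metric_sym z y).
rewrite -/c -/e => H2; apply: le_trans H2 _.
have -> : (t * D - u) ^+ 2 + (c ^+ 2 - u ^+ 2)
  = t ^+ 2 * D ^+ 2 - t * (2 * D * u) + c ^+ 2 by ring.
by rewrite uD le_eqVlt; apply/orP; left; apply/eqP; ring.
Qed.

End l2prod.

(** * Compactness of closed balls *)

Section proper.
Context {R : realType}.

(** An ultrafilter on [nat] replaces the passage to subsequences: fixed once, it makes all bounded
    sequences of an argument converge together. *)
Definition ultracompact_ball (M : metricType R) (x : M) (r : R) : Prop :=
  forall U : set_system nat, UltraFilter U ->
  forall u : nat -> M, (\forall n \near U, mdist x (u n) <= r) ->
  exists y : M, u @ U --> y.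

(* Compactness of the closed balls, in a form that passes to products. *)
Definition proper_space (M : metricType R) : Prop :=
  forall (x : M) r, ultracompact_ball x r.

Lemma ultracompact_ballP (M : metricType R) (x : M) r :
  (forall U : set_system nat, UltraFilter U ->
   forall u : nat -> M, (forall n, mdist x (u n) <= r) ->
   exists y : M, u @ U --> y) -> ultracompact_ball x r.
Proof.
move=> H U UU u hu.
have [r0|r0] := leP 0 r; last first.
  have [n] := filter_ex hu; have := mdist_ge0 x (u n); lra.
pose v n := if mdist x (u n) <= r then u n else x.
have [|y hy] := H U UU v.
  by move=> n; rewrite /v; case: ifP => // _; rewrite mdistxx.
exists y; apply/mcvgP => e e0.
move/mcvgP : hy => /(_ e e0); apply: filterS2 hu => n h.
by rewrite /v h.
Qed.

Lemma ultra_fmap (S T : Type) (f : S -> T) (U : set_system S) :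
  UltraFilter U -> UltraFilter (f @ U).
Proof.
move=> UU; split; first exact: fmap_proper_filter.
move=> G GG UG; apply/seteqP; split => // A GA.
have [//|UnA] := in_ultra_setVsetC (f @^-1` A) UU.
have GnA : G (~` A) by exact: UG.
by have [x []] := filter_ex (filterI GA GnA).
Qed.

Lemma cvg_mdist (M : metricType R) T (F : set_system T) {FF : Filter F}
  (u v : T -> M) x y : u @ F --> x -> v @ F --> y ->
  mdist (u n) (v n) @[n --> F] --> mdist x y.
Proof.
move=> /mcvgP hu /mcvgP hv; apply/cvgrPdist_lt => e e0.
have e2 : 0 < e / 2 by rewrite divr_gt0.
move: (hu _ e2) (hv _ e2); apply: filterS2 => n h1 h2.
have := metric_triangle x (u n) y; have := metric_triangle (u n) (v n) y.
have := metric_triangle (u n) x (v n); have := metric_triangle x y (v n).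
rewrite (metric_sym (v n) y) (metric_sym (u n) x) ltr_distl => ? ? ? ?.
by apply/andP; split; lra.
Qed.

Lemma cvg_mdist_le (M : metricType R) T (F : set_system T) {FF : ProperFilter F}
  (v : T -> M) x y r : v @ F --> y -> (\forall n \near F, mdist x (v n) <= r) ->
  mdist x y <= r.
Proof.
move=> /mcvgP hv h; apply/ler_addgt0Pr => e e0.
have [n [h1 h2]] := filter_ex (filterI h (hv _ e0)).
have := metric_triangle x (v n) y; rewrite (metric_sym (v n) y).
by move: h1 h2 => /=; lra.
Qed.

(** The set of radii of compact balls about [x] is closed under increasing limits ([Pc]) and open
    ([Pd]), hence unbounded. *)
Lemma geodesic_hopf_rinow (M : metricType R) : npc M -> complete_space M ->
  locally_compact [set: M] -> proper_space M.
Proof.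
move=> hM hc hl.
have Pa (x : M) : exists2 r : R, 0 < r & ultracompact_ball x r.
  have [B] := hl x I; rewrite /within/= => hB [cB _].
  have {}hB : nbhs x B by apply: filterS hB => y; exact.
  move: hB; rewrite -metricType_numDomainType.filter_from_mdist_nbhs => -[r /= r0 hr].
  exists (r / 2); first by rewrite divr_gt0.
  move=> U UU u hu; have UU' := ultra_fmap u UU.
  have := cB; rewrite compact_ultra => /(_ _ UU') [|y [_ hy]]; last by exists y.
  by rewrite /fmap/=; apply: filterS hu => n h; apply: hr => /=; lra.
have Pb (x y : M) (r s : R) : ultracompact_ball x r -> mdist x y + s <= r ->
    ultracompact_ball y s.
  move=> P h U UU u hu; apply: P; apply: filterS hu => n h'.
  by have := metric_triangle x y (u n); lra.
have Pc (x : M) (r : R) : 0 < r -> (forall s : R, 0 <= s < r -> ultracompact_ball x s) ->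
    ultracompact_ball x r.
  move=> r0 P; apply: ultracompact_ballP => U UU u hu.
  apply: hc; apply: cauchy_exP => e e0.
  (* The points are pulled towards [x] by the factor [s < 1] into a smaller compact ball. The factor
     is so close to 1 that each moves by at most [e / 2], which makes the image of the ultrafilter
     Cauchy. *)
  pose s : R := Num.max 0 (1 - e / (2 * r)).
  have s0 : 0 <= s by rewrite /s le_max lexx.
  have er : 0 < e / (2 * r) by rewrite divr_gt0// mulr_gt0.
  have s1 : s < 1 by rewrite /s gt_max ltr01 gtrBl.
  have sr : (1 - s) * r <= e / 2.
    have : 1 - s <= e / (2 * r).
      have : 1 - e / (2 * r) <= s by rewrite /s le_max lexx orbT.
      lra.
    rewrite -(ler_pM2r r0) => /le_trans; apply.
    by rewrite invfM mulrA divfK// gt_eqF.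
  have s01 : 0 <= s <= 1 by rewrite s0 ltW.
  have sr2 : 0 <= s * r < r by apply/andP; split; [exact: mulr_ge0 s0 (ltW r0)|rewrite gtr_pMl].
  have [|y hy] := P _ sr2 U UU (fun n => pt hM x (u n) s).
    by apply: nearW => n; rewrite d_pt//; apply: ler_pM => //; exact: mdist_ge0.
  have e2 : 0 < e / 2 by rewrite divr_gt0.
  exists y; move/mcvgP : hy => /(_ _ e2); rewrite /fmap/=.
  apply: filterS => n h; rewrite ballEmdist/=.
  have := metric_triangle y (pt hM x (u n) s) (u n); rewrite d_pt'//.
  have : (1 - s) * mdist x (u n) <= (1 - s) * r by rewrite ler_wpM2l// subr_ge0 ltW.
  lra.
have Pd (x : M) (r : R) : 0 <= r -> ultracompact_ball x r ->
    exists2 e : R, 0 < e & ultracompact_ball x (r + e).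
  move=> r0 P; apply: contrapT => hn.
  (* If all balls of radius [2 / (k + 1)] centred in the compact ball were compact, points slightly
     outside it could be pulled back to radius [r], and the limit there would be the centre of a
     ball containing them. The bad centres accumulate at a point, against local compactness
     there. *)
  have {hn} hy (k : nat) : exists y : M, mdist x y <= r /\
      ~ ultracompact_ball y (2 * k.+1%:R^-1).
    apply: contrapT => hk; apply: hn; exists k.+1%:R^-1 => //.
    apply: ultracompact_ballP => U UU u hu.
    have e0 : 0 < k.+1%:R^-1 :> R by [].
    set e := k.+1%:R^-1 in hk e0 hu *.
    have re : 0 < r + e by lra.
    have s01 : 0 <= r / (r + e) <= 1 by apply: ratio01; apply/andP; split; lra.
    have [s0 s1] := andP s01.
    have hle n : mdist x (pt hM x (u n) (r / (r + e))) <= r.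
      rewrite d_pt// -[leRHS](divfK (lt0r_neq0 re)) //; exact: ler_wpM2l.
    have hle' n : mdist (pt hM x (u n) (r / (r + e))) (u n) <= e.
      rewrite d_pt'//; have -> : 1 - r / (r + e) = e / (r + e).
        by field; rewrite gt_eqF.
      rewrite -[leRHS](divfK (lt0r_neq0 re)) //; apply: ler_wpM2l => //.
      by rewrite divr_ge0 ?ltW.
    have [|y yv] := P U UU (fun n => pt hM x (u n) (r / (r + e))).
      exact: nearW.
    have xy : mdist x y <= r by apply: cvg_mdist_le yv _; exact: nearW.
    have Py : ultracompact_ball y (2 * e).
      by apply: contrapT => nP; apply: hk; exists y.
    apply: Py; move/mcvgP : yv => /(_ _ e0); apply: filterS => n h.
    have := metric_triangle y (pt hM x (u n) (r / (r + e))) (u n).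
    by have := hle' n; lra.
  have [y_ hy_] := choice hy.
  have [V [VU oV]] := ultraFilterLemma (@eventually_filter).
  have [|y yy] := P V VU y_; first by apply: nearW => k; have [] := hy_ k.
  have [s s0 Ps] := Pa y.
  have s2 : 0 < s / 2 by rewrite divr_gt0.
  have : \forall k \near V, False; last by move/filter_ex => [].
  have h4 : \forall k \near V, k.+1%:R^-1 < s / 4.
    apply: oV; near=> k; rewrite -[ltRHS]invrK ltf_pV2 ?posrE ?invr_gt0 ?divr_gt0//.
    near: k; apply: filterS (nbhs_infty_gtr (s / 4)^-1) => k /lt_trans; apply.
    by rewrite ltr_nat.
  move/mcvgP : yy => /(_ _ s2); apply: filterS2 h4 => k h4 h2.
  have [_] := hy_ k; apply; apply: Pb Ps _; move: (k.+1%:R^-1 : R) h4 => a h4; lra.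
move=> x; pose S : set R := [set r | 0 <= r /\ ultracompact_ball x r].
have [nbS|bS] := pselect (forall r, exists2 s, S s & r <= s).
  by move=> r; have [s [s0 Ps] rs] := nbS r; apply: Pb Ps _; rewrite mdistxx add0r.
exfalso; have [b hb] : exists b, ubound S b.
  move/existsNP : bS => [b hb]; exists b => s Ss; rewrite leNgt; apply/negP => bs.
  by apply: hb; exists s => //; exact: ltW.
have [r0 r00 Pr0] := Pa x.
have Sr0 : S r0 by split => //; exact: ltW.
have hS : has_sup S by split; [exists r0|exists b].
have supr0 : r0 <= sup S by apply: ub_le_sup => //; exists b.
have P : ultracompact_ball x (sup S).
  apply: Pc => [|s /andP[s0 sS]]; first by lra.
  have e0 : 0 < sup S - s by lra.
  have [s' [s'0 Ps'] hs'] := sup_adherent e0 hS.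
  apply: Pb Ps' _; rewrite mdistxx; lra.
have [|e e0 Pe] := Pd x (sup S) _ P; first by lra.
have : sup S + e <= sup S by apply: ub_le_sup; [exists b|split => //; lra].
lra.
Unshelve. all: by end_near. Qed.

End proper.

(** * Rays and limits of segments *)

Section rays.
Context {R : realType}.

Lemma proper_l2prod (X1 X2 : metricType R) : proper_space X1 ->
  proper_space X2 -> proper_space (l2prod X1 X2).
Proof.
move=> h1 h2 x r U UU u hu.
have [|y1 hy1] := @h1 x.1 r U UU (fun n => (u n).1).
  by apply: filterS hu => n; exact: le_trans (mdist_fst_le _ _).
have [|y2 hy2] := @h2 x.2 r U UU (fun n => (u n).2).
  by apply: filterS hu => n; exact: le_trans (mdist_snd_le _ _).
exists ((y1, y2) : l2prod X1 X2); apply/mcvgP => e e0.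
have e2 : 0 < e / 2 by rewrite divr_gt0.
move/mcvgP : hy1 => /(_ _ e2) hy1; move/mcvgP : hy2 => /(_ _ e2).
apply: filterS2 hy1 => n k1 k2.
by have /= := mdist_le_add ((y1, y2) : l2prod X1 X2) (u n); lra.
Qed.

Lemma cvg_dist_le (M : metricType R) T (F : set_system T)
  {FF : ProperFilter F} (u v : T -> M) x y r : u @ F --> x -> v @ F --> y ->
  (\forall n \near F, mdist (u n) (v n) <= r) -> mdist x y <= r.
Proof.
move=> /mcvgP hu /mcvgP hv h; apply/ler_addgt0Pr => /= e e0.
have e2 : 0 < e / 2 by rewrite divr_gt0.
have [n [h1 [h2 h3]]] := filter_ex (filterI h (filterI (hu _ e2) (hv _ e2))).
have := metric_triangle x (u n) y; have := metric_triangle (u n) (v n) y.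
by rewrite (metric_sym (v n) y); move: h1 h2 h3 => /=; lra.
Qed.

Lemma cvg_dist_ge (M : metricType R) T (F : set_system T)
  {FF : ProperFilter F} (u v : T -> M) x y r : u @ F --> x -> v @ F --> y ->
  (\forall n \near F, r <= mdist (u n) (v n)) -> r <= mdist x y.
Proof.
move=> /mcvgP hu /mcvgP hv h; apply/ler_addgt0Pr => /= e e0.
have e2 : 0 < e / 2 by rewrite divr_gt0.
have [n [h1 [h2 h3]]] := filter_ex (filterI h (filterI (hu _ e2) (hv _ e2))).
have := metric_triangle (u n) x (v n); have := metric_triangle x y (v n).
by rewrite (metric_sym (u n) x); move: h1 h2 h3 => /=; lra.
Qed.

Lemma nat_ultrafilter : exists U : set_system nat, UltraFilter U /\ \oo `<=` U.
Proof. exact: (ultraFilterLemma (@eventually_filter)). Qed.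

Context {M : metricType R} (hM : npc M) (pM : proper_space M).
Local Notation d := (@mdist R M).
Implicit Types (x y z : M) (s t u v : R) (a b c : R -> M).

Definition asymp a b : Prop :=
  exists K : R, forall t, 0 <= t -> d (a t) (b t) <= K.

Lemma asymp_sym a b : asymp a b -> asymp b a.
Proof. by move=> [K h]; exists K => t t0; rewrite metric_sym h. Qed.

Lemma asymp_trans a b c : asymp a b -> asymp b c -> asymp a c.
Proof.
move=> [K h] [L h']; exists (K + L) => t t0.
by apply: le_trans (metric_triangle _ (b t) _) _; rewrite lerD ?h ?h'.
Qed.

Lemma ray_dist c t : is_ray c -> 0 <= t -> d (c 0) (c t) = t.
Proof. by move=> hc t0; rewrite hc// sub0r normrN ger0_norm. Qed.

Lemma ray_geo c s t : is_ray c -> 0 <= s <= t -> c s = geo hM (c 0) (c t) s.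
Proof.
move=> hc /andP[s0 st]; have t0 : 0 <= t by lra.
apply: geo_unique; rewrite ?ray_dist// ?s0//.
by rewrite hc// distrC ger0_norm; lra.
Qed.

Lemma ray_convex a b t T : is_ray a -> is_ray b -> 0 <= t <= T -> 0 < T ->
  d (a t) (b t) <= (1 - t / T) * d (a 0) (b 0) + t / T * d (a T) (b T).
Proof.
move=> ha hb ht T0; rewrite (ray_geo ha ht) (ray_geo hb ht) /geo.
rewrite (ray_dist ha (ltW T0)) (ray_dist hb (ltW T0)).
by apply: pt_convex; exact: ratio01.
Qed.

(** A bounded convex function on a half-line is nonincreasing. *)
Lemma asymp_dist a b t : is_ray a -> is_ray b -> asymp a b -> 0 <= t ->
  d (a t) (b t) <= d (a 0) (b 0).
Proof.
move=> ha hb [K hK] t0; apply/ler_addgt0Pr => /= e e0.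
have K0 : 0 <= K by apply: le_trans (hK 0 _); rewrite ?mdist_ge0.
pose T := t + 1 + t * K / e.
have q0 : 0 <= t * K / e by rewrite divr_ge0 ?mulr_ge0// ltW.
have T1 : t <= T by rewrite /T; lra.
have T0 : 0 < T by rewrite /T; lra.
have ht : 0 <= t <= T by rewrite t0.
apply: le_trans (ray_convex ha hb ht T0) _.
have /andP[r0 r1] := ratio01 ht; apply: lerD.
  by rewrite ler_piMl ?mdist_ge0//; lra.
apply: (@le_trans _ _ (t / T * K)).
  by apply: ler_wpM2l => //; apply: hK; exact: ltW.
rewrite mulrAC ler_pdivrMr//.
have -> : e * T = e * (t + 1) + t * K.
  by rewrite /T mulrDr [X in _ + X]mulrC divfK ?gt_eqF.
by rewrite lerDr mulr_ge0 ?ltW//; lra.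
Qed.

Lemma asymp_eq a b t : is_ray a -> is_ray b -> asymp a b -> a 0 = b 0 ->
  0 <= t -> a t = b t.
Proof.
move=> ha hb hab ab0 t0; apply: mdist_positivity; apply/eqP.
by rewrite eq_le mdist_ge0 andbT (le_trans (asymp_dist ha hb hab t0))// ab0 mdistxx.
Qed.

Section limits.
Context {U : set_system nat} {UU : UltraFilter U}.
Implicit Types zs : nat -> M.

Definition escaping zs : Prop :=
  forall x K, \forall n \near U, K <= d x (zs n).

Lemma escapingP zs x : (forall K, \forall n \near U, K <= d x (zs n)) ->
  escaping zs.
Proof.
move=> h y K; apply: filterS (h (K + d x y)) => n.
by have := metric_triangle x y (zs n); lra.
Qed.

Lemma geo_limit zs x : escaping zs -> exists2 r, is_ray r &
  r 0 = x /\ forall t, 0 <= t -> geo hM x (zs n) t @[n --> U] --> r t.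
Proof.
move=> hz.
have hl t : exists y : M, 0 <= t -> geo hM x (zs n) t @[n --> U] --> y.
  have [t0|t0] := leP 0 t; last by exists x => //; lra.
  have [|y hy] := @pM x t U UU (fun n => geo hM x (zs n) t).
    by apply: filterS (hz x t) => n h; rewrite d_geo// t0.
  by exists y.
have [r hr] := choice hl; exists r; last first.
  split => //; have r0 := hr 0 (lexx _).
  apply: (@cvg_unique _ (@metric_hausdorff _ M) (geo hM x (zs n) 0 @[n --> U])) r0 _.
  have -> : (fun n => geo hM x (zs n) 0) = cst x.
    by apply/funext => n; rewrite /geo mul0r pt0.
  exact: cvg_cst.
move=> s t s0 t0; apply/eqP; rewrite eq_le; apply/andP; split.
  apply: (cvg_dist_le (hr s s0) (hr t t0)).
  by apply: filterS2 (hz x s) (hz x t) => n h1 h2; rewrite d_geo_geo ?s0 ?t0.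
apply: (cvg_dist_ge (hr s s0) (hr t t0)).
by apply: filterS2 (hz x s) (hz x t) => n h1 h2; rewrite d_geo_geo ?s0 ?t0.
Qed.

Lemma geo_limit_fellow zs x y a b t : escaping zs -> 0 <= t ->
  geo hM x (zs n) t @[n --> U] --> a t -> geo hM y (zs n) t @[n --> U] --> b t ->
  d (a t) (b t) <= 2 * d x y.
Proof.
move=> hz t0 ha hb.
apply: (cvg_dist_le ha hb).
apply: filterS2 (hz x t) (hz y t) => n h1 h2.
by apply: geo_fellow; rewrite ?t0.
Qed.

Lemma escaping_ray c (ts : nat -> R) : is_ray c ->
  (forall K, \forall n \near U, K <= ts n) -> escaping (fun n => c (ts n)).
Proof.
move=> hc hT; apply: (escapingP (x := c 0)) => K.
by apply: filterS2 (hT K) (hT 0) => n h1 h2; rewrite ray_dist.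
Qed.

(** The segments have a limit ray by compactness. It is asymptotic to [c], because seen from [c 0]
    they lie on [c] itself, and a class has only one ray from each origin. *)
Lemma geo_to_ray c r (ts : nat -> R) t : is_ray c -> is_ray r -> asymp r c ->
  (forall K, \forall n \near U, K <= ts n) -> 0 <= t ->
  geo hM (r 0) (c (ts n)) t @[n --> U] --> r t.
Proof.
move=> hc hr rc hT t0.
have hz := escaping_ray hc hT.
have [r' hr' [r'0 lr']] := geo_limit (r 0) hz.
suff -> : r t = r' t by exact: lr'.
apply: asymp_eq => //; apply: asymp_trans rc _; apply: asymp_sym.
exists (2 * d (r 0) (c 0)) => s s0.
apply: (geo_limit_fellow hz s0 (lr' s s0)).
have : (fun _ : nat => c s) @ U --> c s by exact: cvg_cst.
apply: cvg_trans; apply: near_eq_cvg.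
by apply: filterS (hT s) => n h; apply: ray_geo => //; rewrite s0.
Qed.

End limits.

Lemma ray_from c x : is_ray c -> exists2 r, is_ray r & r 0 = x /\ asymp r c.
Proof.
move=> hc; have [U [UU oU]] := nat_ultrafilter.
have hT K : \forall n \near U, K <= n%:R :> R.
  by apply: oU; apply: filterS (nbhs_infty_gtr K) => n; exact: ltW.
have hz : @escaping U (fun n => c n%:R) by exact: escaping_ray hc hT.
have [r hr [r0 lr]] := geo_limit x hz; exists r => //; split => //.
exists (2 * d x (c 0)) => s s0.
apply: (geo_limit_fellow hz s0 (lr s s0)).
have : (fun _ : nat => c s) @ U --> c s by exact: cvg_cst.
apply: cvg_trans; apply: near_eq_cvg.
by apply: filterS (hT s) => n h; apply: ray_geo => //; rewrite s0.
Qed.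

End rays.

(** * Flat half-planes and rank one isometries *)

Section half_plane.
Context {R : realType} {M : metricType R} (hM : npc M) (pM : proper_space M).
Local Notation d := (@mdist R M).
Implicit Types (x y z : M) (s t u v : R).

Lemma line_ray (c : R -> M) s : is_line c -> is_ray (fun t => c (s + t)).
Proof. by move=> hc u v _ _; rewrite hc; congr `|_|; ring. Qed.

Lemma geoP x y z t : 0 <= t <= d x y ->
  d z (geo hM x y t) ^+ 2 <= (1 - t / d x y) * d z x ^+ 2
    + t / d x y * d z y ^+ 2 - t / d x y * (1 - t / d x y) * d x y ^+ 2.
Proof. by move=> h; apply: ptP; exact: ratio01. Qed.

(** Two uses of the inequality, arranged as a polynomial in the inverse lengths [e], [f] and the
    difference [k] of the lengths: these are the quantities that converge as [y] escapes. *)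
Lemma two_sides_bound x x' y (u v k a b e f : R) :
  0 < a -> 0 < b -> 0 <= u <= a -> 0 <= v <= b ->
  d x y = a -> d x' y = b -> k = b - a -> e = a^-1 -> f = b^-1 ->
  d (geo hM x y u) (geo hM x' y v) ^+ 2 <=
  (1 - u * e) * (1 - v * f) * d x x' ^+ 2
  + (1 - u * e) * (v ^+ 2 - v * k * (2 - k * f))
  + u * k * (2 + k * e) - 2 * u * v * (1 + k * e) + u * v ^+ 2 * e + u ^+ 2.
Proof.
move=> a0 b0 hu hv ya yb kE eE fE.
have hu' := ratio01 hu; have hv' := ratio01 hv.
have {}hu : 0 <= u <= d x y by rewrite ya.
have {}hv : 0 <= v <= d x' y by rewrite yb.
have h1 := geoP (geo hM x' y v) hu; have h2 := geoP x hv.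
have h3 := d_geo' hM hv.
rewrite (metric_sym _ (geo hM x y u)) (metric_sym _ x) h3 ya yb in h1.
rewrite ya yb in h2.
have [u0 u1] := andP hu'; have h4 : 0 <= 1 - u / a by lra.
apply: le_trans h1 _.
apply: le_trans (lerB (lerD (ler_wpM2l h4 h2) (lexx _)) (lexx _)) _.
rewrite le_eqVlt; apply/orP; left; apply/eqP; rewrite eE fE kE.
by field; rewrite !gt_eqF.
Qed.

(** * Rays from the points of a line towards a limit direction *)

Section limit.
Context {U : set_system nat} {UU : UltraFilter U}.
Context (c : R -> M) (ys : nat -> M) (k : R) (rho : R -> R -> M).
Hypotheses (hc : is_line c) (k1 : `|k| < 1) (hy : @escaping R M U ys).
Hypothesis hk : forall t, d (ys n) (c t) - d (ys n) (c 0) @[n --> U] --> k * t.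
Hypothesis hrho : forall s t, 0 <= t ->
  geo hM (c s) (ys n) t @[n --> U] --> rho s t.

Lemma cvg_inv_dist s : (d (c s) (ys n))^-1 @[n --> U] --> (0 : R).
Proof.
apply/cvgrPdist_lt => e e0.
apply: filterS (hy (c s) (e^-1 + 1)) => n h.
have i0 : 0 < e^-1 by rewrite invr_gt0.
have p0 : 0 < d (c s) (ys n) by lra.
rewrite sub0r normrN gtr0_norm ?invr_gt0//.
by rewrite -[ltRHS]invrK ltf_pV2 ?posrE//; lra.
Qed.

(** The limit of [two_sides_bound] as the inverse lengths tend to 0. With [S = sqrt (1 - k ^+ 2)],
    the right side is the squared distance in the plane between [(s - k u, S u)] and
    [(t - k v, S v)]. *)
Lemma half_plane_le s t u v : 0 <= u -> 0 <= v ->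
  d (rho s u) (rho t v) ^+ 2 <=
  (s - t) ^+ 2 + (u - v) ^+ 2 - 2 * k * (s - t) * (u - v).
Proof.
move=> u0 v0.
have hE := cvg_inv_dist s; have hF := cvg_inv_dist t.
have hK : d (c t) (ys n) - d (c s) (ys n) @[n --> U] --> k * (t - s).
  rewrite mulrBr (_ : (fun n => _) = (fun n =>
    (d (ys n) (c t) - d (ys n) (c 0)) - (d (ys n) (c s) - d (ys n) (c 0)))).
    exact: cvgB.
  by apply/funext => n; rewrite (metric_sym (c t)) (metric_sym (c s)); ring.
pose e n := (d (c s) (ys n))^-1; pose f n := (d (c t) (ys n))^-1.
pose q n := d (c t) (ys n) - d (c s) (ys n).
have C (a : R) : (fun _ : nat => a) @ U --> a by exact: cvg_cst.
pose rhs n := (1 - u * e n) * (1 - v * f n) * d (c s) (c t) ^+ 2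
  + (1 - u * e n) * (v ^+ 2 - v * q n * (2 - q n * f n))
  + u * q n * (2 + q n * e n) - 2 * u * v * (1 + q n * e n)
  + u * v ^+ 2 * e n + u ^+ 2.
have hrhs : rhs @ U --> (1 - u * 0) * (1 - v * 0) * d (c s) (c t) ^+ 2
  + (1 - u * 0) * (v ^+ 2 - v * (k * (t - s)) * (2 - (k * (t - s)) * 0))
  + u * (k * (t - s)) * (2 + (k * (t - s)) * 0) - 2 * u * v * (1 + (k * (t - s)) * 0)
  + u * v ^+ 2 * 0 + u ^+ 2.
  apply: cvgD; last exact: C.
  apply: cvgD; last by apply: cvgM; [exact: C|exact: hE].
  apply: cvgB; last first.
    by apply: cvgM; [exact: C|apply: cvgD; [exact: C|apply: cvgM]].
  apply: cvgD; last first.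
    by apply: cvgM; [apply: cvgM => //; exact: C|apply: cvgD; [exact: C|apply: cvgM]].
  have h1 : 1 - u * e n @[n --> U] --> 1 - u * 0.
    by apply: cvgB; [exact: C|apply: cvgM => //; exact: C].
  apply: cvgD.
    apply: cvgM; last exact: C.
    by apply: cvgM => //; apply: cvgB; [exact: C|apply: cvgM => //; exact: C].
  apply: cvgM => //; apply: cvgB; first exact: C.
  apply: cvgM; first by apply: cvgM => //; exact: C.
  by apply: cvgB; [exact: C|apply: cvgM].
have hl : d (geo hM (c s) (ys n) u) (geo hM (c t) (ys n) v) ^+ 2 @[n --> U] -->
    d (rho s u) (rho t v) ^+ 2.
  have h : d (geo hM (c s) (ys n) u) (geo hM (c t) (ys n) v) @[n --> U] -->
    d (rho s u) (rho t v) by apply: cvg_mdist; exact: hrho.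
  by rewrite expr2; under eq_fun do rewrite expr2; exact: cvgM.
apply: (@le_trans _ _ ((1 - u * 0) * (1 - v * 0) * d (c s) (c t) ^+ 2
  + (1 - u * 0) * (v ^+ 2 - v * (k * (t - s)) * (2 - (k * (t - s)) * 0))
  + u * (k * (t - s)) * (2 + (k * (t - s)) * 0) - 2 * u * v * (1 + (k * (t - s)) * 0)
  + u * v ^+ 2 * 0 + u ^+ 2)); last first.
  rewrite hc real_normK ?num_real// le_eqVlt; apply/orP; left; apply/eqP; ring.
apply: (ler_cvg_to hl hrhs).
apply: filterS2 (hy (c s) (u + 1)) (hy (c t) (v + 1)) => n h1 h2.
apply: (two_sides_bound (a := d (c s) (ys n)) (b := d (c t) (ys n))) => //; lra.
Qed.

Lemma rho0 s : rho s 0 = c s.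
Proof.
apply: (@cvg_unique _ (@metric_hausdorff _ M) _ _ _ _ (@hrho s 0 (lexx 0))).
have -> : (fun n => geo hM (c s) (ys n) 0) = cst (c s).
  by apply/funext => n; rewrite /geo mul0r pt0.
exact: cvg_cst.
Qed.

Lemma rho_dist s u : 0 <= u -> d (c s) (rho s u) = u.
Proof.
move=> u0; apply/eqP; rewrite eq_le; apply/andP; split.
  apply: (cvg_mdist_le (@hrho s u u0)).
  by apply: filterS (hy (c s) u) => n h; rewrite d_geo// u0.
apply: (cvg_dist_ge (cvg_cst (c s)) (@hrho s u u0)).
by apply: filterS (hy (c s) u) => n h; rewrite d_geo// u0.
Qed.

(* The point [c s] is the midpoint of [c t] and [c (2 * s - t)]; bounding the
   distance to the latter from above bounds the distance to [c t] from below. *)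
Lemma half_plane_base s t u : 0 <= u ->
  d (rho s u) (c t) ^+ 2 = (s - t) ^+ 2 + u ^+ 2 - 2 * k * (s - t) * u.
Proof.
move=> u0; apply/eqP; rewrite eq_le; apply/andP; split.
  by have := half_plane_le s t u0 (lexx 0); rewrite rho0 subr0.
have h := half_plane_le s (2 * s - t) u0 (lexx 0); rewrite rho0 subr0 in h.
have half : 0 <= (1 / 2 : R) <= 1 by apply/andP; split; lra.
have e : c s = pt hM (c t) (c (2 * s - t)) (1 / 2).
  apply: pt_unique => //.
    rewrite !hc -[1 / 2]gtr0_norm// -normrM -normrN.
    by rewrite (_ : - (t - s) = 1 / 2 * - (t - (2 * s - t))) ?mulrN ?normrN//; field.
  rewrite !hc -[1 - 1 / 2]gtr0_norm//; last by lra.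
  by rewrite -normrM (_ : s - _ = (1 - 1 / 2) * (t - (2 * s - t)))//; field.
have := ptP hM (c t) (c (2 * s - t)) (rho s u) half.
rewrite -e (metric_sym _ (c s)) rho_dist// hc real_normK ?num_real//.
by move: h; nra.
Qed.

(** The ray [rho s] is to be the half-line from [(s, 0)] in the direction [(- k, S)], and [F]
    inverts these oblique coordinates. Distances to the boundary line are exact by
    [half_plane_base]; elsewhere [half_plane_le] gives only the upper bound. *)
Lemma half_plane_bound : bounds_flat_half_plane c.
Proof.
have kk : k ^+ 2 < 1.
  by rewrite -(real_normK (num_real k)) -(expr1n R 2) ltr_sqr ?nnegrE.
pose S : R := Num.sqrt (1 - k ^+ 2).
have S0 : 0 < S by rewrite sqrtr_gt0; lra.
have SS : S ^+ 2 = 1 - k ^+ 2 by rewrite sqr_sqrtr//; lra.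
pose F (p : euclidean_plane R) := rho (p.1 + k * (p.2 / S)) (p.2 / S).
have Fle (p q : euclidean_plane R) : 0 <= p.2 -> 0 <= q.2 ->
    d (F p) (F q) <= mdist p q.
  move=> p0 q0; rewrite -ler_sqr ?nnegrE ?mdist_ge0// plane_dist_sqr.
  have p0' : 0 <= p.2 / S by rewrite divr_ge0// ltW.
  have q0' : 0 <= q.2 / S by rewrite divr_ge0// ltW.
  apply: le_trans (half_plane_le _ _ p0' q0') _.
  rewrite le_eqVlt; apply/orP; left; apply/eqP.
  have pE : p.2 = S * (p.2 / S) by rewrite mulrC divfK// gt_eqF.
  have qE : q.2 = S * (q.2 / S) by rewrite mulrC divfK// gt_eqF.
  move: (p.2 / S) (q.2 / S) pE qE => u v -> ->.
  have -> : (S * u - S * v) ^+ 2 = S ^+ 2 * (u - v) ^+ 2 by ring.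
  by rewrite SS; ring.
have Fbase (p : euclidean_plane R) t : 0 <= p.2 ->
    d (c t) (F p) = mdist ((t, 0) : euclidean_plane R) p.
  move=> p0; apply/eqP; rewrite -(@eqrXn2 _ 2) ?mdist_ge0//.
  have p0' : 0 <= p.2 / S by rewrite divr_ge0// ltW.
  rewrite plane_dist_sqr metric_sym half_plane_base//=.
  have pE : p.2 = S * (p.2 / S) by rewrite mulrC divfK// gt_eqF.
  by move: (p.2 / S) pE => u ->; rewrite sub0r sqrrN exprMn SS; apply/eqP; ring.
(* For points at distinct heights, extend the segment between them until it
   meets the boundary line, where distances are already known. *)
have Flt (p q : euclidean_plane R) : 0 <= p.2 -> p.2 < q.2 ->
    mdist p q <= d (F p) (F q).
  move=> p0 pq; have q0 : 0 < q.2 by lra.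
  pose m : R := p.2 / q.2.
  have m0 : 0 <= m by rewrite divr_ge0// ltW.
  have m1 : m < 1 by rewrite ltr_pdivrMr// mul1r.
  have mq : m * q.2 = p.2 by rewrite divfK// gt_eqF.
  pose a : R := (p.1 - m * q.1) / (1 - m).
  have aE : (1 - m) * a = p.1 - m * q.1 by rewrite mulrC divfK// gt_eqF// subr_gt0.
  have e1 : p.1 = (1 - m) * a + m * q.1 by rewrite aE; ring.
  have L0 := mdist_ge0 ((a, 0) : euclidean_plane R) q.
  have Ap : mdist ((a, 0) : euclidean_plane R) p =
      m * mdist ((a, 0) : euclidean_plane R) q.
    apply: plane_distE; first exact: mulr_ge0.
    by rewrite exprMn plane_dist_sqr/= e1 -mq; ring.
  have pqE : mdist p q = (1 - m) * mdist ((a, 0) : euclidean_plane R) q.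
    apply: plane_distE; first by rewrite mulr_ge0// subr_ge0 ltW.
    by rewrite exprMn plane_dist_sqr/= e1 -mq; ring.
  have := metric_triangle (c a) (F p) (F q).
  by rewrite !Fbase// ?Ap ?pqE; [lra|exact: ltW].
exists F; split => [s|p q p0 q0]; first by rewrite /F/= mul0r mulr0 addr0 rho0.
apply/eqP; rewrite eq_le Fle//=.
have [pq|qp|pq] := ltgtP p.2 q.2; first exact: Flt.
  by rewrite metric_sym (metric_sym (F p)) Flt.
(* At equal heights the extended segment never meets the boundary line, so one point is raised by
   [e / 2]. *)
apply/ler_addgt0Pr => /= e e0.
pose r : euclidean_plane R := (q.1, q.2 + e / 2).
have e2 : 0 < e / 2 by rewrite divr_gt0.
have pr : p.2 < r.2 by rewrite /r/= pq; lra.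
have qr : mdist q r = e / 2.
  by apply: plane_distE; [exact: ltW|rewrite /r/=; ring].
have r0 : 0 <= r.2 by rewrite /r/=; lra.
have h1 := Flt p r p0 pr; have h2 := Fle q r q0 r0.
have h3 := metric_triangle (F p) (F q) (F r).
have := metric_triangle p r q; rewrite (metric_sym r q) qr in h2 *; lra.
Qed.

End limit.

(** For [|k| = 1] the oblique coordinates degenerate, as when the points escape towards an end of
    the line itself. *)
Theorem half_plane_lemma (U : set_system nat) (c : R -> M) (ys : nat -> M) k :
  UltraFilter U -> is_line c -> `|k| < 1 -> @escaping R M U ys ->
  (forall t, d (ys n) (c t) - d (ys n) (c 0) @[n --> U] --> k * t) ->
  bounds_flat_half_plane c.
Proof.
move=> UU hc k1 hy hk.
have hr s : exists r : R -> M, forall t, 0 <= t ->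
    geo hM (c s) (ys n) t @[n --> U] --> r t.
  by have [r _ [_ hr]] := geo_limit hM pM (c s) hy; exists r.
have [rho hrho] := choice hr.
exact: (half_plane_bound hc k1 hy hk hrho).
Qed.

End half_plane.

(** * Convex functions of one variable *)

Section convex_function.
Context {R : realType} (f : R -> R).
Hypothesis conv : forall s t T : R, s <= t <= T ->
  (T - s) * f t <= (T - t) * f s + (t - s) * f T.

Lemma convex_slope (p q r s : R) : p <= q -> q <= r -> r <= s -> q < s ->
  (f q - f p) * (s - r) <= (f s - f r) * (q - p).
Proof.
move=> pq qr rs qs.
have c1 : (s - q) * (f q - f p) <= (q - p) * (f s - f q).
  have : p <= q <= s by apply/andP; split; lra.
  by move/conv; lra.
have c2 : (s - r) * (f s - f q) <= (s - q) * (f s - f r).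
  have : q <= r <= s by apply/andP; split; lra.
  by move/conv; lra.
have sr : 0 <= s - r by lra.
have qp : 0 <= q - p by lra.
have h1 := ler_wpM2l sr c1; have h2 := ler_wpM2l qp c2.
have sq : 0 < s - q by lra.
by rewrite -(ler_pM2l sq); lra.
Qed.

(* Unit chords at spacing [L] have increasing slopes in [0, 1], so two
   consecutive ones are almost equal. *)
Lemma convex_flat_window (t0 L d : R) (m : nat) : 1 <= L -> 0 < d -> 1 < m%:R * d ->
  (forall t : R, f t0 <= f t) ->
  f (t0 + m%:R * L + 1) - f (t0 + m%:R * L) < 1 ->
  exists i, (i < m)%N /\ forall s t : R,
    t0 + i%:R * L + 1 <= s -> s <= t -> t <= t0 + i.+1%:R * L ->
    (f (t0 + i%:R * L + 1) - f (t0 + i%:R * L)) * (t - s) <= f t - f s <=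
    (f (t0 + i%:R * L + 1) - f (t0 + i%:R * L) + d) * (t - s).
Proof.
move=> L1 d0 md hmin; pose g i := f (t0 + i%:R * L + 1) - f (t0 + i%:R * L).
rewrite -/(g m) => gm.
(* The slope is at least 0 at the minimum, so [m] increments larger than [d] would bring it above
   [m * d > 1]. *)
have [i [im gi]] : exists i, (i < m)%N /\ g i.+1 <= g i + d.
  apply: contrapT => hn.
  have h i : (i <= m)%N -> i%:R * d <= g i - g 0%N.
    elim: i => [|i IH] im; first by rewrite mul0r subrr.
    have := IH (ltnW im); have : ~ (g i.+1 <= g i + d) by move=> h; apply: hn; exists i.
    by move/negP; rewrite -ltNge -natr1; lra.
  have := h m (leqnn m); have : 0 <= g 0%N by rewrite /g mul0r addr0 subr_ge0.
  lra.
exists i; split => // s t h1 h2 h3; rewrite -/(g i).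
have iL : t0 + i.+1%:R * L = t0 + i%:R * L + L by rewrite -natr1; ring.
have [->|st] := eqVneq s t; first by rewrite !subrr !mulr0 lexx.
have {}st : s < t by rewrite lt_neqAle st.
apply/andP; split.
  have : g i * (t - s) <=
      (f t - f s) * (t0 + i%:R * L + 1 - (t0 + i%:R * L)).
    by apply: convex_slope; lra.
  by lra.
apply: (@le_trans _ _ (g i.+1 * (t - s))); last by rewrite ler_wpM2r// subr_ge0 ltW.
have : (f t - f s) * (t0 + i.+1%:R * L + 1 - (t0 + i.+1%:R * L)) <=
    g i.+1 * (t - s) by apply: convex_slope; lra.
by lra.
Qed.

End convex_function.

(** * Feet on a periodic line *)

Section axes.
Context {R : realType} {M : metricType R} (hM : npc M) (pM : proper_space M).
Local Notation d := (@mdist R M).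
Implicit Types (x y z : M) (s t u v : R) (c : R -> M).

(** What is kept of the translation along an axis: every parameter can be brought to 0, up to an
    error [l], by a distance preserving map. *)
Definition periodic c : Prop := exists2 l : R, 0 <= l & forall s,
  exists s', `|s - s'| <= l /\ exists phi : M -> M,
    (forall x y, d (phi x) (phi y) = d x y) /\ forall t, phi (c (s' + t)) = c t.

Definition foot c y t : Prop := forall t', d y (c t) <= d y (c t').

Lemma line_rev c : is_line c -> is_line (fun t => c (- t)).
Proof. by move=> hc s t; rewrite hc distrC; congr `|_|; ring. Qed.

Lemma periodic_rev c : periodic c -> periodic (fun t => c (- t)).
Proof.
move=> [l l0 hl]; exists l => // s; have [s' [ss' [phi [hp hc]]]] := hl (- s).
exists (- s'); split.
  by rewrite (_ : s - - s' = - (- s - s')) ?normrN//; ring.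
by exists phi; split => // t; rewrite opprD opprK hc.
Qed.

Lemma half_plane_rev c : bounds_flat_half_plane (fun t => c (- t)) ->
  bounds_flat_half_plane c.
Proof.
move=> [F [F0 hF]]; exists (fun p => F (- p.1, p.2)); split => [s|p q p0 q0].
  by rewrite /= F0 opprK.
rewrite hF//; apply: plane_distE; first exact: mdist_ge0.
by rewrite plane_dist_sqr/=; ring.
Qed.

Lemma foot_rev c y t : foot c y t -> foot (fun t => c (- t)) y (- t).
Proof. by move=> h t'; rewrite opprK. Qed.

Lemma foot_lip c y s t : is_line c -> d y (c t) <= d y (c s) + `|s - t|.
Proof. by move=> hc; rewrite -hc metric_triangle. Qed.

Lemma foot_exists c y : is_line c -> exists t, foot c y t.
Proof.
move=> hc; pose K := 2 * d y (c 0) + 1.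
have y0 := mdist_ge0 y (c 0).
have [||t] := @EVT_min R (fun t => d y (c t)) (- K) K.
- by rewrite /K; lra.
- apply: continuous_subspaceT => t; apply/cvgrPdist_lt => e e0.
  near=> s; apply: (@le_lt_trans _ _ `|t - s|).
    have := foot_lip y s t hc; have := foot_lip y t s hc.
    by rewrite (distrC s t) ler_norml => *; apply/andP; split; lra.
  by near: s; exact: cvgr_dist_lt.
move=> tK ht; exists t => s.
have [sK|sK] := boolP (s \in `[- K, K]%R); first exact: ht.
apply: (@le_trans _ _ (d y (c 0))).
  by apply: ht; rewrite in_itv/= /K; apply/andP; split; lra.
have sK' : K < `|s| by rewrite ltNge ler_norml; move: sK; rewrite in_itv.
have := metric_triangle (c 0) y (c s).
by rewrite hc sub0r normrN (metric_sym (c 0) y) /K in sK' *; lra.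
Unshelve. all: by end_near. Qed.

Lemma line_convex c y s t T : is_line c -> s <= t <= T ->
  (T - s) * d y (c t) <= (T - t) * d y (c s) + (t - s) * d y (c T).
Proof.
move=> hc /andP[st tT].
have [Ts|Ts] := eqVneq s T.
  by have ts : t = s; [lra|rewrite ts Ts; lra].
have sT : 0 < T - s by rewrite subr_gt0 lt_neqAle Ts; lra.
have h01 : 0 <= (t - s) / (T - s) <= 1 by apply: ratio01; apply/andP; split; lra.
have e : c t = pt hM (c s) (c T) ((t - s) / (T - s)).
  have a1 : `|s - t| = t - s by rewrite distrC ger0_norm// subr_ge0.
  have a2 : `|t - T| = T - t by rewrite distrC ger0_norm// subr_ge0.
  have a3 : `|s - T| = T - s by rewrite distrC ger0_norm// ltW.
  apply: pt_unique => //; rewrite !hc ?a1 ?a2 a3.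
    by rewrite divfK// gt_eqF.
  by rewrite mulrBl divfK ?gt_eqF// mul1r; lra.
have := pt_convex hM y y (c s) (c T) h01.
have -> : pt hM y y ((t - s) / (T - s)) = y.
  by apply/esym/pt_unique; rewrite ?mdistxx ?mulr0.
rewrite -e -(ler_pM2l sT) => /le_trans; apply.
have qe : (T - s) * ((t - s) / (T - s)) = t - s by rewrite mulrC divfK// gt_eqF.
move: (_ / _) qe => q qe; have {}qe : t = s + (T - s) * q by lra.
by rewrite le_eqVlt; apply/orP; left; apply/eqP; rewrite qe; ring.
Qed.

Lemma real_ultra_cvg (U : set_system nat) (u : nat -> R) (a b : R) :
  UltraFilter U -> (forall n, a <= u n <= b) ->
  exists2 l, u @ U --> l & a <= l <= b.
Proof.
move=> UU hu; have := @segment_compact R a b; rewrite compact_ultra.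
move=> /(_ (u @ U) (ultra_fmap u UU)) [|l [hl ul]].
  by apply: nearW => n /=; rewrite in_itv/= hu.
by exists l => //; move: hl; rewrite /= in_itv.
Qed.

Lemma ultra_infty (U : set_system nat) (K : R) : \oo `<=` U ->
  \forall n \near U, K <= n%:R.
Proof. by apply; apply: filterS (nbhs_infty_gtr K) => n; exact: ltW. Qed.

(* A failure of the conclusion gives points [y] for which [d y (c t)] is almost
   affine of slope at most [1 - e] on long windows; recentring the windows by
   [periodic] and passing to the limit spans a flat half-plane. *)
Lemma foot_slope c (e : R) : is_line c -> periodic c ->
  ~ bounds_flat_half_plane c -> 0 < e < 1 ->
  exists T, forall y t0 s t, foot c y t0 -> t0 + T <= s -> s <= t ->
    (1 - e) * (t - s) <= d y (c t) - d y (c s).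
Proof.
move=> hc [l l0 hp] hn /andP[e0 e1]; apply: contrapT => hT; apply: hn.
have conv y : forall s t T, s <= t <= T ->
  (T - s) * d y (c t) <= (T - t) * d y (c s) + (t - s) * d y (c T).
  by move=> s t T; exact: line_convex.
have W n : exists yk : M * R, 0 <= yk.2 <= 1 - e /\
    forall t, `|t| <= n%:R ->
    `|d yk.1 (c t) - d yk.1 (c 0) - yk.2 * t| <= n.+1%:R^-1.
  (* A unit chord, then room for an interval of radius [n] about a centre that [periodic] provides
     only up to [l]. Below, [dl] is chosen so that [dl * n] stays under the allowed error
     [n.+1%:R^-1], and [m] so that [m * dl > 1]. *)
  pose L : R := 2 * (n%:R + l) + 1.
  have n0 : 0 <= n%:R :> R by [].
  have L1 : 1 <= L by rewrite /L; lra.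
  pose m := ((n.+1 * n.+1).+1)%N.
  pose dl : R := n.+1%:R^-1 / n.+1%:R.
  have dl0 : 0 < dl by rewrite divr_gt0.
  have md : 1 < m%:R * dl.
    rewrite /dl -invfM mulrC ltr_pdivlMl ?mulr_gt0// mulr1 -natrM ltr_nat.
    by rewrite /m ltnS.
  have {hT} [y [t0 [s [t [ft t0s st hst]]]]] : exists y t0 s t,
      [/\ foot c y t0, t0 + (m%:R * L + 1) <= s, s <= t &
      d y (c t) - d y (c s) < (1 - e) * (t - s)].
    apply: contrapT => hh; apply: hT; exists (m%:R * L + 1) => y t0 s t f1 f2 f3.
    by rewrite leNgt; apply/negP => f4; apply: hh; exists y, t0, s, t.
  have st' : s < t.
    by rewrite lt_neqAle st andbT; apply/eqP => ee; move: hst; rewrite ee !subrr mulr0 ltxx.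
  (* By convexity, the chord of slope below [1 - e] from [s] to [t] bounds all unit slopes before
     [s]. *)
  have small a : t0 <= a -> a + 1 <= s -> d y (c (a + 1)) - d y (c a) < 1 - e.
    move=> ha hs.
    have h1 : (d y (c (a + 1)) - d y (c a)) * (t - s) <=
        (d y (c t) - d y (c s)) * (a + 1 - a).
      by apply: (convex_slope (conv y)); lra.
    have ts : 0 < t - s by lra.
    by rewrite -(ltr_pM2r ts); lra.
  have mL : 0 <= m%:R * L by rewrite mulr_ge0//; lra.
  have gm : d y (c (t0 + m%:R * L + 1)) - d y (c (t0 + m%:R * L)) < 1.
    by have := small (t0 + m%:R * L); lra.
  have [i [im hi]] := convex_flat_window (conv y) L1 dl0 md ft gm.
  set k := _ - _ in hi.
  have i0 : 0 <= i%:R * L by rewrite mulr_ge0//; lra.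
  have imL : i%:R * L + L <= m%:R * L.
    by rewrite -{2}(mul1r L) -mulrDl ler_pM2r ?natr1 ?ler_nat//; lra.
  have k1 : k < 1 - e by apply: small; lra.
  have k0 : 0 <= k.
    have [a0|a0] := eqVneq (i%:R * L) 0.
      by rewrite /k a0 addr0 subr_ge0.
    have ap : 0 < i%:R * L by rewrite lt_neqAle eq_sym a0.
    have := conv y t0 (t0 + i%:R * L) (t0 + i%:R * L + 1).
    have := ft (t0 + i%:R * L); rewrite -(pmulr_rge0 k ap) /k => h1 h2.
    have : t0 <= t0 + i%:R * L <= t0 + i%:R * L + 1 by apply/andP; split; lra.
    by move/h2; lra.
  pose A := t0 + i%:R * L + 1.
  have iL : t0 + i.+1%:R * L = A + 2 * (n%:R + l).
    by rewrite -natr1 /A /L; ring.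
  have [b [hb [phi [hphi phic]]]] := hp (A + (n%:R + l)).
  have hb' : `|b - (A + (n%:R + l))| <= l by rewrite distrC.
  exists (phi y, k); split; first by rewrite k0 ltW.
  have win t1 : `|t1| <= n%:R -> A <= b + t1 <= t0 + i.+1%:R * L.
    rewrite iL !ler_norml in hb' * => /andP[? ?]; move/andP: hb' => [? ?].
    by apply/andP; split; lra.
  have shift t1 : d (phi y) (c t1) = d y (c (b + t1)) by rewrite -phic hphi.
  move=> t1 ht1; rewrite /= !shift addr0.
  have [w1 w2] := andP (win t1 ht1).
  have [|w3 w4] := andP (win 0 _); first by rewrite normr0.
  rewrite addr0 in w3 w4.
  have dn : dl * n%:R <= n.+1%:R^-1.
    rewrite /dl -[leRHS]mulr1 -mulrA ler_wpM2l// mulrC ler_pdivrMr// mul1r.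
    by rewrite ler_nat.
  have tn : dl * `|t1| <= n.+1%:R^-1.
    by apply: le_trans dn; apply: ler_wpM2l => //; exact: ltW.
  apply: le_trans tn; have [t1p|t1n] := leP 0 t1.
    have bt : b <= b + t1 by lra.
    have /andP[h1 h2] := hi b (b + t1) w3 bt w2.
    by rewrite (ger0_norm t1p) ler_norml; apply/andP; split; lra.
  have bt : b + t1 <= b by lra.
  have /andP[h1 h2] := hi (b + t1) b w1 bt w4.
  by rewrite (ltr0_norm t1n) ler_norml; apply/andP; split; lra.
have [ys hys] := choice W.
have [U [UU oU]] := nat_ultrafilter.
have [k hk /andP[k0 k1]] : exists2 k : R, (ys n).2 @[n --> U] --> k & 0 <= k <= 1 - e.
  by apply: real_ultra_cvg => n; have [] := hys n.
have oinv (r : R) : 0 < r -> \forall n \near U, n.+1%:R^-1 < r.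
  move=> r0; apply: filterS (ultra_infty (r^-1 + 1) oU) => n h.
  have i0 : 0 < r^-1 by rewrite invr_gt0.
  rewrite -[ltRHS]invrK ltf_pV2 ?posrE//.
  by rewrite -natr1; lra.
apply: (half_plane_lemma hM pM (ys := fun n => (ys n).1) (U := U) (k := k)) => //.
- by rewrite ger0_norm//; lra.
- apply: (escapingP (x := c 0)) => K.
  have [q q0] : exists2 q : R, 0 < q & q * e = 1.
    by exists e^-1; rewrite ?invr_gt0// mulVf// gt_eqF.
  move=> qe.
  (* With [y] the [n]-th point, [d y (c n)] exceeds [d y (c 0)] by at most [(1 - e) n + 1], while
     [c 0] and [c n] are [n] apart; hence [d y (c 0)] is at least [(e n - 1) / 2]. *)
  apply: filterS (ultra_infty (q * (2 * `|K| + 2)) oU) => n hKn.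
  have [/andP[a0 a1] hw] := hys n.
  have nn : `|n%:R| <= n%:R :> R by rewrite ger0_norm.
  have := hw _ nn; have i1 : n.+1%:R^-1 <= 1 :> R by rewrite invf_le1// ler1n.
  rewrite ler_norml => /andP[_ h2].
  have h3 := metric_triangle (c 0) (ys n).1 (c n%:R).
  rewrite hc sub0r normrN ger0_norm// in h3.
  rewrite (metric_sym (c 0)) in h3 *.
  have h4 : e * (q * (2 * `|K| + 2)) <= e * n%:R by rewrite ler_pM2l.
  have h5 : (ys n).2 * n%:R <= (1 - e) * n%:R by rewrite ler_wpM2r.
  have h6 : e * (q * (2 * `|K| + 2)) = 2 * `|K| + 2 by rewrite mulrA (mulrC e) qe mul1r.
  rewrite h6 in h4; move: (n.+1%:R^-1 : R) i1 h2 => iv i1 h2.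
  by have := ler_norm K; lra.
- move=> t; apply/cvgrPdist_lt => /= r r0.
  have r2 : 0 < r / 2 by rewrite divr_gt0.
  have kt : (ys n).2 * t @[n --> U] --> k * t by apply: cvgM => //; exact: cvg_cst.
  move/cvgrPdist_lt : kt => /(_ _ r2).
  apply: filterS3 (oinv _ r2) (ultra_infty `|t| oU) => n h1 h2 h3.
  have [_ /(_ t h2)] := hys n.
  move: (n.+1%:R^-1 : R) h1 => iv h1; move: h3; rewrite !ltr_norml !ler_norml.
  by move=> /andP[? ?] /andP[? ?]; apply/andP; split; lra.
Qed.

(** When the feet run off to the left, any fixed interval is eventually in the range of
    [foot_slope], for every [e]; the slope there tends to 1, its largest possible value. *)
Lemma foot_cvg (U : set_system nat) c (ys : nat -> M) (ts : nat -> R) :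
  UltraFilter U -> is_line c -> periodic c -> ~ bounds_flat_half_plane c ->
  (forall n, foot c (ys n) (ts n)) ->
  (forall K, \forall n \near U, ts n <= K) ->
  forall t, d (ys n) (c t) - d (ys n) (c 0) @[n --> U] --> 1 * t.
Proof.
move=> UU hc hp hn hf hts t; rewrite mul1r; apply/cvgrPdist_lt => r r0.
pose e : R := Num.min (1 / 2) (r / (2 * (`|t| + 1))).
have t1 : 0 < `|t| + 1 by have := normr_ge0 t; lra.
have e01 : 0 < e < 1.
  rewrite /e lt_min gt_min divr_gt0// divr_gt0 ?mulr_gt0//=.
  by rewrite ltr_pdivrMr// mul1r ltrDl ltr01.
have [e0 e1] := andP e01.
have et : e * `|t| < r.
  have : e <= r / (2 * (`|t| + 1)) by rewrite /e ge_min lexx orbT.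
  rewrite -(ler_pM2r t1) invfM mulrA divfK ?gt_eqF//.
  by rewrite mulrDr mulr1; have := normr_ge0 t; lra.
have [T hT] := foot_slope hc hp hn e01.
apply: filterS (hts (- `|t| - T)) => n h; apply: le_lt_trans et.
have l1 := foot_lip (ys n) 0 t hc; have l2 := foot_lip (ys n) t 0 hc.
rewrite sub0r normrN in l1; rewrite subr0 in l2.
have [t0|t0] := leP 0 t.
  rewrite ger0_norm// in h l1 l2 *.
  have := hT (ys n) (ts n) 0 t (hf n); rewrite subr0 => /(_ _ t0) h2.
  by rewrite ler_norml; apply/andP; split; [lra|have := h2 (_ : _ <= 0); lra].
rewrite ltr0_norm// in h l1 l2 *.
have := hT (ys n) (ts n) t 0 (hf n); rewrite sub0r => /(_ _ (ltW t0)) h2.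
by rewrite ler_norml; apply/andP; split; [have := h2 (_ : _ <= t); lra|lra].
Qed.

Lemma foot_escaping (U : set_system nat) c (ys : nat -> M) (ts : nat -> R) :
  UltraFilter U -> is_line c -> (forall n, foot c (ys n) (ts n)) ->
  (forall K, \forall n \near U, K <= ts n) -> @escaping R M U ys.
Proof.
move=> UU hc hf hts; apply: (escapingP (x := c 0)) => K.
apply: filterS (hts (2 * K)) => n h; rewrite metric_sym.
have := hf n 0; have := metric_triangle (c 0) (ys n) (c (ts n)).
rewrite hc sub0r normrN (metric_sym (c 0)); have := ler_norm (ts n); lra.
Qed.

(** This is [half_plane_le] with [k = 1] on the reversed line: the bound on the distance between the
    limit at time [t] and [c t] is then 0. *)
Lemma foot_geo_cvg (U : set_system nat) c (ys : nat -> M) (ts : nat -> R) t :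
  UltraFilter U -> is_line c -> periodic c -> ~ bounds_flat_half_plane c ->
  (forall n, foot c (ys n) (ts n)) ->
  (forall K, \forall n \near U, K <= ts n) -> 0 <= t ->
  geo hM (c 0) (ys n) t @[n --> U] --> c t.
Proof.
move=> UU hc hp hn hf hts t0.
have hy := foot_escaping UU hc hf hts.
have hr s : exists r : R -> M, forall t, 0 <= t ->
    geo hM (c (- s)) (ys n) t @[n --> U] --> r t.
  by have [r _ [_ hr]] := geo_limit hM pM (c (- s)) hy; exists r.
have [rho hrho] := choice hr.
have hk := @foot_cvg U (fun t => c (- t)) ys (fun n => - ts n) UU (line_rev hc)
  (periodic_rev hp) (fun h => hn (half_plane_rev h)) (fun n => foot_rev (hf n)).
have {}hk : forall t, d (ys n) (c (- t)) - d (ys n) (c (- 0)) @[n --> U] --> 1 * t.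
  by apply: hk => K; apply: filterS (hts (- K)) => n; lra.
have := half_plane_le (line_rev hc) hy hk hrho 0 (- t) t0 (lexx 0).
rewrite (rho0 hrho (- t)) opprK => /(_ UU) H.
have -> : c t = rho 0 t.
  apply/esym/mdist_positivity/eqP; rewrite -sqrf_eq0 eq_le sqr_ge0 andbT.
  by apply: le_trans H _; rewrite le_eqVlt; apply/orP; left; apply/eqP; ring.
by have := hrho 0 t t0; rewrite oppr0.
Qed.

End axes.

(** * Segments avoiding a ball centred on the line *)

Section avoiding_segments.
Context {R : realType} {M : metricType R} (hM : npc M) (pM : proper_space M).
Local Notation d := (@mdist R M).
Implicit Types (x y z : M) (s t u v : R) (c : R -> M).

Lemma pt_geo x y s : 0 <= s <= 1 -> pt hM x y s = geo hM x y (s * d x y).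
Proof.
move=> h; have [s0 s1] := andP h; apply: geo_unique.
- by rewrite mulr_ge0 ?mdist_ge0// ler_piMl ?mdist_ge0.
- by rewrite d_pt.
- by rewrite d_pt'// mulrBl mul1r.
Qed.

Lemma d_pt_pt x y s t : 0 <= s <= 1 -> 0 <= t <= 1 ->
  d (pt hM x y s) (pt hM x y t) = `|s - t| * d x y.
Proof.
move=> hs ht; have [s0 s1] := andP hs; have [t0 t1] := andP ht.
rewrite !pt_geo// d_geo_geo; last 2 first.
- by rewrite mulr_ge0 ?mdist_ge0// ler_piMl ?mdist_ge0.
- by rewrite mulr_ge0 ?mdist_ge0// ler_piMl ?mdist_ge0.
by rewrite -mulrBl normrM (ger0_norm (mdist_ge0 _ _)).
Qed.

Lemma foot_pt c y t s : 0 <= s <= 1 -> foot c y t ->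
  foot c (pt hM (c t) y s) t.
Proof.
move=> hs hf t'; have := hf t'.
have := metric_triangle y (pt hM (c t) y s) (c t').
have e1 := d_pt hM (c t) y hs; have := d_pt' hM (c t) y hs.
rewrite (metric_sym _ y) (metric_sym (c t) y) => e2.
by rewrite e2 (metric_sym (pt _ _ _ _) (c t)) e1 (metric_sym (c t) y); lra.
Qed.

(** Being bounded, the distance is nonincreasing by [asymp_dist], along the lines and along their
    reversals. *)
Lemma parallel_const (a b : R -> M) s t : is_line a -> is_line b ->
  (exists K, forall t, d (a t) (b t) <= K) -> d (a s) (b s) = d (a t) (b t).
Proof.
have H a' b' u v : is_line a' -> is_line b' ->
    (exists K, forall t, d (a' t) (b' t) <= K) -> u <= v ->
    d (a' v) (b' v) <= d (a' u) (b' u).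
  move=> ha hb [K hK] uv.
  have uv0 : 0 <= v - u by lra.
  have as_ : asymp (fun t => a' (u + t)) (fun t => b' (u + t)).
    by exists K => r _; exact: hK.
  have := asymp_dist hM (line_ray u ha) (line_ray u hb) as_ uv0.
  by rewrite addr0 addrC subrK.
move=> ha hb [K hK].
wlog st : s t / s <= t.
  move=> hw; have /orP[st|ts] := le_total s t; first exact: hw.
  by apply/esym/hw.
apply/eqP; rewrite eq_le; apply/andP; split; last by apply: H => //; exists K.
have := @H (fun t => a (- t)) (fun t => b (- t)) (- t) (- s) (line_rev ha)
  (line_rev hb); rewrite /= !opprK; apply; last by lra.
by exists K => r; exact: hK.
Qed.

(* Sliding both endpoints from their feet outwards, the segment first meets and
   finally avoids the ball of radius [r]; stop just after it leaves it. *)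
Lemma barely_avoiding_segment c y z ty tz (r dl : R) : is_line c ->
  foot c y ty -> foot c z tz -> ty <= 0 -> 0 <= tz -> 0 <= r -> 0 < dl ->
  (forall l, 0 <= l <= 1 -> r < d (c 0) (pt hM y z l)) ->
  exists y' z' l, [/\ foot c y' ty, foot c z' tz, 0 <= l <= 1,
    d (c 0) (pt hM y' z' l) <= r + dl &
    forall l', 0 <= l' <= 1 -> r < d (c 0) (pt hM y' z' l')].
Proof.
move=> hc fy fz ty0 tz0 r0 dl0 hav.
pose K : R := (d (c ty) y + d (c tz) z) / dl.
have K0 : 0 <= K by rewrite divr_ge0 ?addr_ge0 ?mdist_ge0// ltW.
have [m0 hm0] : exists m0 : nat, K <= m0%:R.
  by have := archi_boundP K0; exists (Num.bound K); exact: ltW.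
pose m := m0.+1; have mK : K <= m%:R by rewrite /m -natr1; lra.
have mp : 0 < m%:R :> R by [].
have fr i : (i <= m)%N -> 0 <= (i%:R / m%:R : R) <= 1.
  by move=> im; apply: ratio01; rewrite ler0n ler_nat.
pose yy i := pt hM (c ty) y (i%:R / m%:R).
pose zz i := pt hM (c tz) z (i%:R / m%:R).
pose P i := forall l, 0 <= l <= 1 -> r < d (c 0) (pt hM (yy i) (zz i) l).
have Pm : P m by rewrite /P /yy /zz divff ?gt_eqF// !pt1.
(* With its endpoints at the feet, the segment lies on the line and contains [c 0]. *)
have P0 : ~ P 0%N.
  rewrite /P /yy /zz mul0r !pt0 => hP.
  have hl : 0 <= - ty / (tz - ty) <= 1 by apply: ratio01; apply/andP; split; lra.
  have := hP _ hl; apply/negP; rewrite -leNgt.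
  have ht : - ty <= tz - ty by lra.
  have h01 : 0 <= - ty <= tz - ty by apply/andP; split; lra.
  have e : c 0 = pt hM (c ty) (c tz) (- ty / (tz - ty)).
    apply: pt_unique => //; rewrite !hc (distrC ty tz) (@ger0_norm _ (tz - ty)); try lra.
      by rewrite ratioK// subr0 ler0_norm.
    by rewrite mulrBl mul1r ratioK// sub0r normrN ger0_norm//; lra.
  by rewrite -e mdistxx.
have [i [im nPi Pi]] : exists i, [/\ (i < m)%N, ~ P i & P i.+1].
  apply: contrapT => hn; have h i : (i <= m)%N -> ~ P i.
    elim: i => [//|i IH] im Pi; apply: hn; exists i; split => //.
    by apply: IH; exact: ltnW.
  exact: h m (leqnn m) Pm.
move/existsNP : nPi => [l /not_implyP[hl /negP]]; rewrite -leNgt => hd.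
have hi := fr _ (ltnW im); have hi1 := fr _ im.
exists (yy i.+1), (zz i.+1), l; split => //; try exact: foot_pt.
apply: le_trans (metric_triangle _ (pt hM (yy i) (zz i) l) _) _.
rewrite lerD//; apply: le_trans (pt_convex _ _ _ _ _ hl) _.
have st : `|i%:R / m%:R - i.+1%:R / m%:R| = m%:R^-1 :> R.
  by rewrite -mulrBl -natr1 opprD addrA subrr sub0r mulN1r normrN ger0_norm.
rewrite /yy /zz !d_pt_pt// st.
have h1 : d (c ty) y + d (c tz) z <= dl * m%:R.
  by move: mK; rewrite /K ler_pdivrMr// mulrC.
have h2 : m%:R^-1 * d (c ty) y <= dl.
  by rewrite mulrC ler_pdivrMr//; have := mdist_ge0 (c tz) z; lra.
have h3 : m%:R^-1 * d (c tz) z <= dl.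
  by rewrite mulrC ler_pdivrMr//; have := mdist_ge0 (c ty) y; lra.
have [l0 l1] := andP hl; have l1' : 0 <= 1 - l by lra.
by have := ler_wpM2l l1' h2; have := ler_wpM2l l0 h3; lra.
Qed.

Lemma geo_sub_segment y z l t : 0 <= l <= 1 -> 0 <= t <= d (pt hM y z l) z ->
  exists2 l', 0 <= l' <= 1 & geo hM (pt hM y z l) z t = pt hM y z l'.
Proof.
move=> hl ht; have [l0 l1] := andP hl; have [t0 t1] := andP ht.
have D0 := mdist_ge0 y z.
rewrite d_pt'// in t1.
have h : 0 <= l * d y z + t <= d y z.
  by apply/andP; split; [rewrite addr_ge0// mulr_ge0|lra].
exists ((l * d y z + t) / d y z); first exact: ratio01.
apply: geo_unique => //.
  apply: le_trans (metric_triangle _ (pt hM y z l) _) _.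
  by rewrite d_pt// d_geo.
by rewrite d_geo'// d_pt'//; lra.
Qed.

Lemma geo_opposite y z l s t : 0 <= l <= 1 ->
  0 <= t <= d (pt hM y z l) z -> 0 <= s <= d (pt hM y z l) y ->
  s + t <= d (geo hM (pt hM y z l) z t) (geo hM (pt hM y z l) y s).
Proof.
move=> hl ht hs; have e1 := d_geo' hM ht; have e2 := d_geo' hM hs.
have f1 := d_pt hM y z hl; have f2 := d_pt' hM y z hl.
set w := pt hM y z l in e1 e2 f1 f2 *.
set A := geo hM w z t in e1 *; set B := geo hM w y s in e2 *.
have := metric_triangle y B z; have := metric_triangle B A z.
rewrite (metric_sym y B) e1 e2 (metric_sym w y) f1 f2 (metric_sym B A); lra.
Qed.

(* Through a point [w] of the limit of such segments passes a line parallel to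
   [c], which stays outside the ball of radius [r]. *)
Lemma parallel_limit_bound (U : set_system nat) c (ys zs : nat -> M)
    (ty tz : nat -> R) (ls : nat -> R) w (r : R) :
  UltraFilter U -> is_line c -> periodic c -> ~ bounds_flat_half_plane c ->
  (forall n, foot c (ys n) (ty n)) -> (forall n, foot c (zs n) (tz n)) ->
  (forall K, \forall n \near U, ty n <= K) ->
  (forall K, \forall n \near U, K <= tz n) ->
  (forall n, 0 <= ls n <= 1) ->
  (forall n l, 0 <= l <= 1 -> r <= d (c 0) (pt hM (ys n) (zs n) l)) ->
  pt hM (ys n) (zs n) (ls n) @[n --> U] --> w -> 0 <= r ->
  forall t, r <= d (c t) w /\
    d (c t) w ^+ 2 <= 2 * t ^+ 2 + 2 * d (c 0) w ^+ 2 - r ^+ 2.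
Proof.
move=> UU hc hp hn fy fz hty htz hl hr hw r0.
have htz' : forall K, \forall n \near U, K <= - ty n.
  by move=> K; apply: filterS (hty (- K)) => n; lra.
have fy' n := foot_rev (fy n).
have ez := foot_escaping UU hc fz htz.
have ey := foot_escaping UU (line_rev hc) fy' htz'.
(* [p] and [q] are the two halves of the parallel line through [w]: seen from [c 0], the same
   escaping points have the two halves of [c] as limits. *)
have [p hp_ [p0 lp]] := geo_limit hM pM w ez.
have [q hq_ [q0 lq]] := geo_limit hM pM w ey.
have cz t : 0 <= t -> geo hM (c 0) (zs n) t @[n --> U] --> c t.
  exact: foot_geo_cvg fz htz.
have cy t : 0 <= t -> geo hM (c 0) (ys n) t @[n --> U] --> c (- t).
  have := foot_geo_cvg hM pM UU (line_rev hc) (periodic_rev hp)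
    (fun h => hn (half_plane_rev h)) fy' htz' (t := t).
  by rewrite oppr0.
have pc t : 0 <= t -> d (p t) (c t) <= 2 * d w (c 0).
  by move=> t0; apply: (geo_limit_fellow (b := c) ez t0 (lp t t0) (cz t t0)).
have qc t : 0 <= t -> d (q t) (c (- t)) <= 2 * d w (c 0).
  move=> t0.
  exact: (geo_limit_fellow (b := fun t => c (- t)) ey t0 (lq t t0) (cy t t0)).
pose wn n := pt hM (ys n) (zs n) (ls n).
have near_w e : 0 < e -> \forall n \near U, d w (wn n) < e.
  by move=> e0; move/mcvgP : hw => /(_ _ e0).
have pr t : 0 <= t -> r <= d (c 0) (p t).
  move=> t0; apply/ler_addgt0Pr => /= e e0.
  have e2 : 0 < e / 2 by rewrite divr_gt0.
  rewrite -lerBlDr; apply: (cvg_dist_ge (cvg_cst (c 0)) (lp t t0)).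
  apply: filterS3 (near_w _ e2) (ez w (t + e / 2)) (ez w t) => n h1 h2 h2'.
  have h3 := metric_triangle w (wn n) (zs n).
  have ht : 0 <= t <= d (wn n) (zs n) by rewrite t0; lra.
  have ht' : 0 <= t <= d w (zs n) by rewrite t0.
  have [l' hl' el] := geo_sub_segment (hl n) ht.
  have := hr n l' hl'; rewrite -el -/(wn n) => h4.
  have h5 : d (geo hM w (zs n) t) (geo hM (wn n) (zs n) t) <= 2 * d w (wn n).
    by apply: geo_fellow => //; have /andP[] := ht.
  have := metric_triangle (c 0) (geo hM w (zs n) t) (geo hM (wn n) (zs n) t).
  lra.
have qr t : 0 <= t -> r <= d (c 0) (q t).
  move=> t0; apply/ler_addgt0Pr => /= e e0.
  have e2 : 0 < e / 2 by rewrite divr_gt0.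
  rewrite -lerBlDr; apply: (cvg_dist_ge (cvg_cst (c 0)) (lq t t0)).
  apply: filterS3 (near_w _ e2) (ey w (t + e / 2)) (ey w t) => n h1 h2 h2'.
  have h3 := metric_triangle w (wn n) (ys n).
  have ht : 0 <= t <= d (wn n) (ys n) by rewrite t0; lra.
  have ht' : 0 <= t <= d w (ys n) by rewrite t0.
  have hl1 : 0 <= 1 - ls n <= 1 by have /andP[? ?] := hl n; apply/andP; split; lra.
  have wC : pt hM (zs n) (ys n) (1 - ls n) = wn n by apply: ptC.
  have ht2 := ht; rewrite -wC in ht2.
  have [l' hl' el] := geo_sub_segment hl1 ht2.
  have hl2 : 0 <= 1 - l' <= 1 by have /andP[? ?] := hl'; apply/andP; split; lra.
  have := hr n _ hl2; rewrite ptC// -el wC => h4.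
  have h5 : d (geo hM w (ys n) t) (geo hM (wn n) (ys n) t) <= 2 * d w (wn n).
    by apply: geo_fellow => //; have /andP[] := ht.
  have := metric_triangle (c 0) (geo hM w (ys n) t) (geo hM (wn n) (ys n) t).
  lra.
(* The segments extend on both sides of a point near [w], so the two limit rays are opposite and
   together form a line. *)
have pq s t : 0 <= s -> 0 <= t -> s + t <= d (p t) (q s).
  move=> s0 t0; apply/ler_addgt0Pr => /= e e0.
  have e4 : 0 < e / 4 by rewrite divr_gt0.
  rewrite -lerBlDr; apply: (cvg_dist_ge (lp t t0) (lq s s0)).
  apply: filterS3 (near_w _ e4) (ez w (t + e / 4)) (ey w (s + e / 4)) => n h1 h2 h3.
  have h4 := metric_triangle w (wn n) (zs n).
  have h5 := metric_triangle w (wn n) (ys n).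
  have ht : 0 <= t <= d (wn n) (zs n) by rewrite t0; lra.
  have hs : 0 <= s <= d (wn n) (ys n) by rewrite s0; lra.
  have ht' : 0 <= t <= d w (zs n) by rewrite t0; lra.
  have hs' : 0 <= s <= d w (ys n) by rewrite s0; lra.
  have h6 := geo_opposite (hl n) ht hs; rewrite -/(wn n) in h6.
  have h7 : d (geo hM w (zs n) t) (geo hM (wn n) (zs n) t) <= 2 * d w (wn n).
    by apply: geo_fellow => //; have /andP[] := ht.
  have h8 : d (geo hM w (ys n) s) (geo hM (wn n) (ys n) s) <= 2 * d w (wn n).
    by apply: geo_fellow => //; have /andP[] := hs.
  have := metric_triangle (geo hM (wn n) (zs n) t) (geo hM w (zs n) t)
    (geo hM (wn n) (ys n) s).
  have := metric_triangle (geo hM w (zs n) t) (geo hM w (ys n) s)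
    (geo hM (wn n) (ys n) s).
  by rewrite (metric_sym (geo hM (wn n) (zs n) t) (geo hM w (zs n) t)); lra.
pose b t := if 0 <= t then p t else q (- t).
have b0 : b 0 = w by rewrite /b lexx p0.
have hb : is_line b.
  have H s t : s <= t -> d (b s) (b t) = `|s - t|.
    move=> st; rewrite distrC (@ger0_norm _ (t - s)); last by lra.
    rewrite /b; have [s0|s0] := leP 0 s.
      rewrite (le_trans s0 st) hp_//; last by lra.
      by rewrite distrC ger0_norm//; lra.
    have [t0|t0] := leP 0 t; last first.
      by rewrite hq_; [rewrite ger0_norm; lra|lra|lra].
    have s0' : 0 <= - s by lra.
    apply/eqP; rewrite eq_le; apply/andP; split.
      have := metric_triangle (q (- s)) w (p t).
      have h1 := ray_dist hp_ t0; have h2 := ray_dist hq_ s0'.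
      by rewrite p0 in h1; rewrite q0 in h2; rewrite (metric_sym _ w) h1 h2; lra.
    by have := pq _ _ s0' t0; rewrite metric_sym; lra.
  move=> s t; have /orP[|] := le_total s t; first exact: H.
  by move=> ts; rewrite metric_sym distrC H.
have bc t : d (b t) (c t) <= 2 * d w (c 0).
  rewrite /b; have [t0|t0] := leP 0 t; first exact: pc.
  have := @qc (- t); rewrite opprK; apply; lra.
have br t : r <= d (c 0) (b t).
  rewrite /b; have [t0|t0] := leP 0 t; first exact: pr.
  by apply: qr; lra.
move=> t.
have e1 : d (c t) (b t) = d (c 0) (b 0).
  by apply: parallel_const => //; exists (2 * d w (c 0)) => s; rewrite metric_sym.
(* Shifting one of two parallel lines keeps their distance constant; this exchanges [d (c t) (b 0)]
   for [d (c 0) (b (- t))]. *)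
have bt : is_line (fun s => b (s - t)).
  by move=> u v; rewrite hb; congr `|_|; ring.
have e2 : d (c t) (b 0) = d (c 0) (b (- t)).
  have := @parallel_const c (fun s => b (s - t)) t 0 hc bt.
  rewrite subrr sub0r; apply; exists (2 * d w (c 0) + `|t|) => s.
  have := metric_triangle (c s) (b s) (b (s - t)); have := bc s.
  by rewrite hb (metric_sym (b s) (c s)) (_ : s - (s - t) = t); [lra|ring].
rewrite -b0; split; first by rewrite e2.
(* The diagonal from [c 0] to [b t] is at least [r]; the other diagonal is the distance to be
   bounded. *)
have := quadrilateral hM (c 0) (c t) (b t) (b 0).
rewrite !hb !hc e1 sub0r subr0 normrN real_normK ?num_real// (metric_sym (b 0)).
by have : r ^+ 2 <= d (c 0) (b t) ^+ 2; [rewrite ler_sqr ?nnegrE ?mdist_ge0|lra].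
Qed.

End avoiding_segments.

(** * Contraction along rank one axes *)

Section contraction.
Context {R : realType} {M : metricType R} (hM : npc M) (pM : proper_space M).
Local Notation d := (@mdist R M).
Implicit Types (x y z : M) (s t u v : R) (c : R -> M).

(** Otherwise segments avoid arbitrarily large balls centred on the line. Made to avoid a ball of
    radius [r] only barely, they give limit points [w] at distance about [r] for which [d w (c t)]
    varies by [O(1 / r)] at fixed [t]; as [r] grows this is slope 0 in [half_plane_lemma]. *)
Theorem contraction c : is_line c -> periodic c ->
  ~ bounds_flat_half_plane c ->
  exists2 D : R, 0 <= D & forall y z ty tz s, foot c y ty -> foot c z tz ->
    ty <= s - D -> s + D <= tz ->
    exists2 l : R, 0 <= l <= 1 & d (c s) (pt hM y z l) <= D.
Proof.
move=> hc hp hn; apply: contrapT => hD; apply: (hn).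
have [l l0 hl] := hp.
have W n : exists yz : (M * R) * (M * R),
  [/\ foot c yz.1.1 yz.1.2, foot c yz.2.1 yz.2.2, yz.1.2 <= - n%:R,
      n%:R <= yz.2.2 & forall l' : R, 0 <= l' <= 1 ->
      n%:R < d (c 0) (pt hM yz.1.1 yz.2.1 l')].
  have [y [z [ty [tz [s [fy fz hy hz hav]]]]]] : exists y z ty tz s,
    [/\ foot c y ty, foot c z tz, ty <= s - (n%:R + l), s + (n%:R + l) <= tz &
     forall l' : R, 0 <= l' <= 1 -> n%:R + l < d (c s) (pt hM y z l')].
    apply: contrapT => hh; apply: hD; exists (n%:R + l); first exact: addr_ge0.
    move=> y z ty tz s f1 f2 f3 f4; apply: contrapT => f5; apply: hh.
    exists y, z, ty, tz, s; split => // l' hl'; rewrite ltNge; apply/negP => f6.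
    by apply: f5; exists l'.
  have [s' [ss' [phi [hphi phic]]]] := hl s.
  have shift x t : d (phi x) (c t) = d x (c (s' + t)) by rewrite -phic hphi.
  have fphi x t : foot c x t -> foot c (phi x) (t - s').
    by move=> h t'; rewrite !shift addrC subrK.
  move: ss'; rewrite ler_norml => /andP[s1 s2].
  exists ((phi y, ty - s'), (phi z, tz - s')) => /=.
  split; [exact: fphi|exact: fphi|lra|lra|move=> l' hl'].
  have -> : pt hM (phi y) (phi z) l' = phi (pt hM y z l').
    by apply/esym/pt_unique => //; rewrite !hphi ?d_pt ?d_pt'.
  rewrite metric_sym shift addr0.
  have := metric_triangle (c s) (c s') (pt hM y z l'); have := hav l' hl'.
  have : d (c s) (c s') <= l by rewrite hc ler_norml s1 s2.
  by rewrite (metric_sym (c s') (pt _ _ _ _)); lra.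
have [yz hyz] := choice W.
have [U [UU oU]] := nat_ultrafilter.
have V (k : nat) : exists w, k.+1%:R <= d (c 0) w /\
    forall t, `|d w (c t) - d w (c 0)| <= (2 * t ^+ 2 + 3) / k.+1%:R.
  (* With the slack [dl = 1 / r], the square of [d (c 0) w] exceeds [r ^+ 2] by at most
     [2 + dl ^+ 2 <= 3], independently of [r]. *)
  pose r : R := k.+1%:R; pose dl : R := r^-1.
  have r1 : 1 <= r by rewrite /r ler1n.
  have rd : r * dl = 1 by rewrite /dl divff// gt_eqF//; lra.
  have dl0 : 0 < dl by rewrite invr_gt0; lra.
  have dl1 : dl <= 1 by rewrite /dl invf_le1//; lra.
  have B n : exists yzl : M * M * R, [/\ foot c yzl.1.1 (yz (n + k.+1)%N).1.2,
      foot c yzl.1.2 (yz (n + k.+1)%N).2.2, 0 <= yzl.2 <= 1,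
      d (c 0) (pt hM yzl.1.1 yzl.1.2 yzl.2) <= r + dl &
      forall l' : R, 0 <= l' <= 1 -> r < d (c 0) (pt hM yzl.1.1 yzl.1.2 l')].
    have [f1 f2 f3 f4 f5] := hyz (n + k.+1)%N.
    have nk : r <= (n + k.+1)%:R by rewrite ler_nat leq_addl.
    have r0 : 0 <= r by lra.
    have ty0 : (yz (n + k.+1)%N).1.2 <= 0 by lra.
    have tz0 : 0 <= (yz (n + k.+1)%N).2.2 by lra.
    have av l' : 0 <= l' <= 1 -> r < d (c 0)
        (pt hM (yz (n + k.+1)%N).1.1 (yz (n + k.+1)%N).2.1 l').
      by move=> hl'; apply: le_lt_trans (f5 l' hl').
    have [y' [z' [l' [g1 g2 g3 g4 g5]]]] :=
      barely_avoiding_segment hc f1 f2 ty0 tz0 r0 dl0 av.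
    by exists (y', z', l').
  have [b hb] := choice B.
  have [|w hw] := @pM (c 0) (r + dl) U UU
      (fun n => pt hM (b n).1.1 (b n).1.2 (b n).2).
    by apply: nearW => n; have [] := hb n.
  have inf K : \forall n \near U, K <= (n + k.+1)%:R :> R.
    apply: filterS (ultra_infty K oU) => n /le_trans; apply.
    by rewrite ler_nat leq_addr.
  have hy K : \forall n \near U, (yz (n + k.+1)%N).1.2 <= K.
    apply: filterS (inf (- K)) => n h.
    by have [_ _ h' _ _] := hyz (n + k.+1)%N; lra.
  have hz K : \forall n \near U, K <= (yz (n + k.+1)%N).2.2.
    apply: filterS (inf K) => n h.
    by have [_ _ _ h' _] := hyz (n + k.+1)%N; lra.
  have r0 : 0 <= r by lra.
  have P t : r <= d (c t) w /\
      d (c t) w ^+ 2 <= 2 * t ^+ 2 + 2 * d (c 0) w ^+ 2 - r ^+ 2.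
    apply: (parallel_limit_bound pM UU hc hp hn _ _ hy hz _ _ hw r0) => n;
      have [h1 h2 h3 h4 h5] := hb n => //.
    by move=> l' hl'; apply: ltW; exact: h5.
  have w1 : d (c 0) w <= r + dl.
    apply: (cvg_mdist_le hw); apply: nearW => n.
    by have [] := hb n.
  exists w; split; first by have [] := P 0.
  move=> t; have [p1 p2] := P t; have [p3 _] := P 0.
  rewrite (metric_sym w) (metric_sym w).
  rewrite ler_pdivlMr; last by lra.
  rewrite -/r; have t2 := sqr_ge0 t.
  move: (d (c t) w) (d (c 0) w) p1 p2 p3 w1 => A D p1 p2 p3 w1.
  have k1 : D ^+ 2 - r ^+ 2 <= 3.
    have : D ^+ 2 <= (r + dl) ^+ 2 by rewrite ler_sqr ?nnegrE//; lra.
    have : dl ^+ 2 <= 1 by rewrite expr_le1// ltW.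
    by rewrite sqrrD mulr2n rd; lra.
  have [AD|AD] := leP 0 (A - D).
    rewrite ger0_norm//; apply: (@le_trans _ _ ((A - D) * (A + D))).
      by rewrite ler_wpM2l//; lra.
    have -> : (A - D) * (A + D) = A ^+ 2 - D ^+ 2 by ring.
    by lra.
  rewrite ltr0_norm//; have : (- (A - D)) * r <= dl * r by rewrite ler_wpM2r//; lra.
  by rewrite (mulrC dl) rd; lra.
have [ws hws] := choice V.
apply: (half_plane_lemma hM pM (ys := ws) (U := U) (k := 0)) => //.
- by rewrite normr0.
- apply: (escapingP (x := c 0)) => K.
  apply: filterS (ultra_infty K oU) => n h; have [h' _] := hws n.
  by apply: le_trans h' => //; apply: le_trans h _; rewrite ler_nat.
- move=> t; rewrite mul0r; apply/cvgrPdist_lt => /= e e0.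
  have t2 := sqr_ge0 t.
  apply: filterS (ultra_infty ((2 * t ^+ 2 + 3) / e) oU) => n h.
  have [_ /(_ t) h'] := hws n; rewrite sub0r normrN; apply: le_lt_trans h' _.
  by move: h; rewrite ltr_pdivrMr// ler_pdivrMr// -natr1; lra.
Qed.

End contraction.

(** * Boundary points and the ends of axes *)

Section boundary_basics.
Context {R : realType} {M : metricType R}.
Local Notation d := (@mdist R M).
Implicit Types (xi : boundary M).

Lemma rayP (a : ray M) : is_ray a.
Proof. by case: a => a /= /asboolP. Qed.

Lemma endpointP (a b : ray M) : endpoint a = endpoint b <-> asymp a b.
Proof.
split=> [|h].
  by move/eqmodP => /asboolP[K hK]; exists K.
by apply/eqmodP; apply/asboolP; case: h => K hK; exists K.
Qed.

Lemma endrayK xi : endpoint (endray xi) = xi.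
Proof. exact: reprK. Qed.

Lemma boundary_map_endpoint (f : M -> M) (a b : ray M) :
  (forall x y, d (f x) (f y) = d x y) -> asymp (f \o a) b ->
  boundary_map f (endpoint a) = endpoint b.
Proof.
move=> hf hab; rewrite /boundary_map; apply/endpointP.
rewrite insubdK; last first.
  by apply/asboolP => s t s0 t0 /=; rewrite hf; exact: rayP.
apply: asymp_trans hab.
have [K hK] : asymp (endray (endpoint a)) a by apply/endpointP; rewrite endrayK.
by exists K => t t0 /=; rewrite hf; exact: hK.
Qed.

Lemma fixed_endpoint (f : M -> M) (a : ray M) :
  (forall x y, d (f x) (f y) = d x y) -> asymp (f \o a) a ->
  fixed_boundary f (endpoint a).
Proof. by move=> hf ha; rewrite /fixed_boundary/=; exact: boundary_map_endpoint. Qed.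

End boundary_basics.

Section directions.
Context {R : realType} {M : metricType R} (hM : npc M) (pM : proper_space M).
Local Notation d := (@mdist R M).
Implicit Types (x y z : M) (s t u v : R) (c : R -> M).

(** Escaping points with feet far out on both lines are approached from [c 0] along [c] and from
    [c' 0] along [c'], and limits towards the same points are asymptotic. *)
Lemma unique_direction c c' : is_line c -> periodic c ->
  ~ bounds_flat_half_plane c -> is_line c' -> periodic c' ->
  ~ bounds_flat_half_plane c' -> ~ asymp c c' ->
  exists T : R, forall y t t', foot c y t -> foot c' y t' -> T <= t -> T <= t' ->
    False.
Proof.
move=> hc hp hn hc' hp' hn' ha; apply: contrapT => hT; apply: ha.
have W (n : nat) : exists y : M * (R * R),
    [/\ foot c y.1 y.2.1, foot c' y.1 y.2.2, n%:R <= y.2.1 & n%:R <= y.2.2].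
  apply: contrapT => hh; apply: hT; exists n%:R => y t t' f1 f2 f3 f4.
  by apply: hh; exists (y, (t, t')).
have [ys hys] := choice W.
have [U [UU oU]] := nat_ultrafilter.
have inf K : \forall n \near U, K <= (ys n).2.1.
  apply: filterS (ultra_infty K oU) => n /le_trans; apply.
  by have [] := hys n.
have inf' K : \forall n \near U, K <= (ys n).2.2.
  apply: filterS (ultra_infty K oU) => n /le_trans; apply.
  by have [] := hys n.
have f1 n : foot c (ys n).1 (ys n).2.1 by have [] := hys n.
have f2 n : foot c' (ys n).1 (ys n).2.2 by have [] := hys n.
exists (2 * d (c 0) (c' 0)) => t t0.
apply: (geo_limit_fellow (foot_escaping UU hc f1 inf) t0).
  exact: (foot_geo_cvg hM pM UU hc hp hn f1 inf t0).
exact: (foot_geo_cvg hM pM UU hc' hp' hn' f2 inf' t0).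
Qed.

Lemma axis_periodic (f : M -> M) c : is_isometry f -> is_axis f c -> periodic c.
Proof.
move=> [hf sf] [hc [l l0 hl]]; exists l; first exact: ltW.
have [f' hf'] := choice sf.
have df' x y : d (f' x) (f' y) = d x y by rewrite -hf !hf'.
have f'l t : f' (c t) = c (t - l).
  by apply: mdist_positivity; rewrite -hf hf' hl subrK mdistxx.
move=> s; pose k := Num.floor (s / l).
have sk : k%:~R * l <= s < (k%:~R + 1) * l.
  have /andP[h1 h2] := mem_rg1_floor (s / l).
  by rewrite -ler_pdivlMr// -ltr_pdivrMr// -/k h1.
exists (k%:~R * l); split.
  move/andP: sk => [h1 h2]; rewrite ler_norml; apply/andP; split; lra.
case: {sk} k => n.
  exists (iter n f'); split => [x y|t].
    by elim: n => //= n IH; rewrite df'.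
  elim: n t => [|n IH] t /=; first by rewrite mul0r add0r.
  rewrite (_ : _ + t = n%:~R * l + (t + l)) ?IH ?f'l ?addrK//.
  by rewrite -addn1 PoszD intrD; ring.
exists (iter n.+1 f); split => [x y|t].
  by elim: n.+1 => //= m IH; rewrite hf.
rewrite NegzE mulrNz -pmulrn; elim: n.+1 t => [|m IH] t /=.
  by rewrite mulr0n oppr0 mul0r add0r.
rewrite (_ : _ + t = - m%:R * l + (t - l)) ?IH ?hl ?subrK//.
by rewrite -natr1; ring.
Qed.

Lemma half_line_drift (f : M -> M) c : is_axis f c ->
  (exists K, forall t, d (f (c t)) (c t) <= K) /\
  exists K, forall t, d (f (c (- t))) (c (- t)) <= K.
Proof.
move=> [hc [l l0 hl]].
by split; exists l => t; rewrite hl hc addrC addKr ger0_norm// ltW.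
Qed.

Lemma opposite_not_asymp c : is_line c -> ~ asymp c (fun t => c (- t)).
Proof.
move=> hc [K hK]; have K0 : 0 <= K.
  by apply: le_trans (hK 0 (lexx _)); rewrite mdist_ge0.
have := hK (K + 1); rewrite hc opprK (_ : K + 1 + (K + 1) = 2 * K + 2); last by ring.
by rewrite ger0_norm; [have : 0 <= K + 1 by lra; move=> h /(_ h)|]; lra.
Qed.

(** Bounded displacement along a half-line means that its endpoint is fixed; a common endpoint would
    be fixed by both isometries. *)
Lemma independent_not_asymp (f f' : M -> M) c c' : is_isometry f ->
  is_isometry f' -> independent f f' -> is_line c -> is_line c' ->
  (exists K, forall t, d (f (c t)) (c t) <= K) ->
  (exists K, forall t, d (f' (c' t)) (c' t) <= K) -> ~ asymp c c'.
Proof.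
move=> [hf _] [hf' _] hind hc hc' [K hK] [K' hK'] has_.
have rc : is_ray c by move=> s t _ _; exact: hc.
have rc' : is_ray c' by move=> s t _ _; exact: hc'.
pose a := Ray (asboolT rc); pose a' := Ray (asboolT rc').
have e : endpoint a = endpoint a' by apply/endpointP.
suff : (fixed_boundary f `&` fixed_boundary f') (endpoint a).
  by rewrite -/(independent _ _) in hind *; rewrite [X in X _]hind.
split; first by apply: fixed_endpoint => //; exists K => t _; exact: hK.
by rewrite e; apply: fixed_endpoint => //; exists K' => t _; exact: hK'.
Qed.

End directions.

(* The four directions are the two ends of the axes of two independent rank one
   isometries: [G (x, true)] translates along [L (x, true)] and
   [G (x, false)] is its inverse. *)
Section four_directions.
Context {R : realType} {M : metricType R} (hM : npc M) (pM : proper_space M).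
Local Notation d := (@mdist R M).
Implicit Types (x y z : M) (s t u v : R) (a b : bool * bool).

Definition opp_dir a : bool * bool := (a.1, ~~ a.2).

Record four_axes (G : bool * bool -> M -> M) (L : bool * bool -> R -> M) : Prop := {
  fa_line : forall a, is_line (L a) ;
  fa_periodic : forall a, periodic (L a) ;
  fa_half_plane : forall a, ~ bounds_flat_half_plane (L a) ;
  fa_opp : forall a t, L (opp_dir a) t = L a (- t) ;
  fa_dist : forall a x y, d (G a x) (G a y) = d x y ;
  fa_shift : exists2 l : bool -> R, (forall i : bool, 0 < l i) &
    forall a t, G a (L a t) = L a (t + l a.1) ;
  fa_asymp : forall a b, a != b -> ~ asymp (L a) (L b) }.

Context (G : bool * bool -> M -> M) (L : bool * bool -> R -> M).
Hypothesis fa : four_axes G L.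

(** The points projecting beyond [T] towards one end of an axis: the ping-pong domains of the four
    directions. *)
Definition in_direction (T : R) a y : Prop := exists2 t, foot (L a) y t & T <= t.

Lemma in_direction_mono (T T' : R) a y : T <= T' ->
  in_direction T' a y -> in_direction T a y.
Proof. by move=> TT' [t ft Tt]; exists t => //; exact: le_trans Tt. Qed.

Lemma in_direction_unique : exists T : R, forall y a b,
  in_direction T a y -> in_direction T b y -> a = b.
Proof.
have H (ab : (bool * bool) * (bool * bool)) : exists T : R, forall y,
    in_direction T ab.1 y -> in_direction T ab.2 y -> ab.1 = ab.2.
  have [e|ne] := eqVneq ab.1 ab.2; first by exists 0 => y _ _.
  have [T hT] := unique_direction hM pM (fa_line fa ab.1) (fa_periodic fa ab.1)
    (@fa_half_plane _ _ fa ab.1) (fa_line fa ab.2) (fa_periodic fa ab.2)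
    (@fa_half_plane _ _ fa ab.2) (fa_asymp fa ne).
  by exists T => y [t ft Tt] [t' ft' Tt']; case: (hT y t t').
have [T hT] := choice H.
exists (\sum_ab `|T ab|) => y a b ha hb.
have le : T (a, b) <= \sum_ab `|T ab|.
  rewrite (bigD1 (a, b))//=; apply: (le_trans (ler_norm _)).
  by rewrite lerDl sumr_ge0.
exact: (hT (a, b) y (in_direction_mono le ha) (in_direction_mono le hb)).
Qed.

Lemma foot_iter (n : nat) a y t (l : bool -> R) :
  (forall a t, G a (L a t) = L a (t + l a.1)) ->
  foot (L a) y t -> foot (L a) (iter n (G a) y) (t + n%:R * l a.1).
Proof.
move=> hl ft; elim: n => [|n IH] /=; first by rewrite mul0r addr0.
move=> t'; have := IH (t' - l a.1).
rewrite -(fa_dist fa a (iter n _ _) (L a _)) -(fa_dist fa a (iter n _ _) (L a (t' - _))).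
by rewrite !hl subrK -addrA -[X in _ + (_ + X)]mul1r -mulrDl natr1.
Qed.

(** Outside the opposite direction the foot is beyond [- T], and each application of [G a] advances
    it by a fixed length. The smaller of the two translation lengths gives one [N] for all
    directions. *)
Lemma iter_in_direction (T : R) : exists N : nat, forall n a y, (N <= n)%N ->
  ~ in_direction T (opp_dir a) y -> in_direction T a (iter n (G a) y).
Proof.
have [l l0 hl] := fa_shift fa.
have l0' : 0 < Num.min (l true) (l false) by rewrite lt_min !l0.
exists (Num.bound (2 * `|T| / Num.min (l true) (l false))) => n a y hn hy.
have [t ft] := foot_exists y (fa_line fa a).
have tT : - T < t.
  rewrite ltNge; apply/negP => tT; apply: hy; exists (- t); last by lra.
  by move=> t'; rewrite !(fa_opp fa) opprK; exact: ft.
exists (t + n%:R * l a.1); first exact: foot_iter.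
have h1 : 2 * `|T| <= n%:R * Num.min (l true) (l false).
  rewrite -ler_pdivrMr//; apply: (@le_trans _ _ (Num.bound (2 * `|T| / Num.min (l true) (l false)))%:R).
    by apply/ltW/archi_boundP; rewrite divr_ge0 ?mulr_ge0// ltW.
  by rewrite ler_nat.
have h2 : n%:R * Num.min (l true) (l false) <= n%:R * l a.1.
  by apply: ler_wpM2l => //; case: (a.1); rewrite ge_min lexx ?orbT.
by have := ler_norm T; lra.
Qed.

Lemma iter_passes_near (T : R) (o : M) : exists (N : nat) (r : R),
  forall n a y z, (N <= n)%N -> ~ in_direction T a y ->
  ~ in_direction T (opp_dir a) z ->
  exists2 l : R, 0 <= l <= 1 & d o (pt hM y (iter n (G a) z) l) <= r.
Proof.
have [D hD0 hD] : exists2 D : R, 0 <= D & forall a y z ty tz s,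
    foot (L a) y ty -> foot (L a) z tz -> ty <= s - D -> s + D <= tz ->
    exists2 l : R, 0 <= l <= 1 & d (L a s) (pt hM y z l) <= D.
  have h a : exists D : R, 0 <= D /\ forall y z ty tz s,
      foot (L a) y ty -> foot (L a) z tz -> ty <= s - D -> s + D <= tz ->
      exists2 l : R, 0 <= l <= 1 & d (L a s) (pt hM y z l) <= D.
    have [D D0 hD] := contraction hM pM (fa_line fa a) (fa_periodic fa a)
      (@fa_half_plane _ _ fa a).
    by exists D.
  have [D hD] := choice h.
  exists (\sum_a D a); first by rewrite sumr_ge0// => a _; have [] := hD a.
  move=> a y z ty tz s f1 f2 f3 f4.
  have le : D a <= \sum_a D a.
    by rewrite (bigD1 a)//= lerDl sumr_ge0// => b _; have [] := hD b.
  have [_ hDa] := hD a.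
  have [||l hl hl'] := hDa y z ty tz s f1 f2; [by lra|by lra|].
  by exists l => //; exact: le_trans le.
(* Leaves a margin [D] on each side of the parameter [|T| + D]: the foot of [y] is below [T], that
   of the translated [z] beyond [T']. *)
pose T' : R := `|T| + 2 * D.
have [N hN] := iter_in_direction T'.
have TT' : T <= T' by have := ler_norm T; rewrite /T'; lra.
exists N, (D + T' + \sum_a d (L a 0) o) => n a y z Nn hy hz.
have hz' : ~ in_direction T' (opp_dir a) z.
  by move=> h; apply: hz; exact: in_direction_mono h.
have [tz fz Tz] := hN n a z Nn hz'.
have [ty fy] := foot_exists y (fa_line fa a).
have Ty : ty < T by rewrite ltNge; apply/negP => h; apply: hy; exists ty.
have [||l hl hl'] := hD a y (iter n (G a) z) ty tz (`|T| + D) fy fz.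
- by have := ler_norm T; lra.
- by rewrite /T' in Tz; lra.
exists l => //.
have h1 : d o (L a 0) <= \sum_a d (L a 0) o.
  by rewrite (bigD1 a)//= metric_sym lerDl sumr_ge0// => b _; exact: mdist_ge0.
have h2 : d (L a 0) (L a (`|T| + D)) = `|T| + D.
  by rewrite (fa_line fa)// sub0r normrN ger0_norm// addr_ge0.
have := metric_triangle o (L a 0) (pt hM y (iter n (G a) z) l).
have := metric_triangle (L a 0) (L a (`|T| + D)) (pt hM y (iter n (G a) z) l).
by rewrite /T'; lra.
Qed.

End four_directions.

Section rank_one_axes.
Context {R : realType} {M : metricType R} (hM : npc M) (pM : proper_space M).
Local Notation d := (@mdist R M).

Lemma rank_one_four_axes (g g' h h' : M -> M) : rank_one g -> rank_one h ->
  independent g h -> cancel g' g -> cancel h' h -> exists L,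
  four_axes (fun a : bool * bool => if a.1 then if a.2 then g else g'
                                    else if a.2 then h else h') L.
Proof.
move=> [[ig _] [c ac nc]] [[ih _] [b ab nb]] hind gK hK.
exists (fun a : bool * bool => if a.1 then if a.2 then c else (fun t => c (- t))
                               else if a.2 then b else (fun t => b (- t))).
have lc : is_line c by case: ac. have lb : is_line b by case: ab.
have [dc dc'] := half_line_drift ac; have [db db'] := half_line_drift ab.
have dg x y : d (g' x) (g' y) = d x y by rewrite -(proj1 ig) !gK.
have dh x y : d (h' x) (h' y) = d x y by rewrite -(proj1 ih) !hK.
split.
- by move=> [[] []] //=; exact: line_rev.
- by move=> [[] []] /=; [|apply: periodic_rev| |apply: periodic_rev];
    [apply: axis_periodic ac|apply: axis_periodic ac|apply: axis_periodic ab
    |apply: axis_periodic ab].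
- by move=> [[] []] //= /half_plane_rev.
- by move=> [[] []] t //=; rewrite opprK.
- by move=> [[] []] x y /=; [exact: (proj1 ig)| exact: dg|exact: (proj1 ih)|exact: dh].
- have [_ [l l0 hl]] := ac; have [_ [m m0 hm]] := ab.
  exists (fun i : bool => if i then l else m); first by case.
  have H (f f' : M -> M) (a : R -> M) r : is_isometry f -> cancel f' f ->
      (forall t, f (a t) = a (t + r)) -> forall t, f' (a (- t)) = a (- (t + r)).
    move=> fi fK fa t; apply: mdist_positivity.
    by rewrite -(proj1 fi) fK fa opprD subrK mdistxx.
  by move=> [[] []] t //=; [exact: H hl t|exact: H hm t].
have oc := opposite_not_asymp lc; have ob := opposite_not_asymp lb.
have lc' := line_rev lc; have lb' := line_rev lb.
have N1 := independent_not_asymp ig ih hind lc lb dc db.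
have N2 := independent_not_asymp ig ih hind lc' lb dc' db.
have N3 := independent_not_asymp ig ih hind lc lb' dc db'.
have N4 := independent_not_asymp ig ih hind lc' lb' dc' db'.
move=> [[] []] [[] []] //= _ //; by move/asymp_sym.
Qed.

End rank_one_axes.

(** * Choosing directions in both factors at once *)

Section extension.
Context {R : realType} {X1 X2 : metricType R}.
Context (h1 : npc X1) (p1 : proper_space X1) (h2 : npc X2) (p2 : proper_space X2).
Context (G1 : bool * bool -> X1 -> X1) (L1 : bool * bool -> R -> X1).
Context (G2 : bool * bool -> X2 -> X2) (L2 : bool * bool -> R -> X2).
Hypotheses (fa1 : four_axes G1 L1) (fa2 : four_axes G2 L2).

(** Together [e], [P] and [Q] exclude at most three of the four directions. *)
Lemma avoid_directions (P Q : bool * bool -> Prop) (e : bool * bool) :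
  (forall a b, P a -> P b -> a = b) -> (forall a b, Q a -> Q b -> a = b) ->
  exists a, [/\ a <> e, ~ P a & ~ Q a].
Proof.
move=> hP hQ; apply: contrapT => hn.
pose S := [set a | `[< P a >]]%SET; pose S' := [set a | `[< Q a >]]%SET.
have c1 : (#|S| <= 1)%N.
  apply/card_le1P => a; rewrite inE => /asboolP Pa b.
  rewrite !inE; apply/idP/idP => [/asboolP Pb|/eqP ->]; last exact/asboolP.
  by apply/eqP; exact: hP.
have c2 : (#|S'| <= 1)%N.
  apply/card_le1P => a; rewrite inE => /asboolP Pa b.
  rewrite !inE; apply/idP/idP => [/asboolP Pb|/eqP ->]; last exact/asboolP.
  by apply/eqP; exact: hQ.
have : (#|[set: bool * bool]%SET| <= #|(e |: (S :|: S'))%SET|)%N.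
  apply/subset_leq_card/fintype.subsetP => a _; rewrite !inE.
  apply/orP; have [->|ne] := eqVneq a e; [by left|right].
  apply/orP; apply: contrapT => /not_orP[n1 n2]; apply: hn; exists a.
  by split=> [/eqP|Pa|Qa]; [rewrite (negbTE ne)|apply: n1; apply/asboolP
    |apply: n2; apply/asboolP].
rewrite cardsT card_prod card_bool.
have := leq_card_setU S S'; have := leq_card_setU [set e]%SET (S :|: S')%SET.
by rewrite cards1 => -[k1 _] [k2 _] k3; move: c1 c2 k1 k2 k3; lia.
Qed.

(* First [b ^ N] brings [z] into a known direction in both factors, then
   [a ^ N] is chosen among the directions avoiding [y] and [opp b]. *)
Lemma extension_lemma (o : l2prod X1 X2) : exists (N : nat) (r : R),
  forall y z : l2prod X1 X2, exists a b : bool * bool,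
  (exists2 l : R, 0 <= l <= 1 &
    mdist o.1 (pt h1 y.1 (iter N (G1 a) (iter N (G1 b) z.1)) l) <= r) /\
  (exists2 l : R, 0 <= l <= 1 &
    mdist o.2 (pt h2 y.2 (iter N (G2 a) (iter N (G2 b) z.2)) l) <= r).
Proof.
have [T1 u1] := in_direction_unique h1 p1 fa1.
have [T2 u2] := in_direction_unique h2 p2 fa2.
have [M1 i1] := iter_in_direction fa1 T1.
have [M2 i2] := iter_in_direction fa2 T2.
have [N1 [r1 n1]] := iter_passes_near h1 p1 fa1 T1 o.1.
have [N2 [r2 n2]] := iter_passes_near h2 p2 fa2 T2 o.2.
pose N := (M1 + M2 + (N1 + N2))%N.
exists N, (Num.max r1 r2) => y z.
have oppK a : opp_dir (opp_dir a) = a by case: a => x s; rewrite /opp_dir/= negbK.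
(* Each factor excludes at most one direction; the slot [e] holds an arbitrary third one. *)
have [b [_ b1 b2]] := @avoid_directions
  (fun b => in_direction L1 T1 (opp_dir b) z.1)
  (fun b => in_direction L2 T2 (opp_dir b) z.2) (true, true)
  (fun a b ha hb => can_inj oppK (u1 _ _ _ ha hb))
  (fun a b ha hb => can_inj oppK (u2 _ _ _ ha hb)).
have {}i1 := i1 N b z.1 _ b1; have {}i2 := i2 N b z.2 _ b2.
have d1 : in_direction L1 T1 b (iter N (G1 b) z.1) by apply: i1; rewrite /N; lia.
have d2 : in_direction L2 T2 b (iter N (G2 b) z.2) by apply: i2; rewrite /N; lia.
have [a [ab a1 a2]] := @avoid_directions
  (fun a => in_direction L1 T1 a y.1) (fun a => in_direction L2 T2 a y.2)
  (opp_dir b) (u1 _) (u2 _).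
have nb : opp_dir a <> b by move=> e; apply: ab; rewrite -e oppK.
exists a, b; split.
  have [||l hl hl'] := n1 N a y.1 (iter N (G1 b) z.1) _ a1.
  - by rewrite /N; lia.
  - by move=> h; apply: nb; exact: u1 h d1.
  by exists l => //; rewrite le_max hl'.
have [||l hl hl'] := n2 N a y.2 (iter N (G2 b) z.2) _ a2.
- by rewrite /N; lia.
- by move=> h; apply: nb; exact: u2 h d2.
by exists l => //; rewrite le_max hl' orbT.
Qed.

End extension.

(** * The geometric boundary of a product *)

Section boundary_topology.
Context {R : realType} {M : metricType R} (hM : npc M) (pM : proper_space M).
Local Notation d := (@mdist R M).
Implicit Types (x y z p : M) (xi zeta : boundary M) (s t e : R).

Definition ray_to x xi : R -> M :=
  let: exist2 r _ _ := cid2 (ray_from hM pM x (rayP (endray xi))) in r.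

Lemma ray_to_ray x xi : is_ray (ray_to x xi).
Proof. by rewrite /ray_to; case: cid2. Qed.

Lemma ray_to0 x xi : ray_to x xi 0 = x.
Proof. by rewrite /ray_to; case: cid2 => ? ? []. Qed.

Lemma ray_to_asymp x xi : asymp (ray_to x xi) (endray xi).
Proof. by rewrite /ray_to; case: cid2 => ? ? []. Qed.

Lemma endpoint_ray_to x xi : endpoint (Ray (asboolT (ray_to_ray x xi))) = xi.
Proof.
by rewrite -[RHS]endrayK; apply/endpointP => /=; exact: ray_to_asymp.
Qed.

Lemma ray_to_unique (a : ray M) x xi t : endpoint a = xi -> a 0 = x -> 0 <= t ->
  ray_to x xi t = a t.
Proof.
move=> axi a0 t0; apply: (asymp_eq hM) => //.
- exact: ray_to_ray.
- exact: rayP.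
- apply: asymp_trans (ray_to_asymp x xi) _.
  by apply/endpointP; rewrite endrayK.
- by rewrite ray_to0.
Qed.

Lemma ray_to_dist x y xi t : 0 <= t -> d (ray_to x xi t) (ray_to y xi t) <= d x y.
Proof.
move=> t0; rewrite -[in X in _ <= X](ray_to0 x xi) -[in X in _ <= X](ray_to0 y xi).
apply: (asymp_dist hM) => //; try exact: ray_to_ray.
exact: asymp_trans (ray_to_asymp x xi) (asymp_sym (ray_to_asymp y xi)).
Qed.

Definition cone_at x xi t e : set (boundary M) :=
  [set zeta | d (ray_to x zeta t) (ray_to x xi t) < e].

Lemma cone_at_open x xi t e : 0 < t -> 0 < e -> open (cone_at x xi t e).
Proof.
move=> t0 e0; pose c := Ray (asboolT (ray_to_ray x xi)).
exists (cone_nbhd c t e).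
  exists [set cone_nbhd c t e]; last by rewrite bigcup_set1.
  move=> _ ->; apply: finI_from1; right.
  by exists c, t, e.
apply/seteqP; split => zeta /=.
  move=> [a [az a0 h]]; rewrite /cone_at/= (ray_to_unique az) ?ltW//.
  by rewrite a0/= ray_to0.
rewrite /cone_at/= => h; exists (Ray (asboolT (ray_to_ray x zeta))); split => //=.
  exact: endpoint_ray_to.
by rewrite !ray_to0.
Qed.

Lemma cone_at_self x xi t e : 0 < e -> cone_at x xi t e xi.
Proof. by move=> e0; rewrite /cone_at/= mdistxx. Qed.

Lemma lipschitz_open (f : M -> R) x t e : (forall y z, f y <= f z + d y z) ->
  0 <= t -> open [set xi | f (ray_to x xi t) < e].
Proof.
move=> hf; rewrite le_eqVlt => /orP[/eqP <-|t0].
  have [h|h] := boolP (f x < e).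
    by rewrite (_ : [set _ | _] = setT); [exact: openT
      |apply/seteqP; split => // xi _ /=; rewrite ray_to0].
  rewrite (_ : [set _ | _] = set0); first exact: open0.
  by apply/seteqP; split => // xi /=; rewrite ray_to0 (negbTE h).
rewrite openE => xi /= hxi; rewrite /interior nbhsE/=.
exists (cone_at x xi t (e - f (ray_to x xi t))).
  by split; [apply: cone_at_open; rewrite ?subr_gt0
    |apply: cone_at_self; rewrite subr_gt0].
by move=> zeta; rewrite /cone_at/= => h; have := hf (ray_to x zeta t) (ray_to x xi t); lra.
Qed.

(** The width is kept at 1 and only the time grows. Since this is a filter, comparing it with the
    topology on subbasic sets is enough. *)
Let cone_filter x xi : set_system (boundary M) := fun A =>
  exists2 r : R, 0 < r & forall t, r <= t -> cone_at x xi t 1 `<=` A.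

Let cone_filter_filter x xi : Filter (cone_filter x xi).
Proof.
split.
- by exists 1 => // t _ zeta.
- move=> A B [r r0 hA] [s s0 hB]; exists (r + s); first exact: addr_gt0.
  by move=> t rt zeta hz; split; [apply: hA hz|apply: hB hz]; lra.
- by move=> A B AB [r r0 hA]; exists r => // t rt; apply: subset_trans AB; exact: hA.
Qed.

(* Changing the base point moves the ray to a boundary point by a bounded
   amount, which convexity makes small at time [r] when it occurs at time
   [t >> r]. *)
Lemma cone_filter_cone_nbhd x xi (c : ray M) r e : 0 < r ->
  cone_nbhd c r e (inr xi) ->
  cone_filter x xi (inr @^-1` (cone_nbhd c r e)).
Proof.
move=> r0 [a [axi a0 h]].
pose y := c 0; pose K := 2 * d x y + 1.
have K0 : 0 < K by have := mdist_ge0 x y; rewrite /K; lra.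
have ay t : 0 <= t -> ray_to y xi t = a t by move=> t0; apply: ray_to_unique.
pose eta := e - d (a r) (c r); have eta0 : 0 < eta by rewrite subr_gt0.
have q0 : 0 < r * K / eta by rewrite divr_gt0// mulr_gt0.
(* At time [t] the rays from [y] are less than [K] apart, so at time [r] less than [r * K / t],
   which is below the available [eta]. *)
exists (r + r * K / eta + 1) => [|t ht zeta hz]; first by lra.
have t0 : 0 < t by lra.
exists (Ray (asboolT (ray_to_ray y zeta))); split => /=.
- exact: endpoint_ray_to.
- by rewrite ray_to0.
have hrt : 0 <= r <= t by apply/andP; split; lra.
have := ray_convex hM (ray_to_ray y zeta) (rayP a) hrt t0.
rewrite ray_to0 a0 mdistxx mulr0 add0r => h1.
have h2 : d (ray_to y zeta t) (a t) < K.
  rewrite -ay; last exact: ltW.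
  have t0' := ltW t0.
  have := ray_to_dist x y zeta t0'; have := ray_to_dist x y xi t0'.
  have := metric_triangle (ray_to y zeta t) (ray_to x zeta t) (ray_to y xi t).
  have := metric_triangle (ray_to x zeta t) (ray_to x xi t) (ray_to y xi t).
  by move: hz; rewrite /cone_at/= /K (metric_sym (ray_to x zeta t) (ray_to y zeta t)); lra.
have h3 : r / t * d (ray_to y zeta t) (a t) < eta.
  rewrite mulrAC ltr_pdivrMr//; apply: (@le_lt_trans _ _ (r * K)).
    by rewrite ler_pM2l// ltW.
  by rewrite -ltr_pdivrMl// [X in X < _]mulrC; lra.
by have := metric_triangle (ray_to y zeta r) (a r) (c r); rewrite /eta in h3; lra.
Qed.

Lemma boundary_basis x xi (U : set (boundary M)) : open U -> U xi ->
  exists2 r : R, 0 < r & forall t, r <= t -> cone_at x xi t 1 `<=` U.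
Proof.
move=> [V [D hD <-]] <- [B DB Bxi].
have [D' sD' eB] := hD B DB.
suff : cone_filter x xi (inr @^-1` B).
  by move=> [r r0 hr]; exists r => // t rt zeta hz; exists B => //; exact: hr hz.
rewrite -eB in Bxi *.
apply: (@filter_bigI _ _ D' (fun i => inr @^-1` isSubBaseTopological.b i) _
  (cone_filter_filter x xi)) => i iD.
have := Bxi i iD; have := sD' i iD; rewrite inE => -[[p [r ->]]|[c [r [e [r0 e0 ->]]]]].
  by move=> [? ?].
exact: cone_filter_cone_nbhd.
Qed.

Lemma finite_net x r e : 0 < e -> exists s : seq M, forall y, d x y <= r ->
  exists2 z, z \in s & d z y < e.
Proof.
move=> e0; apply: contrapT => hn.
have W (s : seq M) : exists y, d x y <= r /\ forall z, z \in s -> e <= d z y.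
  apply: contrapT => hs; apply: hn; exists s => y hy.
  apply: contrapT => hz; apply: hs; exists y; split => // z zs.
  by rewrite leNgt; apply/negP => h; apply: hz; exists z.
have [f hf] := choice W.
pose l n := iter n (fun s : seq M => f s :: s) [::]; pose u n := f (l n).
have ul m n : (m < n)%N -> u m \in l n.
  elim: n => // n IH; rewrite ltnS leq_eqVlt => /orP[/eqP ->|/IH h].
    by rewrite /l/= inE eqxx.
  by rewrite /l/= inE h orbT.
have [U [UU oU]] := nat_ultrafilter.
have [|y hy] := @pM x r U UU u; first by apply: nearW => n; have [] := hf (l n).
have e2 : 0 < e / 2 by rewrite divr_gt0.
move/mcvgP : hy => /(_ _ e2) hy.
have [m hm] := filter_ex hy.
have hgt : \forall n \near U, (m < n)%N by apply: oU; exists m.+1.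
have [n [hn1 hn2]] := filter_ex (filterI hy hgt).
have [_ /(_ (u m) (ul _ _ hn2))] := hf (l n).
have := metric_triangle (u m) y (u n); rewrite (metric_sym (u m) y) -/(u n).
by move: hm hn1 => /=; lra.
Qed.

(** A Lindelof property. Take a time [k] and a point of a finite net of the ball of radius [k]:
    boundary points whose rays at time [k] are near that net point lie in one another's [cone_at] of
    width 1, so one open set for each such pair is enough. *)
Lemma boundary_lindelof x (N : set (boundary M)) (P : set (boundary M) -> Prop) :
  P set0 -> (forall xi, N xi -> exists U, [/\ open U, U xi & P U]) ->
  exists U : nat -> nat -> set (boundary M),
    (forall i j, open (U i j) /\ P (U i j)) /\
    N `<=` \bigcup_i \bigcup_j U i j.
Proof.
move=> P0 hN.
have hnet (k : nat) : exists s : seq M, forall y, d x y <= k%:R ->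
    exists2 z, z \in s & d z y < 1 / 2.
  by apply: finite_net; lra.
have [net hnet'] := choice hnet.
have W (kj : nat * nat) : exists U, [/\ open U, P U & forall xi, N xi ->
   d (nth x (net kj.1) kj.2) (ray_to x xi kj.1%:R) < 1 / 2 ->
   (exists V, [/\ open V, P V & cone_at x xi kj.1%:R 1 `<=` V]) -> U xi].
  have [[xi [Nxi hd [V [oV PV hV]]]]|hno] := pselect (exists xi, [/\ N xi,
      d (nth x (net kj.1) kj.2) (ray_to x xi kj.1%:R) < 1 / 2 &
      exists V, [/\ open V, P V & cone_at x xi kj.1%:R 1 `<=` V]]).
    exists V; split => // zeta Nz hz _; apply: hV; rewrite /cone_at/=.
    have := metric_triangle (ray_to x zeta kj.1%:R) (nth x (net kj.1) kj.2)
      (ray_to x xi kj.1%:R).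
    by rewrite (metric_sym (ray_to x zeta _) (nth _ _ _)); lra.
  exists set0; split => //; first exact: open0.
  by move=> xi Nxi h1 h2; exfalso; apply: hno; exists xi.
have [U hU] := choice W.
exists (fun i j => U (i, j)); split; first by move=> i j; have [] := hU (i, j).
move=> xi Nxi; have [V [oV Vxi PV]] := hN xi Nxi.
have [r r0 hr] := boundary_basis x oV Vxi.
pose k := Num.bound r.
have rk : r <= k%:R by apply/ltW/archi_boundP/ltW.
have xk : d x (ray_to x xi k%:R) <= k%:R.
  by rewrite -{1}(ray_to0 x xi) (ray_dist (ray_to_ray x xi)).
have [z zs hz] := hnet' k _ xk.
exists k => //; exists (index z (net k)) => //.
have [_ _ /(_ xi Nxi)] := hU (k, index z (net k)); apply; rewrite /= ?nth_index//.
by exists V; split => //; exact: hr.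
Qed.

Lemma boundary_map_ray_to (f : M -> M) x xi t :
  (forall x y, d (f x) (f y) = d x y) -> 0 <= t ->
  ray_to (f x) (boundary_map f xi) t = f (ray_to x xi t).
Proof.
move=> hf t0.
have ra : is_ray (f \o ray_to x xi).
  by move=> s u s0 u0 /=; rewrite hf; exact: ray_to_ray.
have e : boundary_map f xi = endpoint (Ray (asboolT ra)).
  rewrite -[in LHS](endrayK xi); apply: boundary_map_endpoint => //=.
  have [K hK] := ray_to_asymp x xi; exists K => s s0 /=.
  by rewrite hf metric_sym hK.
apply: (ray_to_unique (a := Ray (asboolT ra))) => //=.
by rewrite ray_to0.
Qed.

End boundary_topology.

(** * Busemann functions *)

Section busemann.
Context {R : realType} {M : metricType R} (hM : npc M) (pM : proper_space M).
Local Notation d := (@mdist R M).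
Implicit Types (x y z : M) (eta : boundary M) (s t e : R).

(** The function is nonincreasing and bounded below. This makes the limit in [busemann] a genuine
    one. *)
Lemma cvg_horofunction (c : R -> M) x : is_ray c ->
  cvg (d x (c t) - t @[t --> +oo]).
Proof.
move=> hc; pose F t := d x (c t) - t.
have Fmono s t : 0 <= s -> s <= t -> F t <= F s.
  move=> s0 st; have := metric_triangle x (c s) (c t).
  have t0 : 0 <= t by lra.
  rewrite hc// distrC ger0_norm ?subr_ge0// /F; lra.
have Flb t : 0 <= t -> - d x (c 0) <= F t.
  move=> t0; have := metric_triangle (c 0) x (c t).
  by rewrite ray_dist// (metric_sym (c 0)) /F; lra.
pose S := [set F t | t in [set t | 0 <= t]].
have S0 : S (F 0) by exists 0 => //=.
have hS : has_inf S.
  split; first by exists (F 0).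
  by exists (- d x (c 0)) => _ [t t0 <-]; exact: Flb.
apply/cvg_ex; exists (inf S); apply/cvgrPdist_le => e e0.
have [_ [s s0 <-] hs] := inf_adherent e0 hS.
near=> t.
have st : s <= t by near: t; apply: nbhs_pinfty_ge; exact: num_real.
have t0 : 0 <= t by move: s0 => /= s0; lra.
have h1 : inf S <= F t by apply: ge_inf; [case: hS|exists t].
have h2 := Fmono s t s0 st.
by rewrite -/(F t) distrC ger0_norm; lra.
Unshelve. all: by end_near. Qed.

Lemma cvg_busemann eta x y :
  d x (endray eta t) - d y (endray eta t) @[t --> +oo] --> busemann eta x y.
Proof.
have -> : (fun t => d x (endray eta t) - d y (endray eta t)) =
  (fun t => (d x (endray eta t) - t) - (d y (endray eta t) - t)).
  by apply/funext => t; ring.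
rewrite /busemann.
have -> : (fun t => d x (endray eta t) - d y (endray eta t)) =
  (fun t => (d x (endray eta t) - t) - (d y (endray eta t) - t)).
  by apply/funext => t; ring.
apply: is_cvgB; exact: cvg_horofunction (rayP _).
Qed.

Lemma busemann_le eta x y : busemann eta x y <= d x y.
Proof.
apply: (ler_cvg_to (cvg_busemann (eta:=eta) (x:=x) (y:=y))); [exact: cvg_cst|].
apply: nearW => t; have := metric_triangle x y (endray eta t); lra.
Qed.

Lemma busemann_ge eta x y : - d x y <= busemann eta x y.
Proof.
apply: (ler_cvg_to (f := cst (- d x y)) _ (@cvg_busemann eta x y)); [exact: cvg_cst|].
apply: nearW => t; have := metric_triangle y x (endray eta t).
by rewrite /= (metric_sym y x); lra.
Qed.

(** A path from [x] to far points of [endray eta] may join the ray from [y] at time [s], at cost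
    [r], and saves [s]. The segments from [y] to these points converge to that ray and stand in for
    it. *)
Lemma busemann_ray_le eta x y s (r : R) : 0 <= s ->
  d x (ray_to hM pM y eta s) <= r -> busemann eta x y <= r - s.
Proof.
move=> s0 hr; apply/ler_addgt0Pr => /= e e0.
have [U [UU oU]] := nat_ultrafilter.
have e2 : 0 < e / 2 by rewrite divr_gt0.
have hT K : \forall n \near U, K <= n%:R :> R.
  by apply: oU; apply: filterS (nbhs_infty_gtr K) => n; exact: ltW.
have h1 := geo_to_ray hM pM (rayP (endray eta)) (ray_to_ray hM pM y eta)
  (ray_to_asymp hM pM y eta) hT s0.
rewrite ray_to0 in h1; move/mcvgP : (h1 UU) => /(_ _ e2) {}h1.
have h2 : \forall n \near U, `|busemann eta x y -
    (d x (endray eta n%:R) - d y (endray eta n%:R))| < e / 2.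
  apply: oU; have h := cvg_comp _ _ (@cvgr_idn R) (@cvg_busemann eta x y).
  by move/cvgrPdist_lt : h; exact.
have hesc := escaping_ray (U := U) (rayP (endray eta)) hT.
have [n [h3 [h4 h5]]] := filter_ex (filterI h1 (filterI h2 (hesc UU y s))).
have hs : 0 <= s <= d y (endray eta n%:R) by rewrite s0.
have := d_geo' hM hs.
have := metric_triangle x (ray_to hM pM y eta s) (geo hM y (endray eta n%:R) s).
have := metric_triangle x (geo hM y (endray eta n%:R) s) (endray eta n%:R).
by move: h3 h4; rewrite /= ltr_norml => h3 /andP[h4 h4']; lra.
Qed.

End busemann.

(** * Rays of given slope in the product *)

Section coordinates.
Context {R : realType} {X1 X2 : metricType R}.
Context (h1 : npc X1) (p1 : proper_space X1) (h2 : npc X2) (p2 : proper_space X2).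
Local Notation X := (l2prod X1 X2).

Lemma product_ray (a1 : R -> X1) (a2 : R -> X2) (theta : R) :
  is_ray a1 -> is_ray a2 -> 0 <= cos theta -> 0 <= sin theta ->
  is_ray (fun t => (a1 (t * cos theta), a2 (t * sin theta)) : X).
Proof.
move=> r1 r2 c0 s0 s t hs ht; apply/eqP.
rewrite -(@eqrXn2 _ 2) ?mdist_ge0// l2dist_sqr/=.
rewrite r1 ?mulr_ge0// r2 ?mulr_ge0// !real_normK ?num_real//.
rewrite -!mulrBl !exprMn -mulrDr cos2Dsin2 mulr1 //.
Qed.

Lemma coordinates_ray_to xi eta1 eta2 (theta : R) (y : X) (t : R) :
  0 <= cos theta -> 0 <= sin theta ->
  has_coordinates xi eta1 eta2 theta -> 0 <= t ->
  ray_to (npc_l2prod h1 h2) (proper_l2prod p1 p2) y xi t =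
  (ray_to h1 p1 y.1 eta1 (t * cos theta), ray_to h2 p2 y.2 eta2 (t * sin theta)).
Proof.
move=> c0 s0 [c [c1 [c2 [cxi ce1 ce2 hc]]]] t0.
pose a t : X :=
  (ray_to h1 p1 y.1 eta1 (t * cos theta), ray_to h2 p2 y.2 eta2 (t * sin theta)).
have ra : is_ray a.
  by apply: product_ray => //; exact: ray_to_ray.
have a0 : a 0 = y by rewrite /a !mul0r !ray_to0; case: (y).
apply: (ray_to_unique _ _ (a := Ray (asboolT ra))) => //=.
rewrite -cxi; apply/endpointP => /=.
have [K1 hK1] : asymp (ray_to h1 p1 y.1 eta1) c1.
  by apply: asymp_trans (ray_to_asymp h1 p1 y.1 eta1) _; apply/endpointP; rewrite endrayK.
have [K2 hK2] : asymp (ray_to h2 p2 y.2 eta2) c2.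
  by apply: asymp_trans (ray_to_asymp h2 p2 y.2 eta2) _; apply/endpointP; rewrite endrayK.
exists (K1 + K2) => s hs; rewrite hc//.
apply: le_trans (mdist_le_add _ _) _; rewrite /a/=.
by rewrite lerD ?hK1 ?hK2 ?mulr_ge0.
Qed.

End coordinates.

(** * Discrete groups and shadows *)

Section compact_open_identity.
Context {R : realType} {M : metricType R}.
Local Notation d := (@mdist R M).

(** Translates the compact-open topology into displacements. If, for every [n], some map displacing
    the ball of radius [n] by less than [1 / (n + 1)] failed to send [K] into [O], the offending
    points of [K] and their images would have a common limit in [K], hence in [O]. *)
Lemma compact_open_nbhs_id (o : M) (A : set {compact-open, M -> M}) :
  nbhs (id : {compact-open, M -> M}) A -> exists (r e : R), 0 < e /\
  forall f : M -> M, (forall x, d o x <= r -> d x (f x) < e) -> A f.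
Proof.
move=> hA.
pose F : set_system {compact-open, M -> M} := fun S => exists n : nat,
  forall f : M -> M, (forall x, d o x <= n%:R -> d x (f x) < n.+1%:R^-1) -> S f.
have mono (n m : nat) (f : M -> M) : (n <= m)%N ->
    (forall x, d o x <= m%:R -> d x (f x) < m.+1%:R^-1) ->
    forall x, d o x <= n%:R -> d x (f x) < n.+1%:R^-1.
  move=> nm h x hx; apply: lt_le_trans (h x _) _.
    by apply: le_trans hx _; rewrite ler_nat.
  by rewrite lef_pV2 ?posrE// ler_nat.
have FF : Filter F.
  split; first by exists 0%N.
    move=> P Q [n hP] [m hQ]; exists (maxn n m) => f hf; split.
      by apply: hP; apply: mono hf; rewrite leq_maxl.
    by apply: hQ; apply: mono hf; rewrite leq_maxr.
  by move=> P Q PQ [n hP]; exists n => f /hP /PQ.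
suff : F --> (id : {compact-open, M -> M}).
  move=> /(_ A hA) [n hn]; exists n%:R, n.+1%:R^-1; split => //.
apply/compact_open_cvgP => K O cK oO KO; apply: contrapT => hF.
have W (n : nat) : exists fx : (M -> M) * M, [/\ K fx.2, ~ O (fx.1 fx.2) &
    forall x, d o x <= n%:R -> d x (fx.1 x) < n.+1%:R^-1].
  apply: contrapT => hn; apply: hF; exists n => f hf _ [x Kx <-].
  by apply: contrapT => nO; apply: hn; exists (f, x).
have [fx hfx] := choice W.
have [U [UU oU]] := nat_ultrafilter.
pose u n := (fx n).2.
have := cK; rewrite compact_ultra => /(_ _ (ultra_fmap u UU)) [|x [Kx hx]].
  by apply: nearW => n; have [] := hfx n.
have Ox : O x by apply: KO; exists x.
have := oO; rewrite openE => /(_ x Ox); rewrite /interior.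
rewrite -metricType_numDomainType.filter_from_mdist_nbhs => -[e /= e0 he].
have e2 : 0 < e / 2 by rewrite divr_gt0.
have {}hx : \forall n \near U, d x (u n) < e / 2.
  by have /mcvgP := hx; exact.
have hT K' : \forall n \near U, K' <= n%:R :> R.
  by apply: oU; apply: filterS (nbhs_infty_gtr K') => n; exact: ltW.
have [n [h1 [h2 h3]]] := filter_ex (filterI hx
  (filterI (hT (d o x + e / 2)) (hT ((e / 2)^-1)))).
have [_ nO hd] := hfx n; apply: nO; apply: he => /=.
have h4 : d (u n) ((fx n).1 (u n)) < n.+1%:R^-1.
  by apply: hd; have := metric_triangle o x (u n); move: h1 h2 => /=; lra.
have h5 : n.+1%:R^-1 <= e / 2.
  rewrite -[leRHS]invrK lef_pV2 ?posrE ?invr_gt0//.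
  by apply: le_trans h3 _; rewrite ler_nat.
have := metric_triangle x (u n) ((fx n).1 (u n)); move: h1 => /=.
by move: (n.+1%:R^-1 : R) h4 h5 => a h4 h5; rewrite -/(u n); lra.
Qed.

End compact_open_identity.

(** * Discreteness bounds the orbit points in a ball *)

Section discreteness.
Context {R : realType} {X1 X2 : metricType R}.
Context (p1 : proper_space X1) (p2 : proper_space X2).
Local Notation G := ((X1 -> X1) * (X2 -> X2))%type.
Context (Gamma : set G).
Hypotheses (grp : isometry_group Gamma) (disc : discrete_group Gamma).
Implicit Types (gamma : G).

Lemma Gamma_dist1 gamma x y : Gamma gamma ->
  mdist (gamma.1 x) (gamma.1 y) = mdist x y.
Proof. by case: grp => h _ _ _ /h [[]]. Qed.

Lemma Gamma_dist2 gamma x y : Gamma gamma ->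
  mdist (gamma.2 x) (gamma.2 y) = mdist x y.
Proof. by case: grp => h _ _ _ /h [_ []]. Qed.

Lemma Gamma_dist gamma (x y : l2prod X1 X2) : Gamma gamma ->
  mdist (prod_act gamma x) (prod_act gamma y) = mdist x y.
Proof.
move=> hg; apply/eqP; rewrite -(@eqrXn2 _ 2) ?mdist_ge0//.
by rewrite !l2dist_sqr/= Gamma_dist1// Gamma_dist2.
Qed.

Lemma small_displacement (o : l2prod X1 X2) : exists (r e : R), 0 < e /\
  forall gamma, Gamma gamma ->
  (forall x, mdist o.1 x <= r -> mdist x (gamma.1 x) < e) ->
  (forall x, mdist o.2 x <= r -> mdist x (gamma.2 x) < e) ->
  gamma = (id, id).
Proof.
have [_ Gid _ _] := grp.
have [_ [V [[A B] [/= hA hB] AB] hV]] := disc Gid.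
have [r1 [e1 [e10 k1]]] := compact_open_nbhs_id o.1 hA.
have [r2 [e2 [e20 k2]]] := compact_open_nbhs_id o.2 hB.
exists (Num.max r1 r2), (Num.min e1 e2); split; first by rewrite lt_min e10.
move=> gamma hg m1 m2.
suff : (V `&` Gamma) gamma by rewrite hV.
split => //; apply: AB; split => /=.
  apply: k1 => x hx; have := m1 x; rewrite le_max hx => /(_ isT).
  by rewrite lt_min => /andP[].
apply: k2 => x hx; have := m2 x; rewrite le_max hx orbT => /(_ isT).
by rewrite lt_min => /andP[].
Qed.

Lemma code_close (M : metricType R) (t : seq M) (e L : R) (o x y : M) :
  (forall z, mdist o z <= L -> exists2 w, w \in t & mdist w z < e) ->
  mdist o x <= L -> mdist o y <= L ->
  find (fun w => mdist w x < e) t = find (fun w => mdist w y < e) t ->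
  mdist x y < e + e.
Proof.
move=> ht hx hy exy.
have H z : mdist o z <= L -> has (fun w => mdist w z < e) t.
  by move=> /ht[w wt hw]; apply/hasP; exists w.
have k1 := nth_find o (H x hx); have k2 := nth_find o (H y hy).
rewrite -exy in k2; apply: le_lt_trans (metric_triangle _ _ _) _; last first.
  by apply: ltrD k2; rewrite metric_sym; exact: k1.
Qed.

(** An element is coded by the approximate images of a finite net of the ball of radius [r]. Two
    elements with the same code differ on that ball by less than [e] and coincide by
    [small_displacement]. The bound does not depend on [p]. *)
Lemma orbit_bound (o : l2prod X1 X2) (K : R) : exists m : nat,
  forall (p : l2prod X1 X2) (s : seq G), uniq s ->
  (forall gamma, gamma \in s -> Gamma gamma /\ mdist p (prod_act gamma o) <= K) ->
  (size s <= m)%N.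
Proof.
have [r [e [e0 hre]]] := small_displacement o.
have e6 : 0 < e / 6 by rewrite divr_gt0.
have e3 : 0 < e / 3 by rewrite divr_gt0.
have [s1 hs1] := finite_net p1 o.1 r e3.
have [s2 hs2] := finite_net p2 o.2 r e3.
pose L1 := 2 * K + \sum_(z <- s1) mdist o.1 z.
pose L2 := 2 * K + \sum_(z <- s2) mdist o.2 z.
have [t1 ht1] := finite_net p1 o.1 L1 e6.
have [t2 ht2] := finite_net p2 o.2 L2 e6.
have Gcomp : forall g g', Gamma g -> Gamma g' ->
  Gamma (g.1 \o g'.1, g.2 \o g'.2) by case: grp.
have Ginv : forall g, Gamma g -> exists g', [/\ Gamma g',
  cancel g.1 g'.1 & cancel g.2 g'.2] by case: grp.
pose code (g : G) : {ffun 'I_(size s1) -> 'I_(size t1).+1} *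
                    {ffun 'I_(size s2) -> 'I_(size t2).+1} :=
  ([ffun j : 'I_(size s1) =>
     inord (find (fun w => mdist w (g.1 (nth o.1 s1 j)) < e / 6) t1)],
   [ffun j : 'I_(size s2) =>
     inord (find (fun w => mdist w (g.2 (nth o.2 s2 j)) < e / 6) t2)]).
exists #|{: {ffun 'I_(size s1) -> 'I_(size t1).+1} *
           {ffun 'I_(size s2) -> 'I_(size t2).+1}}|.
have base (s : seq G) : uniq s ->
    (forall g, g \in s -> Gamma g /\ mdist o (prod_act g o) <= 2 * K) ->
    (size s <= #|{: {ffun 'I_(size s1) -> 'I_(size t1).+1} *
           {ffun 'I_(size s2) -> 'I_(size t2).+1}}|)%N.
  move=> us hs.
  suff inj : {in s &, injective code}.
    rewrite -(size_map code s).
    have um : uniq (map code s) by rewrite map_inj_in_uniq.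
    by rewrite -(card_uniqP um); exact: max_card.
  move=> g g' gs g's [/ffunP c1 /ffunP c2].
  have [Gg og] := hs g gs; have [Gg' og'] := hs g' g's.
  have [k [Gk k1 k2]] := Ginv g Gg.
  have near1 x : mdist o.1 x <= r -> mdist (g.1 x) (g'.1 x) < e.
    move=> /hs1[z zs hz].
    have jz : (index z s1 < size s1)%N by rewrite index_mem.
    have := c1 (Ordinal jz); rewrite !ffunE/= nth_index//.
    move=> /(congr1 val)/=; rewrite !inordK ?ltnS ?find_size// => ef.
    have ze : mdist o.1 z <= \sum_(z <- s1) mdist o.1 z.
      by rewrite (big_rem z)//= lerDl sumr_ge0// => w _; exact: mdist_ge0.
    have b (h : G) : Gamma h -> mdist o (prod_act h o) <= 2 * K ->
        mdist o.1 (h.1 z) <= L1.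
      move=> Gh oh; have := mdist_fst_le o (prod_act h o).
      have := metric_triangle o.1 (h.1 o.1) (h.1 z).
      by rewrite Gamma_dist1// /L1/=; lra.
    have := code_close ht1 (b g Gg og) (b g' Gg' og') ef.
    have := metric_triangle (g.1 x) (g.1 z) (g'.1 x).
    have := metric_triangle (g.1 z) (g'.1 z) (g'.1 x).
    by rewrite !Gamma_dist1// (metric_sym x z); lra.
  have near2 x : mdist o.2 x <= r -> mdist (g.2 x) (g'.2 x) < e.
    move=> /hs2[z zs hz].
    have jz : (index z s2 < size s2)%N by rewrite index_mem.
    have := c2 (Ordinal jz); rewrite !ffunE/= nth_index//.
    move=> /(congr1 val)/=; rewrite !inordK ?ltnS ?find_size// => ef.
    have ze : mdist o.2 z <= \sum_(z <- s2) mdist o.2 z.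
      by rewrite (big_rem z)//= lerDl sumr_ge0// => w _; exact: mdist_ge0.
    have b (h : G) : Gamma h -> mdist o (prod_act h o) <= 2 * K ->
        mdist o.2 (h.2 z) <= L2.
      move=> Gh oh; have := mdist_snd_le o (prod_act h o).
      have := metric_triangle o.2 (h.2 o.2) (h.2 z).
      by rewrite Gamma_dist2// /L2/=; lra.
    have := code_close ht2 (b g Gg og) (b g' Gg' og') ef.
    have := metric_triangle (g.2 x) (g.2 z) (g'.2 x).
    have := metric_triangle (g.2 z) (g'.2 z) (g'.2 x).
    by rewrite !Gamma_dist2// (metric_sym x z); lra.
  have : (k.1 \o g'.1, k.2 \o g'.2) = (id, id).
    apply: hre; first exact: Gcomp.
      by move=> x /near1; rewrite -(Gamma_dist1 _ _ Gk) k1.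
    by move=> x /near2; rewrite -(Gamma_dist2 _ _ Gk) k2.
  have [k' [Gk' k'1 k'2]] := Ginv k Gk.
  move=> [e1 e2].
  have f1 : g'.1 = g.1.
    apply/funext => x; have := congr1 (fun f => f x) e1 => /= h.
    apply: (can_inj k'1); by rewrite h k1.
  have f2 : g'.2 = g.2.
    apply/funext => x; have := congr1 (fun f => f x) e2 => /= h.
    apply: (can_inj k'2); by rewrite h k2.
  by case: g g' f1 f2 {gs g's c1 c2 Gg og Gg' og' k1 k2 near1 near2 e1 e2}
    => [? ?] [? ?] /= -> ->.
(* For a general [p], the inverse of one element of the list brings all its orbit points within
   [2 * K] of [o]. *)
move=> p [//|g s] us hs.
have [Gg pg] := hs g (mem_head _ _).
have [k [Gk k1 k2]] := Ginv g Gg.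
pose sh (h : G) : G := (k.1 \o h.1, k.2 \o h.2).
rewrite -(size_map sh); apply: base.
  rewrite map_inj_in_uniq// => a b _ _ [ea eb].
  have [k' [Gk' k'1 k'2]] := Ginv k Gk.
  have f1 : a.1 = b.1.
    by apply/funext => x; apply: (can_inj k'1); exact: (congr1 (fun f => f x) ea).
  have f2 : a.2 = b.2.
    by apply/funext => x; apply: (can_inj k'2); exact: (congr1 (fun f => f x) eb).
  by case: a b f1 f2 {ea eb} => [? ?] [? ?] /= -> ->.
move=> _ /mapP[h hs' ->]; have [Gh ph] := hs h hs'; split; first exact: Gcomp.
have -> : prod_act (sh h) o = prod_act k (prod_act h o) by [].
have {1}-> : o = prod_act k (prod_act g o).
  by rewrite /prod_act/= k1 k2; case: (o).
rewrite Gamma_dist//; have := metric_triangle (prod_act g o) p (prod_act h o).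
by rewrite (metric_sym _ p); lra.
Qed.

End discreteness.

(** * Rays passing near a point, and shadows *)

Section passing_rays.
Context {R : realType} {M : metricType R} (hM : npc M) (pM : proper_space M).
Local Notation d := (@mdist R M).

(** Segments converge to [rho] uniformly on bounded intervals, and the passage near [o] happens
    before time [B]. The extra 1 in the radius pays for the convergence. *)
Lemma limit_ray_passes (U : set_system nat) (c rho : R -> M) (o : M)
    (ls : nat -> R) (r : R) : UltraFilter U -> \oo `<=` U ->
  is_ray c -> is_ray rho -> asymp rho c -> 0 <= r ->
  (\forall n \near U, 0 <= ls n <= 1 /\
     d o (pt hM (rho 0) (c n%:R) (ls n)) <= r) ->
  exists2 s : R, 0 <= s & d o (rho s) < r + 1.
Proof.
move=> UU oU hc hr has_ r0 hl.
pose y := rho 0; pose B := d y o + r + 1.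
have B0 : 0 < B by have := mdist_ge0 y o; rewrite /B; lra.
have hT K : \forall n \near U, K <= n%:R :> R by exact: ultra_infty.
have hB := geo_to_ray hM pM hc hr has_ hT (ltW B0).
move/mcvgP : (hB UU) => /(_ _ ltr01) {}hB.
have hesc := escaping_ray (U := U) hc hT.
have [n [[hl1 hl2] [h3 h4]]] := filter_ex (filterI hl (filterI hB (hesc UU y B))).
pose s := ls n * d y (c n%:R); have [l0 l1] := andP hl1.
have s0 : 0 <= s by rewrite mulr_ge0// mdist_ge0.
have ps : pt hM y (c n%:R) (ls n) = geo hM y (c n%:R) s by rewrite pt_geo.
have sd : s <= d y (c n%:R) by rewrite ler_piMl// mdist_ge0.
have sB : s <= B.
  have := metric_triangle y o (geo hM y (c n%:R) s).
  rewrite d_geo ?s0//; move: hl2; rewrite -/y ps /B; lra.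
exists s => //.
have hs : 0 <= s <= B by rewrite s0.
have e1 : geo hM y (c n%:R) s = pt hM y (geo hM y (c n%:R) B) (s / B).
  by rewrite -(geo_geo hM hs h4) /geo d_geo// (ltW B0).
have e2 : rho s = pt hM y (rho B) (s / B).
  by rewrite (ray_geo hM hr hs) /geo (ray_dist hr (ltW B0)).
have h5 : d (geo hM y (c n%:R) s) (rho s) < 1.
  rewrite e1 e2; apply: le_lt_trans (pt_convex1 hM _ _ _ (ratio01 hs)) _.
  have /andP[q0 q1] := ratio01 hs.
  apply: le_lt_trans (_ : d (geo hM y (c n%:R) B) (rho B) < 1).
    by rewrite ler_piMl// mdist_ge0.
  by rewrite metric_sym.
have := metric_triangle o (geo hM y (c n%:R) s) (rho s).
by move: hl2; rewrite -/y ps; lra.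
Qed.

End passing_rays.

Lemma ultra_pigeonhole (T : finType) (U : set_system nat) (f : nat -> T) :
  UltraFilter U -> exists v, \forall n \near U, f n = v.
Proof.
move=> UU; apply: contrapT => hn.
have H v : \forall n \near U, f n <> v.
  have [h|//] := in_ultra_setVsetC [set n | f n = v] UU.
  by exfalso; apply: hn; exists v.
have hall : \forall n \near U, forall v, f n <> v by exact: filter_forall.
by have [n /(_ (f n))] := filter_ex hall.
Qed.

Section shadows.
Context {R : realType} {X1 X2 : metricType R}.
Context (h1 : npc X1) (p1 : proper_space X1) (h2 : npc X2) (p2 : proper_space X2).
Local Notation X := (l2prod X1 X2).
Local Notation G := ((X1 -> X1) * (X2 -> X2))%type.
Local Notation rayX := (ray_to (npc_l2prod h1 h2) (proper_l2prod p1 p2)).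
Implicit Types (x y p : X) (xi : boundary X) (gamma : G).

Definition shadow x p (r : R) : set (boundary X) :=
  [set xi | (exists2 s : R, 0 <= s & mdist p.1 (rayX x xi s).1 < r) /\
            (exists2 t : R, 0 <= t & mdist p.2 (rayX x xi t).2 < r)].

Lemma shadow_open x p r : open (shadow x p r).
Proof.
have -> : shadow x p r =
    (\bigcup_(s in [set s : R | 0 <= s]) [set xi | mdist p.1 (rayX x xi s).1 < r]) `&`
    (\bigcup_(s in [set s : R | 0 <= s]) [set xi | mdist p.2 (rayX x xi s).2 < r]).
  by apply/seteqP; split => xi [[s s0 hs] [t t0 ht]]; split; [exists s|exists t|exists s|exists t].
apply: openI; apply: bigcup_open => s s0.
  apply: (@lipschitz_open _ _ _ _ (fun y : X => mdist p.1 y.1)) => // y z.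
  apply: le_trans (metric_triangle _ z.1 _) _.
  by rewrite lerD2l metric_sym mdist_fst_le.
apply: (@lipschitz_open _ _ _ _ (fun y : X => mdist p.2 y.2)) => // y z.
apply: le_trans (metric_triangle _ z.2 _) _.
by rewrite lerD2l metric_sym mdist_snd_le.
Qed.

Context (Gamma : set G) (grp : isometry_group Gamma).

Lemma shadow_equivariant gamma x p r : Gamma gamma ->
  boundary_map (prod_act gamma) @^-1` shadow (prod_act gamma x) (prod_act gamma p) r
  = shadow x p r.
Proof.
move=> hg.
have H xi t : 0 <= t -> rayX (prod_act gamma x) (boundary_map (prod_act gamma) xi) t
    = prod_act gamma (rayX x xi t).
  by move=> t0; apply: boundary_map_ray_to => // *; exact: (Gamma_dist grp).
apply/seteqP; split => xi /= [[s s0 hs] [t t0 ht]]; split.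
- by exists s => //; move: hs; rewrite H//= (Gamma_dist1 grp).
- by exists t => //; move: ht; rewrite H//= (Gamma_dist2 grp).
- by exists s => //; rewrite H//= (Gamma_dist1 grp).
- by exists t => //; rewrite H//= (Gamma_dist2 grp).
Qed.

Lemma iter_Gamma (n : nat) (g : G) : Gamma g -> Gamma (iter n g.1, iter n g.2).
Proof.
have [_ Gid Gc _] := grp => hg; elim: n => [//|n IH].
exact: (Gc _ _ hg IH).
Qed.

Context (theta : R) (theta_range : 0 < theta < pi / 2).

Let cos0 : 0 < cos theta.
Proof.
by apply: cos_gt0_pihalf; move: theta_range => /andP[? ?]; apply/andP; split; lra.
Qed.

Let sin0 : 0 < sin theta.
Proof.
by apply: sin_gt0_pi; move: theta_range => /andP[? ?]; apply/andP; split; lra.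
Qed.

(* The extension lemma, applied to points going to [xi], gives elements moving
   [xi] into the shadow; a pigeonhole along an ultrafilter picks one of them. *)
Lemma shadows_cover (g h : G) (o : X) : Gamma g -> Gamma h ->
  rank_one g.1 -> rank_one h.1 -> independent g.1 h.1 ->
  rank_one g.2 -> rank_one h.2 -> independent g.2 h.2 ->
  exists (F : seq G) (r : R), [/\ 0 <= r, forall w, w \in F -> Gamma w &
    forall y xi, boundary_slope theta xi ->
    exists2 w, w \in F & shadow y o r (boundary_map (prod_act w) xi)].
Proof.
move=> Gg Gh g1 k1 i1 g2 k2 i2.
have [iso Gid Gc Ginv] := grp.
have inv k : Gamma k -> exists k', [/\ Gamma k', cancel k'.1 k.1 & cancel k'.2 k.2].
  move=> Gk; have [k' [Gk' c1 c2]] := Ginv k Gk; exists k'.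
  have [[_ s1] [_ s2]] := iso k Gk.
  by split => // z; [have [w <-] := s1 z; rewrite c1|have [w <-] := s2 z; rewrite c2].
have [g' [Gg' gc1 gc2]] := inv g Gg; have [h' [Gh' hc1 hc2]] := inv h Gh.
have [L1 fa1] := rank_one_four_axes g1 k1 i1 gc1 hc1.
have [L2 fa2] := rank_one_four_axes g2 k2 i2 gc2 hc2.
have [N [r hN]] := extension_lemma h1 p1 h2 p2 fa1 fa2 o.
pose el (a : bool * bool) : G := if a.1 then if a.2 then g else g'
                                 else if a.2 then h else h'.
have Gel a : Gamma (el a) by case: a => [[] []].
pose word (ab : (bool * bool) * (bool * bool)) : G :=
  (iter N (el ab.1).1 \o iter N (el ab.2).1, iter N (el ab.1).2 \o iter N (el ab.2).2).
have Gword ab : Gamma (word ab).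
  exact: (Gc _ _ (iter_Gamma N (Gel ab.1)) (iter_Gamma N (Gel ab.2))).
have r0 : 0 <= r.
  have [a [b [[l _ hl] _]]] := hN o o; apply: le_trans hl; exact: mdist_ge0.
exists [seq word ab | ab : (bool * bool) * (bool * bool)], (r + 1).
split; [by lra|by move=> _ /mapP[ab _ ->]|].
move=> y xi [eta1 [eta2 [c [c1 [c2 [cxi _ _ cE]]]]]].
(* The factors are followed at the same parameter [n], not along [c]: what matters in the limit is
   the endpoint of [c1] and that of [c2]. *)
have W (n : nat) : exists ab : (bool * bool) * (bool * bool),
  (exists2 l : R, 0 <= l <= 1 &
    mdist o.1 (pt h1 y.1 ((word ab).1 (c1 n%:R)) l) <= r) /\
  (exists2 l : R, 0 <= l <= 1 &
    mdist o.2 (pt h2 y.2 ((word ab).2 (c2 n%:R)) l) <= r).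
  have [a [b [q1 q2]]] := hN y ((c1 n%:R, c2 n%:R) : X).
  exists (a, b); rewrite /word/el/=; split.
    by have [l hl hl'] := q1; exists l => //; move: hl'; case: a b {q1 q2} => [[] []] [[] []].
  by have [l hl hl'] := q2; exists l => //; move: hl'; case: a b {q1 q2} => [[] []] [[] []].
have [f hf] := choice W.
have [U [UU oU]] := nat_ultrafilter.
have [ab hab] := ultra_pigeonhole f UU.
exists (word ab); first by apply/mapP; exists ab => //; rewrite mem_enum.
have Q1 n : exists l : R, f n = ab -> 0 <= l <= 1 /\
    mdist o.1 (pt h1 y.1 ((word ab).1 (c1 n%:R)) l) <= r.
  by have [[l hl hl'] _] := hf n; exists l => <-.
have Q2 n : exists l : R, f n = ab -> 0 <= l <= 1 /\
    mdist o.2 (pt h2 y.2 ((word ab).2 (c2 n%:R)) l) <= r.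
  by have [_ [l hl hl']] := hf n; exists l => <-.
have [l1 hl1] := choice Q1; have [l2 hl2] := choice Q2.
have rc1 : is_ray ((word ab).1 \o c1).
  move=> s t s0 t0; rewrite -(rayP c1)//.
  exact: (Gamma_dist1 grp _ _ (Gword ab)).
have rc2 : is_ray ((word ab).2 \o c2).
  move=> s t s0 t0; rewrite -(rayP c2)//.
  exact: (Gamma_dist2 grp _ _ (Gword ab)).
have [rho1 rr1 [rho10 as1]] := ray_from h1 p1 y.1 rc1.
have [rho2 rr2 [rho20 as2]] := ray_from h2 p2 y.2 rc2.
have [s1 s10 hs1] : exists2 s : R, 0 <= s & mdist o.1 (rho1 s) < r + 1.
  apply: (@limit_ray_passes _ _ h1 p1 U _ rho1 o.1 l1 r UU oU rc1 rr1 as1 r0).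
  by rewrite rho10; apply: filterS hab => n /(hl1 n).
have [s2 s20 hs2] : exists2 s : R, 0 <= s & mdist o.2 (rho2 s) < r + 1.
  apply: (@limit_ray_passes _ _ h2 p2 U _ rho2 o.2 l2 r UU oU rc2 rr2 as2 r0).
  by rewrite rho20; apply: filterS hab => n /(hl2 n).
have rr := product_ray rr1 rr2 (ltW cos0) (ltW sin0).
have e t : 0 <= t -> rayX y (boundary_map (prod_act (word ab)) xi) t =
    (rho1 (t * cos theta), rho2 (t * sin theta)).
  move=> t0; apply: (ray_to_unique _ _ (a := Ray (asboolT rr))) => //=; last first.
    by rewrite !mul0r rho10 rho20; case: (y).
  apply/esym; rewrite -cxi; apply: boundary_map_endpoint.
    by move=> *; exact: (Gamma_dist grp).
  apply: asymp_sym; have [K1 hK1] := as1; have [K2 hK2] := as2.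
  exists (K1 + K2) => t' t'0; apply: le_trans (mdist_le_add _ _) _ => /=.
  rewrite cE//= lerD//; first by apply: hK1; rewrite mulr_ge0// ltW.
  by apply: hK2; rewrite mulr_ge0// ltW.
split.
  exists (s1 / cos theta); first by rewrite divr_ge0// ltW.
  rewrite e ?divr_ge0 ?(ltW cos0)//= divfK// gt_eqF//.
exists (s2 / sin theta); first by rewrite divr_ge0// ltW.
by rewrite e ?divr_ge0 ?(ltW sin0)//= divfK// gt_eqF.
Qed.

(** In the first factor, passing near [o.1] at factor time [s] gives the bound [r - s], and [s] is
    at least [mdist o.1 y.1 - r]. The second is the same. *)
Lemma shadow_busemann y o r xi eta1 eta2 : shadow y o r xi ->
  has_coordinates xi eta1 eta2 theta ->
  busemann eta1 o.1 y.1 <= 2 * r - mdist o.1 y.1 /\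
  busemann eta2 o.2 y.2 <= 2 * r - mdist o.2 y.2.
Proof.
move=> [[s s0 hs] [t t0 ht]] hc.
have es := coordinates_ray_to h1 p1 h2 p2 y (ltW cos0) (ltW sin0) hc s0.
have et := coordinates_ray_to h1 p1 h2 p2 y (ltW cos0) (ltW sin0) hc t0.
rewrite es/= in hs; rewrite et/= in ht.
have s0' : 0 <= s * cos theta by rewrite mulr_ge0// ltW.
have t0' : 0 <= t * sin theta by rewrite mulr_ge0// ltW.
split.
  apply: le_trans (busemann_ray_le s0' (ltW hs)) _.
  have := ray_dist (ray_to_ray h1 p1 y.1 eta1) s0'; rewrite ray_to0.
  have := metric_triangle o.1 (ray_to h1 p1 y.1 eta1 (s * cos theta)) y.1.
  by rewrite (metric_sym (ray_to _ _ _ _ _)); lra.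
apply: le_trans (busemann_ray_le t0' (ltW ht)) _.
have := ray_dist (ray_to_ray h2 p2 y.2 eta2) t0'; rewrite ray_to0.
have := metric_triangle o.2 (ray_to h2 p2 y.2 eta2 (t * sin theta)) y.2.
by rewrite (metric_sym (ray_to _ _ _ _ _)); lra.
Qed.

Lemma size_fibers (T : finType) (A : eqType) (f : A -> T) (s : seq A) (m : nat) :
  (forall c, (size [seq x <- s | f x == c] <= m)%N) -> (size s <= #|T| * m)%N.
Proof.
move=> hm.
have -> : size s = (\sum_(c : T) size [seq x <- s | f x == c])%N.
  elim: s {hm} => [|x s IH] /=; first by rewrite big1.
  rewrite IH (bigD1 (f x))//= [RHS](bigD1 (f x))//= eqxx/= addSn; congr (_ + _).+1.
  by apply: eq_bigr => c; rewrite eq_sym => /negbTE ->.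
by rewrite -sum_nat_const leq_sum.
Qed.

(** A ray passing within [r] of [q] does so at about time [mdist (a 0) q], so the integer part of
    this distance can replace the unknown passage time. *)
Lemma floor_close (M : metricType R) (a : R -> M) (q : M) (s r : R) (n : nat) :
  is_ray a -> 0 <= s -> mdist q (a s) < r -> mdist (a 0) q <= n%:R ->
  exists k : 'I_n.+1, mdist (a k%:R) q <= 2 * r + 1 /\ k = inord (Num.truncn (mdist (a 0) q)).
Proof.
move=> ra s0 hs hn.
have D0 := mdist_ge0 (a 0) q.
have /andP[k0 k1] := truncn_itv D0.
set k := Num.truncn _ in k0 k1 *.
have kn : (k < n.+1)%N by rewrite ltnS -(@ler_nat R); exact: le_trans hn.
exists (inord k); rewrite inordK//; split => //.
have := metric_triangle (a k%:R) (a s) q.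
rewrite ra//; have := ray_dist ra s0.
have := metric_triangle (a 0) (a s) q; have := metric_triangle (a 0) q (a s).
rewrite (metric_sym (a s) q) -natr1 in k1 * => t1 t2 t3 t4.
have : `|k%:R - s| <= r + 1 by rewrite ler_norml; apply/andP; split; lra.
lra.
Qed.

(** Elements with the same integer parts of both displacements have their orbit points near one
    point [(a1 k1, a2 k2)], where [orbit_bound] applies; there are [n.+1 * n.+1] pairs of integer
    parts. *)
Lemma shadow_multiplicity (o : X) (r : R) : discrete_group Gamma ->
  exists m : nat, forall (n : nat) xi (s : seq G), boundary_slope theta xi ->
  uniq s -> (forall gamma, gamma \in s -> [/\ Gamma gamma,
    mdist o (prod_act gamma o) <= n%:R & shadow o (prod_act gamma o) r xi]) ->
  (size s <= (n.+1 * n.+1) * m)%N.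
Proof.
move=> disc.
have [m hm] := orbit_bound p1 p2 grp disc o (2 * (2 * r + 1)).
exists m => n xi s [eta1 [eta2 hc]] us hs.
pose a1 := ray_to h1 p1 o.1 eta1; pose a2 := ray_to h2 p2 o.2 eta2.
pose f (g : G) : 'I_n.+1 * 'I_n.+1 :=
  (inord (Num.truncn (mdist o.1 (g.1 o.1))), inord (Num.truncn (mdist o.2 (g.2 o.2)))).
have -> : (n.+1 * n.+1 = #|{: 'I_n.+1 * 'I_n.+1}|)%N by rewrite card_prod card_ord.
apply: (size_fibers (f := f)) => -[k1 k2].
apply: (hm ((a1 k1%:R, a2 k2%:R) : X)); first exact: filter_uniq.
move=> g; rewrite mem_filter => /andP[/eqP[e1 e2] /hs[Gg gn [[u u0 hu] [t t0 ht]]]].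
split => //; apply: le_trans (mdist_le_add _ _) _ => /=.
rewrite (coordinates_ray_to h1 p1 h2 p2 o (ltW cos0) (ltW sin0) hc u0)/= in hu.
rewrite (coordinates_ray_to h1 p1 h2 p2 o (ltW cos0) (ltW sin0) hc t0)/= in ht.
have u0' : 0 <= u * cos theta by rewrite mulr_ge0// ltW.
have t0' : 0 <= t * sin theta by rewrite mulr_ge0// ltW.
have b1 : mdist (a1 0) (g.1 o.1) <= n%:R.
  by rewrite /a1 ray_to0; apply: le_trans gn; exact: (mdist_fst_le o (prod_act g o)).
have b2 : mdist (a2 0) (g.2 o.2) <= n%:R.
  by rewrite /a2 ray_to0; apply: le_trans gn; exact: (mdist_snd_le o (prod_act g o)).
have [j1 [q1 ej1]] := floor_close (ray_to_ray h1 p1 o.1 eta1) u0' hu b1.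
have [j2 [q2 ej2]] := floor_close (ray_to_ray h2 p2 o.2 eta2) t0' ht b2.
rewrite ray_to0 e1 in ej1; rewrite ray_to0 e2 in ej2.
by rewrite -ej1 -ej2 mulrDl mul1r; move: q1 q2; rewrite /a1 /a2; lra.
Qed.

End shadows.

(** * Densities and the growth of orbits *)

Section measure_facts.
Local Open Scope ereal_scope.
Context (dd : measure_display) (T : measurableType dd) (R : realType).
Implicit Types (mu nu : {finite_measure set T -> \bar R}) (A S : set T).

Lemma Radon_Nikodym_bounds mu nu A (k K : R) :
  nu `<< mu -> measurable A -> (0 <= k)%R -> (0 <= K)%R ->
  {ae mu, forall x, A x ->
    k%:E <= Radon_Nikodym (charge_of_finite_measure nu) mu x <= K%:E} ->
  k%:E * mu A <= nu A <= K%:E * mu A.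
Proof.
move=> numu mA k0 K0 hae; set f := Radon_Nikodym _ _ in hae.
have numu' : charge_of_finite_measure nu `<< mu by [].
have -> : nu A = \int[mu]_(x in A) f x by exact: Radon_Nikodym_integral numu' mA.
have mf : measurable_fun A f.
  apply: (measurable_funS measurableT) => //.
  exact: measurable_int (Radon_Nikodym_integrable numu').
(* Equal to [f] almost everywhere on [A], and nonnegative everywhere as monotonicity of the integral
   asks. *)
pose g x := maxe (f x) k%:E.
have mg : measurable_fun A g.
  by apply: measurable_maxe => //; exact: measurable_cst.
have g0 x : 0 <= g x by rewrite /g le_max lee_fin k0 orbT.
have -> : \int[mu]_(x in A) f x = \int[mu]_(x in A) g x.
  apply: ae_eq_integral => //; apply: filterS hae => x h Ax.
  by have /andP[h1 _] := h Ax; rewrite /g max_l.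
rewrite -!integral_cst//; apply/andP; split.
  by apply: ge0_le_integral => // x _; rewrite /g /= le_max lexx orbT.
apply: ae_ge0_le_integral => //.
apply: filterS hae => x h Ax; have /andP[h1 h2] := h Ax.
by rewrite /g ge_max h2 (le_trans h1 h2).
Qed.

Lemma sum_measure_multiplicity mu S (I : Type) (A : I -> set T) (s : seq I) (K : nat) :
  measurable S -> (forall i, measurable (A i)) ->
  (forall x, S x -> (size [seq i <- s | x \in A i] <= K)%N) ->
  \sum_(i <- s) mu (A i `&` S) <= K%:R%:E * mu S.
Proof.
move=> mS mA hK.
have mi i : measurable_fun S (fun x => (\1_(A i) x)%:E).
  by apply/measurable_EFinP; apply: (measurable_funS measurableT) => //;
    exact: measurable_indic.
have i0 i x : 0 <= (\1_(A i) x)%:E :> \bar R by rewrite lee_fin.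
under eq_bigr do rewrite -integral_indic//.
rewrite -ge0_integral_sum// -integral_cst//.
apply: ge0_le_integral => //.
- by move=> x _; apply: sume_ge0 => i _.
- by apply: emeasurable_sum => i.
move=> x Sx; rewrite sumEFin lee_fin.
apply: (@le_trans _ _ (size [seq i <- s | x \in A i])%:R%R); last first.
  by rewrite ler_nat hK.
rewrite size_filter -sum1_count natr_sum [leRHS]big_mkcond/= ler_sum// => i _.
by rewrite indicE; case: (x \in A i).
Qed.

Lemma measure_le_sum mu S (I : eqType) (A : I -> set T) (s : seq I) :
  measurable S -> (forall i, i \in s -> measurable (A i)) ->
  (forall x, S x -> exists2 i, i \in s & A i x) ->
  mu S <= \sum_(i <- s) mu (A i).
Proof.
elim: s S => [|a s IH] S mS mA hS.
  rewrite big_nil (_ : S = set0) ?measure0//.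
  by apply/seteqP; split => // x /hS[].
rewrite big_cons; have ma : measurable (A a) by apply: mA; rewrite mem_head.
apply: (@le_trans _ _ (mu (A a `|` (S `\` A a)))).
  apply: le_measure; rewrite ?inE//; first by apply: measurableU => //; exact: measurableD.
  by move=> x Sx; have [|] := pselect (A a x); [left|right].
apply: le_trans (measureU2 _ _ _) _ => //; first exact: measurableD.
apply: leeD => //; apply: IH; first exact: measurableD.
  by move=> i si; apply: mA; rewrite inE si orbT.
move=> x [Sx nA]; have [i] := hS x Sx; rewrite inE => /orP[/eqP ->//|si Ai].
by exists i.
Qed.

End measure_facts.

Section support.
Context {R : realType} {M : metricType R} (hM : npc M) (pM : proper_space M).
Context (xi0 : boundary M) (mu : {finite_measure set (borel_boundary xi0) -> \bar R}).

Lemma open_measurable_boundary (U : set (boundary M)) : open U ->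
  measurable (U : set (borel_boundary xi0)).
Proof. by move=> oU; apply: sub_sigma_algebra. Qed.

Let S : set (boundary M) := [set xi | forall U : set (boundary M),
  open_nbhs xi U -> (0 < mu U)%E].

(** The complement of the support is covered by null open sets; [boundary_lindelof] makes the cover
    countable. *)
Lemma support_full : measurable (S : set (borel_boundary xi0)) /\ mu (~` S) = 0%E.
Proof.
have P0 : mu set0 = 0%E by rewrite measure0.
have oN : open (~` S : set (boundary M)).
  rewrite openE => xi /existsNP[U /not_implyP[[oU Uxi] nU]].
  rewrite /interior nbhsE/=; exists U => // zeta Uz hz.
  by apply: nU; apply: hz.
have mN := open_measurable_boundary oN.
split; first by rewrite -(setCK S); exact: measurableC.
have hN xi : (~` S) xi -> exists U : set (boundary M),
    [/\ open U, U xi & mu U = 0%E].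
  move=> /existsNP[V /not_implyP[[oV Vxi] nV]].
  by exists V; split => //; apply/eqP; rewrite -measure_le0 leNgt; exact/negP.
have [U [hU cov]] := @boundary_lindelof R M hM pM (ray_fun (endray xi0) 0)
  (~` S) (fun U => mu U = 0%E) P0 hN.
apply/(negligibleP _ mN); apply: (@negligibleS _ _ _ mu _ _ cov).
apply: negligible_bigcup => i; apply: negligible_bigcup => j.
have [oU U0] := hU i j; apply/negligibleP => //.
exact: open_measurable_boundary.
Qed.

End support.

(** * The shadow lemma *)

Section shadow_lemma.
Context {R : realType} {X1 X2 : metricType R}.
Context (h1 : npc X1) (p1 : proper_space X1) (h2 : npc X2) (p2 : proper_space X2).
Local Notation X := (l2prod X1 X2).
Local Notation G := ((X1 -> X1) * (X2 -> X2))%type.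
Context (Gamma : set G) (grp : isometry_group Gamma).
Context (theta b1 b2 : R) (theta_range : 0 < theta < pi / 2) (o : X).
Context (xi0 : boundary X)
  (mu : X -> {finite_measure set (borel_boundary xi0) -> \bar R}).
Hypothesis dens : is_density Gamma o b1 b2 theta mu.

Local Notation S := (msupport (mu o)).
Local Notation sh := (shadow h1 p1 h2 p2).

Lemma density_support_full : measurable (S : set (borel_boundary xi0)) /\
  mu o (~` S) = 0%E.
Proof. exact: (support_full (npc_l2prod h1 h2) (proper_l2prod p1 p2)). Qed.

Let mS : measurable (S : set (borel_boundary xi0)).
Proof. by have [] := density_support_full. Qed.

(** By absolute continuity every [mu x] vanishes off the support of [mu o], the set on which the
    density formula is given. *)
Lemma density_setI_support x (A : set (borel_boundary xi0)) : measurable A ->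
  mu x A = mu x (A `&` S).
Proof.
move=> mA; have [_ S0] := density_support_full.
have [_ /(_ x)[_ _ dom _]] := dens.
have mS' := measurableC mS.
have S0x : mu x (~` S) = 0%E.
  apply: (dom (~` S)) => // E mE ES.
  apply/eqP; rewrite -measure_le0 -S0; apply: le_measure; rewrite ?inE//.
rewrite -{1}(setIT A) -(setUCr S) setIUr measureU//.
- rewrite [X in (_ + X)%E](_ : _ = 0%E) ?adde0//.
  apply/eqP; rewrite -measure_le0 -S0x; apply: le_measure; rewrite ?inE//.
  exact: measurableI.
- exact: measurableI.
- exact: measurableI.
- by rewrite setIACA setICr setI0.
Qed.

Lemma density_bounds x (A : set (borel_boundary xi0)) (k K : R) : measurable A ->
  0 <= k -> 0 <= K ->
  (forall xi eta1 eta2, A xi -> has_coordinates xi eta1 eta2 theta ->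
    k <= expR (b1 * busemann eta1 o.1 x.1 + b2 * busemann eta2 o.2 x.2) <= K) ->
  (k%:E * mu o (A `&` S) <= mu x A <= K%:E * mu o (A `&` S))%E.
Proof.
move=> mA k0 K0 hA; rewrite (density_setI_support x mA).
have [_ /(_ x)[_ _ dom rn]] := dens.
have [_ /(_ o)[[_ Sub] _ _ _]] := dens.
apply: Radon_Nikodym_bounds => //; first exact: measurableI.
have FF := ae_filter_ringOfSetsType (mu o).
move: rn; apply: filterS => xi h [Axi Sxi].
have [_ [eta1 [eta2 co]]] := Sub _ Sxi.
by rewrite (h Sxi _ _ co) !lee_fin; apply: hA co.
Qed.

Lemma Gamma_inverse gamma : Gamma gamma -> exists gamma', [/\ Gamma gamma',
  cancel (prod_act gamma) (prod_act gamma' : X -> X) &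
  cancel (prod_act gamma') (prod_act gamma : X -> X)].
Proof.
move=> Gg; have [iso _ _ /(_ _ Gg)[gamma' [Gg' c1 c2]]] := grp.
have [[_ s1] [_ s2]] := iso _ Gg.
exists gamma'; split => //= -[x y]; rewrite /prod_act/=; first by rewrite c1 c2.
by have [u <-] := s1 x; have [v <-] := s2 y; rewrite c1 c2.
Qed.

Lemma shadow_preimage gamma y p r : Gamma gamma -> exists2 gamma', Gamma gamma' &
  boundary_map (prod_act gamma) @^-1` sh y p r =
  sh (prod_act gamma' y) (prod_act gamma' p) r.
Proof.
move=> Gg; have [gamma' [Gg' c1 c2]] := Gamma_inverse Gg; exists gamma' => //.
have := shadow_equivariant h1 p1 h2 p2 grp (prod_act gamma' y) (prod_act gamma' p) r Gg.
by rewrite !c2.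
Qed.

Lemma shadow_measurable y p r : measurable (sh y p r : set (borel_boundary xi0)).
Proof. by apply: open_measurable_boundary; exact: shadow_open. Qed.

Lemma measure_translate_le w (V : set (borel_boundary xi0)) : measurable V ->
  (mu (prod_act w o) V <=
   (expR (`|b1| * mdist o.1 (w.1 o.1) + `|b2| * mdist o.2 (w.2 o.2)))%:E *
   mu o (V `&` S))%E.
Proof.
move=> mV.
set K : R := expR _.
suff H xi eta1 eta2 : V xi -> has_coordinates xi eta1 eta2 theta -> 0 <=
    expR (b1 * busemann eta1 o.1 (w.1 o.1) + b2 * busemann eta2 o.2 (w.2 o.2)) <= K.
  have /andP[_ //] := density_bounds (x := prod_act w o) mV (lexx 0) (expR_ge0 _) H.
move=> _ _; rewrite expR_ge0 ler_expR /=.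
have B1 := busemann_le eta1 o.1 (w.1 o.1).
have B2 := busemann_le eta2 o.2 (w.2 o.2).
have C1 := busemann_ge eta1 o.1 (w.1 o.1).
have C2 := busemann_ge eta2 o.2 (w.2 o.2).
have aux (b u v : R) : - v <= u -> u <= v -> b * u <= `|b| * v.
  by case: (lerP 0 b) => b0 *; [rewrite ger0_norm//|rewrite ltr0_norm//]; nra.
by apply: lerD; apply: aux.
Qed.

Lemma total_mass_gt0 : (0 < mu o setT)%E.
Proof.
have [_ /(_ o)[[[xi Sxi] _] _ _ _]] := dens.
by apply: Sxi; split => //; exact: openT.
Qed.

Context (g h : G) (Gg : Gamma g) (Gh : Gamma h).
Context (g1 : rank_one g.1) (k1 : rank_one h.1) (i1 : independent g.1 h.1).
Context (g2 : rank_one g.2) (k2 : rank_one h.2) (i2 : independent g.2 h.2).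

(** Finitely many preimages of the shadow cover the support. By invariance and conformality the mass
    of each is at most a constant times that of the shadow, and the constants do not depend on
    [y]. *)
Lemma shadow_mass : exists (r c : R), [/\ 0 <= r, 0 < c &
  forall y, (c%:E <= mu o (sh y o r `&` S))%E].
Proof.
have [F [r [r0 FG cov]]] :=
  shadows_cover h1 p1 h2 p2 grp theta_range o Gg Gh g1 k1 i1 g2 k2 i2.
pose K (w : G) : R :=
  expR (`|b1| * mdist o.1 (w.1 o.1) + `|b2| * mdist o.2 (w.2 o.2)).
pose T : R := \sum_(w <- F) K w.
have T0 : 0 <= T by apply: sumr_ge0 => w _; exact: expR_ge0.
have fin (A : set (borel_boundary xi0)) : measurable A -> mu o A \is a fin_num.
  exact: fin_num_measure.
have m0 : 0 < fine (mu o setT).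
  by rewrite fine_gt0// total_mass_gt0/= ltey_eq fin.
(* The 1 keeps the denominator positive without any knowledge of the length of [F]. *)
exists r, (fine (mu o setT) / (T + 1)); split => //.
  by rewrite divr_gt0//; lra.
move=> y; have mV := shadow_measurable y o r.
have mVS := measurableI _ _ mV mS.
have bnd : (mu o setT <= T%:E * mu o (sh y o r `&` S))%E.
  rewrite density_setI_support// setTI.
  have [_ /(_ o)[[_ Sub] inv _ _]] := dens.
  apply: (@le_trans _ _ (\sum_(w <- F)
      mu o (boundary_map (prod_act w) @^-1` sh y o r))%E).
    apply: measure_le_sum => //.
      move=> w /FG Gw; have [w' _ ->] := shadow_preimage y o r Gw.
      exact: shadow_measurable.
    by move=> xi /Sub[_ /(cov y)].
  rewrite /T -sumEFin ge0_sume_distrl; last by move=> w _; rewrite lee_fin expR_ge0.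
  rewrite big_seq [leRHS]big_seq; apply: lee_sum => w /FG Gw.
  by rewrite inv//; apply: measure_translate_le.
have Ea := esym (fineK (fin _ mVS)); have Eb := esym (fineK (fin _ measurableT)).
have a0 : 0 <= fine (mu o (sh y o r `&` S)) by rewrite fine_ge0.
move: (fine _) (fine _) Ea Eb a0 m0 bnd => a b -> -> a0 b0.
by rewrite -EFinM !lee_fin => ?; rewrite ler_pdivrMr; lra.
Qed.

(** Invariance moves the light source: the shadow of [gamma o] seen from [o] becomes that of [o]
    seen from [y], the image of [o] under the inverse, measured by [mu y]. Its [mu o] mass is
    bounded below by [shadow_mass]. *)
Lemma shadow_lower_bound : exists (r c : R), [/\ 0 <= r, 0 < c &
  forall gamma, Gamma gamma ->
  ((c * expR (- (b1 * mdist o.1 (gamma.1 o.1) + b2 * mdist o.2 (gamma.2 o.2))))%:E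
    <= mu o (sh o (prod_act gamma o) r))%E].
Proof.
have [r [c [r0 c0 mass]]] := shadow_mass.
exists r, (c * expR (- (2 * r * (`|b1| + `|b2|)))); split => //.
  by rewrite mulr_gt0// expR_gt0.
move=> gamma Gga; have [k [Gk ck kc]] := Gamma_inverse Gga.
have [_ /(_ o)[_ inv _ _]] := dens.
set y := prod_act k o.
have d1 : mdist o.1 y.1 = mdist o.1 (gamma.1 o.1).
  rewrite -(Gamma_dist1 grp o.1 y.1 Gga) metric_sym.
  by rewrite (_ : gamma.1 y.1 = o.1)//; exact: (congr1 (fun q => q.1) (kc o)).
have d2 : mdist o.2 y.2 = mdist o.2 (gamma.2 o.2).
  rewrite -(Gamma_dist2 grp o.2 y.2 Gga) metric_sym.
  by rewrite (_ : gamma.2 y.2 = o.2)//; exact: (congr1 (fun q => q.2) (kc o)).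
have -> : mu o (sh o (prod_act gamma o) r) = mu y (sh y o r).
  rewrite -(inv _ Gk); last exact: shadow_measurable.
  have := shadow_equivariant h1 p1 h2 p2 grp o (prod_act gamma o) r Gk.
  by rewrite ck => ->.
pose q : R := expR (- (2 * r * (`|b1| + `|b2|)) -
  (b1 * mdist o.1 y.1 + b2 * mdist o.2 y.2)).
pose K : R := expR (`|b1| * mdist o.1 y.1 + `|b2| * mdist o.2 y.2).
have H xi eta1 eta2 : sh y o r xi -> has_coordinates xi eta1 eta2 theta -> q <=
    expR (b1 * busemann eta1 o.1 y.1 + b2 * busemann eta2 o.2 y.2) <= K.
  move=> sxi co; rewrite /q /K !ler_expR.
  have [U1 U2] := shadow_busemann theta_range sxi co.
  have B1 := busemann_le eta1 o.1 y.1.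
  have B2 := busemann_le eta2 o.2 y.2.
  have C1 := busemann_ge eta1 o.1 y.1.
  have C2 := busemann_ge eta2 o.2 y.2.
  move: B1 B2 C1 C2 U1 U2.
  move: (busemann _ _ _) (busemann _ _ _) => u1 u2 B1 B2 C1 C2 U1 U2.
  (* For the left inequality, [b >= 0] uses the lower bound on [u], and [b < 0] uses
     [u <= 2 * r - v]; the latter produces the loss [2 * r * |b|]. *)
  have aux (b u v : R) : - v <= u -> u <= v -> u <= 2 * r - v ->
      - (2 * r * `|b|) - b * v <= b * u /\ b * u <= `|b| * v.
    by case: (lerP 0 b) => b0 *; [rewrite ger0_norm//|rewrite ltr0_norm//]; split; nra.
  have [L1 L2] := aux b1 _ _ C1 B1 U1; have [L3 L4] := aux b2 _ _ C2 B2 U2.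
  by apply/andP; split; lra.
have /andP[bnd _] := density_bounds (x := y) (shadow_measurable y o r)
  (expR_ge0 _) (expR_ge0 _) H.
apply: le_trans bnd; rewrite -d1 -d2 -mulrA -expRD -/q mulrC EFinM.
by apply: lee_wpmul2l; rewrite ?lee_fin ?expR_ge0.
Qed.

End shadow_lemma.

(** * Elementary growth estimates *)

Section growth.
Context {R : realType}.

Lemma angle_of_polar (a b : R) : 0 <= a -> 0 <= b ->
  let rho := Num.sqrt (a ^+ 2 + b ^+ 2) in
  a = rho * cos (angle_of a b) /\ b = rho * sin (angle_of a b).
Proof.
move=> a0 b0 /=; rewrite /angle_of; have [->|an0] := eqVneq a 0.
  by rewrite cos_pihalf sin_pihalf expr0n/= add0r sqrtr_sqr ger0_norm// mulr0 mulr1.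
have {}a0 : 0 < a by rewrite lt_neqAle eq_sym an0.
pose x : R := b / a; have x0 : 0 <= x by rewrite divr_ge0// ltW.
have bE : b = a * x by rewrite /x; field.
have -> : Num.sqrt (a ^+ 2 + b ^+ 2) = a * Num.sqrt (1 + x ^+ 2).
  rewrite bE (_ : _ + _ = a ^+ 2 * (1 + x ^+ 2)); last by ring.
  by rewrite sqrtrM ?sqr_ge0// sqrtr_sqr ger0_norm// ltW.
have s0 : Num.sqrt (1 + x ^+ 2) != 0.
  by rewrite gt_eqF// sqrtr_gt0; have := sqr_ge0 x; lra.
have ca := cos_atan x.
have c0 : cos (atan x) != 0 by rewrite ca invr_neq0.
have -> : sin (atan x) = x * cos (atan x).
  by rewrite -{2}(atanK x) /tan -mulrA mulVf ?mulr1.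
by rewrite -/x ca bE; split; field.
Qed.

Lemma linear_angle_continuous (b1 b2 theta e : R) : 0 < e -> exists2 eps : R,
  0 < eps & forall alpha, `|alpha - theta| < eps ->
    b1 * cos alpha + b2 * sin alpha <= b1 * cos theta + b2 * sin theta + e.
Proof.
move=> e0.
have : (fun x : R => b1 * cos x + b2 * sin x) x @[x --> theta] -->
    b1 * cos theta + b2 * sin theta.
  by apply: cvgD; apply: cvgM; try exact: cvg_cst;
    [exact: continuous_cos|exact: continuous_sin].
move=> /cvgrPdist_lt/(_ _ e0)/nbhs_ballP[eps/= eps0 H].
exists eps => // alpha Ha.
have : `|b1 * cos theta + b2 * sin theta - (b1 * cos alpha + b2 * sin alpha)| < e.
  by apply: H; rewrite /ball/= distrC.
by rewrite ltr_norml => /andP[]; lra.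
Qed.

Lemma poly_le_exp (C e : R) : 0 < e ->
  \forall n \near \oo, C * (n.+1 * n.+1)%:R <= expR (n%:R * e).
Proof.
(* Since [a <= 1] and [a <= e / 4], [a * N <= 1 + n e / 4], whose fourth power is below the
   exponential; two of the four factors [N] absorb [|C| / a ^+ 4]. *)
move=> e0; pose a : R := Num.min 1 (e / 4).
have a0 : 0 < a by rewrite lt_min ltr01/=; lra.
have a1 : a <= 1 by rewrite ge_min lexx.
have a2 : a <= e / 4 by rewrite ge_min lexx orbT.
near=> n.
pose N : R := n.+1%:R.
have N1 : 1 <= N by rewrite ler1n.
have EN : N = n%:R + 1 by rewrite /N -natr1.
have nN : `|C| / a ^+ 4 < n%:R by near: n; exact: nbhs_infty_gtr.
have CN : `|C| <= a ^+ 4 * N ^+ 2.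
  rewrite -ler_pdivrMl ?exprn_gt0// mulrC (le_trans (ltW nN))//.
  by rewrite expr2 EN; have : 0 <= n%:R :> R by []; nra.
rewrite natrM -/N.
apply: (@le_trans _ _ ((a * N) ^+ 4)).
  rewrite (_ : (a * N) ^+ 4 = a ^+ 4 * N ^+ 2 * (N * N)); last by ring.
  apply: ler_wpM2r; first by rewrite mulr_ge0//; lra.
  exact: le_trans (ler_norm _) CN.
have -> : n%:R * e = 4%:R * (n%:R * (e / 4)) by field.
rewrite (expRM_natl 4); have aN : a * N <= expR (n%:R * (e / 4)).
  apply: le_trans (expR_ge1Dx _).
  by rewrite EN; have : 0 <= n%:R :> R by []; nra.
have aN0 : 0 <= a * N by rewrite mulr_ge0//; lra.
by rewrite lerXn2r// nnegrE ?expR_ge0.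
Unshelve. all: by end_near.
Qed.

Lemma limn_esup_le (u : nat -> \bar R) (L : \bar R) :
  (\forall n \near \oo, (u n <= L)%E) -> (limn_esup u <= L)%E.
Proof.
move=> H; apply: (@le_trans _ _ (ereal_sup (u @` [set n | (u n <= L)%E]))).
  by apply: ereal_inf_lbound; exists [set n | (u n <= L)%E].
by apply: ge_ereal_sup => _ [n /= h <-].
Qed.

Lemma limf_einf_le (F : set_system R) (f : R -> \bar R) (L : \bar R) :
  (forall A, F A -> exists2 x, A x & (f x <= L)%E) -> (limf_einf f F <= L)%E.
Proof.
move=> H; rewrite /limf_einf leeNl; apply: le_ereal_inf_tmp => _ [A FA <-].
have [x Ax fx] := H A FA.
apply: (@le_trans _ _ (- f x)%E); first by rewrite leeN2.
by apply: ereal_sup_ubound; exists x.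
Qed.

Lemma counting_le (T : choiceType) (A : set T) (K : R) :
  (forall s : seq T, uniq s -> (forall x, x \in s -> A x) -> (size s)%:R <= K) ->
  (counting A <= K%:E :> \bar R)%E.
Proof.
move=> H; have finA : finite_set A.
  apply: contrapT => /(infinite_set_fset (Num.truncn K).+1)[B BA sB].
  have := H _ (finmap.fset_uniq B) BA.
  have : K < (Num.truncn K).+1%:R by rewrite truncnS_gt.
  have : (Num.truncn K).+1%:R <= (size (finmap.enum_fset B))%:R :> R by rewrite ler_nat.
  lra.
rewrite /counting asboolT// lee_fin; apply: H; first exact: finmap.fset_uniq.
by move=> x; rewrite in_fset_set// inE.
Qed.

End growth.

(** * Counting orbit points by their shadows *)

Section orbit_growth.
Context {R : realType} {X1 X2 : metricType R}.
Context (h1 : npc X1) (p1 : proper_space X1) (h2 : npc X2) (p2 : proper_space X2).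
Local Notation X := (l2prod X1 X2).
Local Notation G := ((X1 -> X1) * (X2 -> X2))%type.
Context (Gamma : set G) (grp : isometry_group Gamma) (disc : discrete_group Gamma).
Context (theta b1 b2 : R) (theta_range : 0 < theta < pi / 2) (o : X).
Context (xi0 : boundary X)
  (mu : X -> {finite_measure set (borel_boundary xi0) -> \bar R}).
Hypothesis dens : is_density Gamma o b1 b2 theta mu.
Context (g h : G) (Gg : Gamma g) (Gh : Gamma h).
Context (g1 : rank_one g.1) (k1 : rank_one h.1) (i1 : independent g.1 h.1).
Context (g2 : rank_one g.2) (k2 : rank_one h.2) (i2 : independent g.2 h.2).
Local Notation d1 gamma := (mdist o.1 (gamma.1 o.1)).
Local Notation d2 gamma := (mdist o.2 (gamma.2 o.2)).

(** Two estimates of the sum of the masses of the shadows: each is at least [c * expR (- L)], and by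
    the multiplicity bound the sum is at most [n.+1 * n.+1 * m] times the mass of the support. *)
Lemma orbit_size_bound : exists2 C : R, 0 <= C & forall (n : nat) (L : R) (s : seq G),
  uniq s -> (forall gamma, gamma \in s -> [/\ Gamma gamma,
    mdist o (prod_act gamma o) <= n%:R & b1 * d1 gamma + b2 * d2 gamma <= L]) ->
  (size s)%:R <= C * (n.+1 * n.+1)%:R * expR L.
Proof.
have [r [c [r0 c0 lower]]] := shadow_lower_bound h1 p1 h2 p2 grp theta_range dens
  Gg Gh g1 k1 i1 g2 k2 i2.
have [m mult] := shadow_multiplicity h1 p1 h2 p2 grp theta_range o r disc.
have [mS _] := density_support_full h1 p1 h2 p2 o mu.
have M0 : 0 <= fine (mu o (msupport (mu o))) by rewrite fine_ge0.
exists (m%:R * fine (mu o (msupport (mu o))) / c).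
  by rewrite divr_ge0 ?mulr_ge0// ltW.
move=> n L s us hs.
have [_ /(_ o)[[_ Sub] _ _ _]] := dens.
pose sh gamma : set (borel_boundary xi0) :=
  shadow h1 p1 h2 p2 o (prod_act gamma o) r.
have up : (\sum_(gamma <- s) mu o (sh gamma `&` msupport (mu o)) <=
    (((n.+1 * n.+1) * m)%N%:R)%:E * mu o (msupport (mu o)))%E.
  apply: sum_measure_multiplicity => //; first by move=> gamma; exact: shadow_measurable.
  move=> xi /Sub[_ slope]; apply: (mult n xi) => //; first exact: filter_uniq.
  move=> gamma; rewrite mem_filter => /andP[]; rewrite inE => sxi /hs[? ? _].
  by split.
have low : (((size s)%:R * (c * expR (- L)))%:E <=
    \sum_(gamma <- s) mu o (sh gamma `&` msupport (mu o)))%E.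
  have -> : (size s)%:R * (c * expR (- L)) = \sum_(gamma <- s) (c * expR (- L)).
    by rewrite big_const_seq count_predT iter_addr_0 mulr_natl.
  rewrite -sumEFin big_seq [leRHS]big_seq; apply: lee_sum => gamma /hs[Gga _ hL].
  rewrite -(density_setI_support h1 p1 h2 p2 dens); last exact: shadow_measurable.
  apply: le_trans (lower gamma Gga); rewrite lee_fin ler_pM2l// ler_expR; lra.
have := le_trans low up.
rewrite -(fineK (fin_num_measure (mu o) _ mS)) -EFinM lee_fin natrM => H.
rewrite -(ler_pM2r (mulr_gt0 c0 (expR_gt0 (- L)))) (le_trans H)//.
rewrite le_eqVlt; apply/orP; left; apply/eqP.
have e1 : expR L * expR (- L) = 1 by rewrite -expRD subrr expR0.
move: (fine _) (expR L) (expR (- L)) e1 => F u v e1 /=.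
transitivity (m%:R * F / c * (n.+1 * n.+1)%:R * (c * (u * v))); last by ring.
by rewrite e1; field; rewrite gt_eqF.
Qed.

Lemma growth_exponent_le :
  (growth_exponent Gamma o theta <= (b1 * cos theta + b2 * sin theta)%:E)%E.
Proof.
set kappa := b1 * cos theta + b2 * sin theta.
apply/lee_addgt0Pr => e e0.
have e20 : 0 < e / 2 by rewrite divr_gt0.
have [eps eps0 Heps] := linear_angle_continuous b1 b2 theta e20.
have [C C0 bound] := orbit_size_bound.
(* Half of [e] pays for slopes differing from [theta], the other half for the polynomial and
   constant factors. *)
pose K : R := kappa + e / 2.
apply: limf_einf_le => A FA.
have [x [Ax xeps]] := filter_ex (filterI FA (nbhs_right_lt eps0)).
exists x => //; apply: limn_esup_le.
near=> n.
have n0 : 0 < n%:R :> R by rewrite ltr0n; near: n; exact: nbhs_infty_gt.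
have nC : C * expR `|K| * (n.+1 * n.+1)%:R <= expR (n%:R * (e / 2)).
  by near: n; exact: poly_le_exp.
have cnt : (orbit_count Gamma o theta x n <= (expR (n%:R * (kappa + e)))%:E)%E.
  apply: counting_le => s us hs.
  have HL gamma : gamma \in s -> [/\ Gamma gamma,
      mdist o (prod_act gamma o) <= n%:R &
      b1 * d1 gamma + b2 * d2 gamma <= n%:R * K + `|K|].
    move=> /hs[Gga [/andP[lo up] ang]]; split => //.
    have [E1 E2] := angle_of_polar (mdist_ge0 o.1 (gamma.1 o.1)) (mdist_ge0 o.2 (gamma.2 o.2)).
    have := Heps _ (lt_trans ang xeps).
    have dE : mdist o (prod_act gamma o) = Num.sqrt (d1 gamma ^+ 2 + d2 gamma ^+ 2) by [].
    rewrite -dE in E1 E2; have := mdist_ge0 o (prod_act gamma o).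
    move: (d1 gamma) (d2 gamma) (cos _) (sin _) (mdist o _) E1 E2 lo up
      => a b ca sa rho -> -> lo up rho0; rewrite -/kappa -/K => /(ler_wpM2l rho0) le.
    (* [rho] lies between [n - 1] and [n]; the term [|K|] covers the loss when [K] is negative. *)
    apply: (@le_trans _ _ (rho * K)); first by lra.
    by case: (lerP 0 K) => K0; [rewrite ger0_norm//|rewrite ltr0_norm//]; nra.
  apply: (le_trans (bound n _ s us HL)).
  rewrite expRD (_ : n%:R * (kappa + e) = n%:R * K + n%:R * (e / 2)); last first.
    by rewrite /K; field.
  rewrite expRD mulrCA ler_pM2l ?expR_gt0//.
  by rewrite mulrAC.
apply: (@le_trans _ _ ((n%:R^-1)%:E * (n%:R * (kappa + e))%:E)%E); last first.
  by rewrite -EFinM mulKf ?gt_eqF.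
apply: lee_wpmul2l; first by rewrite lee_fin invr_ge0 ltW.
rewrite -[X in (_ <= X%:E)%E]expRK -lne_EFin ?expR_gt0// lee_lne//.
  by rewrite in_itv/= leey andbT /orbit_count /counting; case: ifP => //= _; rewrite lee_fin.
by rewrite in_itv/= lee_fin expR_ge0 leey.
Unshelve. all: by end_near.
Qed.

End orbit_growth.

Theorem theoremC (R : realType) (X1 X2 : metricType R)
  (hX1 : hadamard X1) (hX2 : hadamard X2)
  (lcX1 : locally_compact [set: X1]) (lcX2 : locally_compact [set: X2])
  (Gamma : set ((X1 -> X1) * (X2 -> X2)))
  (Gamma_group : isometry_group Gamma) (Gamma_discrete : discrete_group Gamma)
  (g h : (X1 -> X1) * (X2 -> X2)) (Gamma_g : Gamma g) (Gamma_h : Gamma h)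
  (g1_rank_one : rank_one g.1) (h1_rank_one : rank_one h.1)
  (gh1_independent : independent g.1 h.1)
  (g2_rank_one : rank_one g.2) (h2_rank_one : rank_one h.2)
  (gh2_independent : independent g.2 h.2)
  (o : l2prod X1 X2)
  (theta b1 b2 : R) (theta_range : 0 < theta < pi / 2) :
  density_exists Gamma o b1 b2 theta ->
  (growth_exponent Gamma o theta <= (b1 * cos theta + b2 * sin theta)%:E)%E.
Proof.
move=> [xi0 [mu dens]].
have [c1 geo1 cat1] := hX1; have [c2 geo2 cat2] := hX2.
have n1 := CAT0_npc geo1 cat1; have n2 := CAT0_npc geo2 cat2.
have p1 := geodesic_hopf_rinow n1 c1 lcX1; have p2 := geodesic_hopf_rinow n2 c2 lcX2.
exact: (growth_exponent_le n1 p1 n2 p2 Gamma_group Gamma_discrete theta_range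
  dens Gamma_g Gamma_h).
Qed.
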